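(* Let $n \ge 2$, $k \in \{1,\dots,n-1\}$, let $K \in \mathcal{K}^n$ with $\mathcal{E}_J(K) = \mathbb{B}^n$, and let $E \subset K$ be a $k$-ellipsoid. Then $$\mathrm{vol}_k(E) \le \mathrm{vol}_k\left(\sqrt{\frac{n}{k}\min\left\{\frac{s_J(K)+1}{2},\frac{n+1}{k+1}\right\}}\;\mathbb{B}^k\right),$$ with equality if and only if both of the following hold: (i) $E$ is a Euclidean $k$-ball of radius $\sqrt{\frac{n}{k}\min\{\frac{s_J(K)+1}{2},\frac{n+1}{k+1}\}}$, and (ii) the center $c$ of $E$ satisfies $E \subset \left\{x \in \mathbb{R}^n : c^T x = n\left(\min\{\frac{s_J(K)+1}{2},\frac{n+1}{k+1}\} - 1\right)\right\}$. Moreover, the inequality is best possible precisely for any prescribed $s_J(K) \notin (1, 1+\frac{2}{n})$; that is, for $s \in [1,n]$, there exist $K \in \mathcal{K}^n$ with $\mathcal{E}_J(K) = \mathbb{B}^n$ and $s_J(K) = s$ and a $k$-ellipsoid $E \subset K$ attaining equality in the inequality if and only if $s \notin (1,1+\frac{2}{n})$.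
   Context: $\mathcal{K}^n$ is the family of convex bodies in $\mathbb{R}^n$, i.e., compact convex sets with non-empty interior. $\mathbb{B}^n$ is the closed Euclidean unit ball in $\mathbb{R}^n$, and $\mathrm{vol}_k$ is $k$-dimensional volume. A $k$-ellipsoid is the image of $\mathbb{B}^k$ under an injective affine map $\mathbb{R}^k \to \mathbb{R}^n$; a Euclidean $k$-ball of radius $\rho$ is a set $c + \rho(\mathbb{B}^n \cap V)$ with $V$ a $k$-dimensional linear subspace. The John ellipsoid $\mathcal{E}_J(K)$ of $K \in \mathcal{K}^n$ is the (unique) volume-maximal $n$-ellipsoid contained in $K$; its center is denoted $c_J(K)$. The John asymmetry of $K$ is $s_J(K) = \inf\{\rho \ge 0 : K - c_J(K) \subset \rho\,(c_J(K) - K)\}$; it always takes values in $[1,n]$. *)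

(* Defs.v *)
From HB Require Import structures.
From mathcomp Require Import all_boot all_order all_algebra.
From mathcomp Require Import all_classical all_reals all_analysis.

Set Implicit Arguments.
Unset Strict Implicit.
Unset Printing Implicit Defensive.

Import Order.TTheory GRing.Theory Num.Theory.
Import numFieldNormedType.Exports.

Local Open Scope classical_set_scope.
Local Open Scope ring_scope.

(* R^n is the type 'cV[R]_n of column vectors.  Its library topology is the
   usual one, but the library norm on matrices is the sup norm, so that the
   Euclidean structure has to be introduced separately. *)

Definition dotp (R : realType) (n : nat) (x y : 'cV[R]_n) : R :=
  (x^T *m y) ord0 ord0.

Definition enorm (R : realType) (n : nat) (x : 'cV[R]_n) : R :=
  Num.sqrt (dotp x x).

Definition eball (R : realType) (n : nat) : set 'cV[R]_n :=
  [set x | enorm x <= 1].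
Arguments eball : clear implicits.

Definition dilate (R : realType) (n : nat) (r : R) (A : set 'cV[R]_n) :
    set 'cV[R]_n :=
  [set r *: x | x in A].

Definition convex_body (R : realType) (n : nat) (K : set 'cV[R]_n) : Prop :=
  [/\ compact K, convex_set (K : set (convex_lmodType 'cV[R]_n))
    & interior K !=set0].

(* A box is given by its lower and upper corners. *)
Definition box (R : realType) (k : nat) (a b : 'cV[R]_k) : set 'cV[R]_k :=
  [set x | forall i, a i ord0 <= x i ord0 <= b i ord0].

Definition box_vol (R : realType) (k : nat) (a b : 'cV[R]_k) : R :=
  \prod_(i < k) (b i ord0 - a i ord0).

(* Lebesgue outer measure on R^k, i.e. Lebesgue measure on measurable sets
   (it is only applied to ellipsoids below): infimum of the total volumes of
   the countable coverings by boxes. *)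
Definition leb (R : realType) (k : nat) (A : set 'cV[R]_k) : \bar R :=
  ereal_inf [set v | exists a b : nat -> 'cV[R]_k,
    [/\ forall j i, a j i ord0 <= b j i ord0,
        A `<=` \bigcup_j box (a j) (b j)
      & v = (\sum_(0 <= j <oo) (box_vol (a j) (b j))%:E)%E]].

(* k-dimensional volume of a set E contained in some k-dimensional affine
   subspace of R^n: the Lebesgue measure of E read in an isometric affine chart
   y |-> c + Q y of such a subspace.  By invariance of Lebesgue measure under
   isometries all the values in the infimum agree. *)
Definition kvol (R : realType) (n k : nat) (E : set 'cV[R]_n) : \bar R :=
  ereal_inf [set leb [set y | E (cQ.1 + cQ.2 *m y)] |
    cQ in [set cQ : 'cV[R]_n * 'M[R]_(n, k) |
      cQ.2^T *m cQ.2 = 1%:M /\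
      E `<=` [set cQ.1 + cQ.2 *m y | y in [set: 'cV[R]_k]]]].

Definition ellipsoid_at (R : realType) (n k : nat) (c : 'cV[R]_n)
    (E : set 'cV[R]_n) : Prop :=
  exists A : 'M[R]_(n, k),
    injective (fun y : 'cV[R]_k => c + A *m y) /\
    E = [set c + A *m y | y in eball R k].

Definition ellipsoid (R : realType) (n k : nat) (E : set 'cV[R]_n) : Prop :=
  exists c, ellipsoid_at k c E.

Definition ellipsoid_center (R : realType) (n k : nat) (E : set 'cV[R]_n) :
    'cV[R]_n :=
  get [set c | ellipsoid_at k c E].

Definition euclidean_ball (R : realType) (n k : nat) (r : R)
    (E : set 'cV[R]_n) : Prop :=
  exists (c : 'cV[R]_n) (V : {vspace 'cV[R]_n}), \dim V = k /\
    E = [set c + r *: x | x in eball R n `&` [set x | x \in V]].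

Definition max_ellipsoid (R : realType) (n : nat) (K E : set 'cV[R]_n) : Prop :=
  [/\ ellipsoid n E, E `<=` K
    & forall E', ellipsoid n E' -> E' `<=` K -> (leb E' <= leb E)%E].

(* Existence and uniqueness of the maximal ellipsoid is John's theorem; the
   default value set0 is never the value for a convex body. *)
Definition john_ellipsoid (R : realType) (n : nat) (K : set 'cV[R]_n) :
    set 'cV[R]_n :=
  xget set0 [set E | max_ellipsoid K E].

Definition john_center (R : realType) (n : nat) (K : set 'cV[R]_n) : 'cV[R]_n :=
  ellipsoid_center n (john_ellipsoid K).

Definition john_asymmetry (R : realType) (n : nat) (K : set 'cV[R]_n) : R :=
  inf [set r : R | 0 <= r /\
    [set x - john_center K | x in K] `<=`
    dilate r [set john_center K - x | x in K]].

Definition min_factor (R : realType) (n k : nat) (s : R) : R :=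
  Num.min ((s + 1) / 2) ((n%:R + 1) / (k%:R + 1)).

Definition max_radius (R : realType) (n k : nat) (s : R) : R :=
  Num.sqrt (n%:R / k%:R * min_factor n k s).

(* Main.v *)
Require Import Defs.
From mathcomp Require Import all_boot all_order all_algebra.
From mathcomp Require Import all_classical all_reals all_analysis.
From mathcomp Require Import ring lra zify.
From mathcomp Require Import measurable_realfun.

(** By John's theorem the unit ball [B] is the maximal ellipsoid of [K] exactly
    when [B] is contained in [K] and there are contact points [u i] with weights
    [lam i > 0] such that [\sum_i lam i *: u i = 0] and
    [\sum_i lam i *: (u i *m (u i)^T) = 1%:M] (a [john_frame]); here [K] lies in
    the half-spaces [u i . x <= 1].  One direction ([john_ellipsoid_frame]) comes
    from separating a point from the convex hull of the pairs [(u u^T, u)] and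
    perturbing the ball, the other ([john_frame_ellipsoid]) from the
    inequality between the arithmetic and the geometric mean and its equality
    case, as the estimates below with [k = n] bound the trace of [T] by [n].

    Upper bound.  Let [E = c + A B] with [A = Q T], where the columns of [Q] are
    orthonormal and [T] is upper triangular with positive diagonal.  Then the
    volume of [E] is [\det T] times that of the unit ball, and
    [\det T <= (P / k) ^ k] with [P = \tr T = \tr (Q^T A)], so it suffices to bound
    [P ^ 2] by [k n] times the factor of the theorem.  Put [a i = |A^T u i|], the
    half-width of [E] in the direction [u i], so that [E] being in [K] yields
    [a i <= 1 - u i . c] and [a i <= s + u i . c], hence [a i <= (s + 1) / 2].
    Put further [S = \tr (A^T A) = \sum_i lam i a i ^ 2], [m = \sum_i lam i a i],
    which is at most [n], and [g = - \sum_i lam i a i u i].  Then [P ^ 2 <= k S] by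
    the Cauchy-Schwarz inequality, and [S <= m (s + 1) / 2] gives the first term
    of the minimum.  For the second one,
    - [S <= m + g . c], from [a i ^ 2 <= a i (1 - u i . c)];
    - [P ^ 2 + |g| ^ 2 <= m ^ 2], from a sum of squares;
    - [g . c <= |g| ^ 2 + (n - m) |g|], as [c - g] is the sum of the vectors
      [- lam i (1 - u i . c - a i) u i], whose lengths add up to [n - m].
    Adding up, [P ^ 2 + S <= m (n + 1)], so [(k + 1) P ^ 2 <= k n (n + 1)].

    Equality.  All inequalities become equalities, so [A] is a multiple of [Q],
    i.e. [E] is a ball, [m = n], [g = c], [|c| ^ 2 = S - n], and [c] turns out to
    be orthogonal to the range of [Q]; the last two facts are condition (ii).  Conversely (i)
    determines the volume.  If the first term of the minimum is attained,
    then each [a i = 1 - u i . c] is [0] or [(s + 1) / 2].  For [1 < s < 1 + 2 / n]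
    the center would satisfy [0 < |c| < 1], so that no [a i] vanishes and
    [0 = \sum_i lam i (u i . c) = n (1 - s) / 2], a contradiction
    ([no_equality]).

    Sharpness.  The body is the polytope of the points with
    [- s <= u i . x <= 1] for a frame in the product of [R ^ k] and [R ^ N],
    [N = n - k], that is symmetric in the first factor; its second components
    are those of a cross-polytope for [s = 1] and of two parallel simplices for [s >= 1 + 2 / n].

    Lebesgue measure on [R ^ k] being an infimum over coverings by boxes, its
    behaviour under linear maps is derived by Gaussian elimination from the case
    of shears, and its positivity on the ball by slicing and integration. *)

(** * Euclidean space *)

Import Order.TTheory GRing.Theory Num.Theory.
Import numFieldNormedType.Exports.
Local Open Scope classical_set_scope.
Local Open Scope ring_scope.
Set Implicit Arguments.
Unset Strict Implicit.
Unset Printing Implicit Defensive.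

Section Euclid.
Variable R : realType.
Implicit Types n k : nat.

Lemma dotpE n (x y : 'cV[R]_n) : dotp x y = \sum_i x i ord0 * y i ord0.
Proof. by rewrite /dotp mxE; apply: eq_bigr => i _; rewrite mxE. Qed.

Lemma dotp_tr n (x y : 'cV[R]_n) : dotp x y = \tr (x^T *m y).
Proof. by rewrite /dotp /mxtrace big_ord1. Qed.

Lemma dotpC n (x y : 'cV[R]_n) : dotp x y = dotp y x.
Proof. by rewrite !dotpE; apply: eq_bigr => i _; rewrite mulrC. Qed.

Lemma dotpDl n (x y z : 'cV[R]_n) : dotp (x + y) z = dotp x z + dotp y z.
Proof. by rewrite /dotp linearD mulmxDl mxE. Qed.

Lemma dotpDr n (x y z : 'cV[R]_n) : dotp x (y + z) = dotp x y + dotp x z.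
Proof. by rewrite /dotp mulmxDr mxE. Qed.

Lemma dotpZl n r (x y : 'cV[R]_n) : dotp (r *: x) y = r * dotp x y.
Proof. by rewrite /dotp linearZ -scalemxAl mxE. Qed.

Lemma dotpZr n r (x y : 'cV[R]_n) : dotp x (r *: y) = r * dotp x y.
Proof. by rewrite /dotp -scalemxAr mxE. Qed.

Lemma dotpNl n (x y : 'cV[R]_n) : dotp (- x) y = - dotp x y.
Proof. by rewrite -scaleN1r dotpZl mulN1r. Qed.

Lemma dotpNr n (x y : 'cV[R]_n) : dotp x (- y) = - dotp x y.
Proof. by rewrite -scaleN1r dotpZr mulN1r. Qed.

Lemma dotp0l n (x : 'cV[R]_n) : dotp 0 x = 0.
Proof. by rewrite -(scale0r x) dotpZl mul0r. Qed.

Lemma dotp0r n (x : 'cV[R]_n) : dotp x 0 = 0.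
Proof. by rewrite dotpC dotp0l. Qed.

Definition dotpL := (dotpDl, dotpNl, dotpZl, dotpDr, dotpNr, dotpZr).

Lemma dotp_suml n (I : finType) (P : pred I) (F : I -> 'cV[R]_n) y :
  dotp (\sum_(i | P i) F i) y = \sum_(i | P i) dotp (F i) y.
Proof.
elim/big_rec2 : _ => [|i u v _ <-]; first by rewrite dotp0l.
by rewrite dotpDl.
Qed.

Lemma dotp_sumr n (I : finType) (P : pred I) (F : I -> 'cV[R]_n) y :
  dotp y (\sum_(i | P i) F i) = \sum_(i | P i) dotp y (F i).
Proof. by rewrite dotpC dotp_suml; apply: eq_bigr => i _; rewrite dotpC. Qed.

Lemma dotp_adjoint n k (A : 'M[R]_(n, k)) x y :
  dotp (A *m x) y = dotp x (A^T *m y).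
Proof. by rewrite /dotp trmx_mul mulmxA. Qed.

Lemma dotp_ge0 n (x : 'cV[R]_n) : 0 <= dotp x x.
Proof. by rewrite dotpE sumr_ge0 // => i _; rewrite -expr2 sqr_ge0. Qed.

Lemma dotp_eq0 n (x : 'cV[R]_n) : dotp x x = 0 -> x = 0.
Proof.
rewrite dotpE => /eqP; rewrite psumr_eq0; last by move=> i _; rewrite -expr2 sqr_ge0.
move=> /allP x0; apply/colP => i; rewrite mxE; apply/eqP.
by have := x0 i (mem_index_enum _); rewrite -expr2 sqrf_eq0.
Qed.

Lemma dotp_gt0 n (x : 'cV[R]_n) : x != 0 -> 0 < dotp x x.
Proof.
move=> x0; rewrite lt_def dotp_ge0 andbT; apply: contraNneq x0 => h.
by apply/eqP/dotp_eq0.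
Qed.

Lemma colE_dotp n (x : 'cV[R]_n) i : x i ord0 = dotp (delta_mx i ord0) x.
Proof.
rewrite dotpE (bigD1 i) //= mxE !eqxx mul1r big1 ?addr0 // => j ji.
by rewrite mxE (negbTE ji) mul0r.
Qed.

Lemma dotp_ext n (x y : 'cV[R]_n) : (forall z, dotp z x = dotp z y) -> x = y.
Proof. by move=> h; apply/colP => i; rewrite !colE_dotp. Qed.

Lemma enorm_ge0 n (x : 'cV[R]_n) : 0 <= enorm x.
Proof. exact: sqrtr_ge0. Qed.

Lemma enorm_sqr n (x : 'cV[R]_n) : enorm x ^+ 2 = dotp x x.
Proof. by rewrite sqr_sqrtr // dotp_ge0. Qed.

Lemma enorm0_eq n (x : 'cV[R]_n) : enorm x = 0 -> x = 0.
Proof. by move=> h; apply: dotp_eq0; rewrite -enorm_sqr h expr0n. Qed.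

Lemma enormZ n r (x : 'cV[R]_n) : enorm (r *: x) = `|r| * enorm x.
Proof.
by rewrite /enorm !dotpL mulrA -expr2 sqrtrM ?sqr_ge0 // sqrtr_sqr.
Qed.

Lemma enorm0 n : enorm (0 : 'cV[R]_n) = 0.
Proof. by rewrite /enorm dotp0l sqrtr0. Qed.

Lemma enormN n (x : 'cV[R]_n) : enorm (- x) = enorm x.
Proof. by rewrite /enorm dotpNl dotpNr opprK. Qed.

Lemma enorm_le1 n (x : 'cV[R]_n) : (enorm x <= 1) = (dotp x x <= 1).
Proof.
by rewrite -enorm_sqr expr_le1 ?enorm_ge0.
Qed.

Lemma enorm_eq1 n (x : 'cV[R]_n) : dotp x x = 1 -> enorm x = 1.
Proof. by rewrite /enorm => ->; rewrite sqrtr1. Qed.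

Lemma dotp_normalize n (x : 'cV[R]_n) :
  x != 0 -> dotp ((enorm x)^-1 *: x) ((enorm x)^-1 *: x) = 1.
Proof.
move=> x0; rewrite !dotpL -enorm_sqr.
by field; rewrite gt_eqF // sqrtr_gt0 dotp_gt0.
Qed.

Lemma cauchy_schwarz n (x y : 'cV[R]_n) : dotp x y <= enorm x * enorm y.
Proof.
have [->|x0] := eqVneq x 0; first by rewrite dotp0l enorm0 mul0r.
have xp : 0 < enorm x by rewrite sqrtr_gt0 dotp_gt0.
have := dotp_ge0 (enorm y *: x - enorm x *: y).
rewrite !dotpL -!enorm_sqr (dotpC y x) => h.
have [y0|yp] := leP (enorm y) 0.
  have /enorm0_eq -> : enorm y = 0 by apply/le_anti; rewrite y0 enorm_ge0.
  by rewrite dotp0r enorm0 mulr0.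
have : 0 <= (enorm x * enorm y) * (enorm x * enorm y - dotp x y) by nra.
by rewrite pmulr_rge0 ?mulr_gt0 // subr_ge0.
Qed.

Lemma cauchy_schwarzN n (x y : 'cV[R]_n) : - (enorm x * enorm y) <= dotp x y.
Proof.
by have := cauchy_schwarz (- x) y; rewrite enormN dotpNl lerNl.
Qed.

Lemma inj_mulmx_eq0 n k (A : 'M[R]_(n, k)) (c : 'cV[R]_n) :
  injective (fun y : 'cV[R]_k => c + A *m y) <->
  (forall y : 'cV[R]_k, A *m y = 0 -> y = 0).
Proof.
split=> [inj y Ay0|ker y z /addrI /eqP].
  by apply: inj; rewrite Ay0 mulmx0.
by rewrite -subr_eq0 -mulmxBr => /eqP/ker /eqP; rewrite subr_eq0 => /eqP.
Qed.

(** Gram-Schmidt orthonormalization of the columns of [A], by induction on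
    their number: the last column [a] is split as [Q1 b + r] with [r] orthogonal
    to the range of [Q1]. *)
Lemma qr_decomposition n k (A : 'M[R]_(n, k)) :
  (forall y : 'cV[R]_k, A *m y = 0 -> y = 0) ->
  exists Q : 'M[R]_(n, k), exists T : 'M[R]_k,
   [/\ Q^T *m Q = 1%:M, A = Q *m T, is_trig_mx T^T & forall i, 0 < T i i].
Proof.
elim: k A => [|k IH] A inj.
  exists 0, 1%:M; split; last by case.
  - by apply/matrixP => -[].
  - by apply/matrixP => ? [].
  - by apply/is_trig_mxP => -[].
have kE : (k.+1 = k + 1)%N by rewrite addn1.
move: A inj; rewrite kE => A inj.
pose A1 := lsubmx A; pose a := rsubmx A.
have [|Q1 [T1 [Q1o A1E T1t T1p]]] := IH A1.
  move=> y Ay0; suff /(congr1 usubmx) : col_mx y (0 : 'cV_1) = 0.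
    by rewrite col_mxKu linear0.
  by apply: inj; rewrite -[A]hsubmxK mul_row_col mulmx0 addr0.
pose b := Q1^T *m a; pose r := a - Q1 *m b.
have Q1r : Q1^T *m r = 0 by rewrite mulmxBr mulmxA Q1o mul1mx subrr.
have T1u : T1 \in unitmx.
  rewrite unitmxE -det_tr det_trig // unitfE; apply/prodf_neq0 => i _.
  by rewrite mxE gt_eqF.
have r0 : r != 0.
  apply/eqP => r0.
  have : col_mx (- (invmx T1 *m b)) (1%:M : 'cV_1) = 0.
    apply: inj; rewrite -[A]hsubmxK mul_row_col mulmx1 -/A1 -/a A1E mulmxN.
    rewrite mulmxA -(mulmxA Q1) mulmxV // mulmx1.
    by rewrite addrC; exact: r0.
  move/(congr1 dsubmx); rewrite col_mxKd linear0 => /matrixP/(_ ord0 ord0).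
  by rewrite !mxE eqxx /= => /eqP; rewrite oner_eq0.
pose q := (enorm r)^-1 *: r.
have rp : 0 < enorm r by rewrite sqrtr_gt0 dotp_gt0.
have qq : q^T *m q = 1%:M.
  apply/matrixP => i j; rewrite !ord1 [RHS]mxE eqxx -[LHS]/(dotp q q).
  exact: dotp_normalize.
have Q1q : Q1^T *m q = 0 by rewrite -scalemxAr Q1r scaler0.
exists (row_mx Q1 q), (block_mx T1 b 0 (enorm r)%:M); split.
- rewrite tr_row_mx mul_col_row Q1o qq Q1q.
  have -> : q^T *m Q1 = 0 by rewrite -[LHS]trmxK trmx_mul trmxK Q1q trmx0.
  by rewrite -scalar_mx_block.
- rewrite mul_row_block mulmx0 addr0 -A1E mul_mx_scalar scalerA mulfV ?gt_eqF //.
  by rewrite scale1r addrC subrK hsubmxK.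
- rewrite tr_block_mx trmx0 tr_scalar_mx is_trig_block_mx // eqxx T1t.
  by rewrite /= scalar_mx_is_trig.
- move=> i; rewrite -(splitK i); case: (fintype.split i) => j /=.
    by rewrite block_mxEul.
  by rewrite block_mxEdr mxE ord1 eqxx.
Qed.

End Euclid.

(** * Lebesgue outer measure and linear maps *)

Section Lebesgue.
Variable R : realType.
Implicit Types k : nat.

Lemma box_vol_ge0 k (a b : 'cV[R]_k) :
  (forall i, a i ord0 <= b i ord0) -> 0 <= box_vol a b.
Proof. by move=> ab; rewrite prodr_ge0 // => i _; rewrite subr_ge0. Qed.

Lemma leb_le_cover k (S : set 'cV[R]_k) (a b : nat -> 'cV[R]_k) :
  (forall j i, a j i ord0 <= b j i ord0) ->
  S `<=` \bigcup_j box (a j) (b j) ->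
  (leb S <= \sum_(0 <= j <oo) (box_vol (a j) (b j))%:E)%E.
Proof. by move=> ab Sab; apply: ereal_inf_lbound; exists a, b. Qed.

Lemma leb_ge0 k (S : set 'cV[R]_k) : (0 <= leb S)%E.
Proof.
apply: le_ereal_inf_tmp => _ [a [b [ab _ ->]]].
by apply: nneseries_ge0 => j _ _; rewrite lee_fin box_vol_ge0.
Qed.

Lemma leb_le k (S S' : set 'cV[R]_k) : S `<=` S' -> (leb S <= leb S')%E.
Proof.
move=> SS'; apply: le_ereal_inf_tmp => _ [a [b [ab S'ab ->]]].
by apply: leb_le_cover => //; exact: subset_trans S'ab.
Qed.

(** The doubly indexed family of the boxes covering each [F j], with error
    [e / 2 ^ j.+1], is reindexed by a bijection of [nat] with [nat * nat]. *)
Lemma leb_sigma_subadditive k (S : set 'cV[R]_k) (F : nat -> set 'cV[R]_k) :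
  S `<=` \bigcup_j F j -> (leb S <= \sum_(0 <= j <oo) leb (F j))%E.
Proof.
move=> SF; have F0 j : (0 <= leb (F j))%E by exact: leb_ge0.
have [->|Ffin] := eqVneq (\sum_(0 <= j <oo) leb (F j))%E +oo%E.
  by rewrite leey.
have Ffn j : leb (F j) \is a fin_num.
  rewrite ge0_fin_numE //; apply: le_lt_trans (_ : _ < +oo)%E; last first.
    by rewrite ltey; exact: Ffin.
  rewrite (nneseries_split 0 j.+1) // add0n big_nat_recr //=.
  rewrite -addeA addeCA leeDl // adde_ge0 //.
    by apply: sume_ge0.
  by apply: nneseries_ge0.
apply/lee_addgt0Pr => e e0.
apply: le_trans (epsilon_trick xpredT F0 (ltW e0)).
have /choice[a /choice[b ab]] j : exists a b : nat -> 'cV[R]_k,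
   [/\ forall i l, a i l ord0 <= b i l ord0, F j `<=` \bigcup_i box (a i) (b i)
     & (\sum_(0 <= i <oo) (box_vol (a i) (b i))%:E <=
          leb (F j) + (e / (2 ^ j.+1)%:R)%:E)%E].
  have : (leb (F j) < leb (F j) + (e / (2 ^ j.+1)%:R)%:E)%E.
    by rewrite lteDl // lte_fin divr_gt0 // ltr0n expn_gt0.
  by case/ereal_inf_lt => _ [a [b [ab Fab ->]]] /ltW h; exists a, b.
have ab0 j i : (0 <= (box_vol (a j i) (b j i))%:E)%E.
  by have [h _ _] := ab j; rewrite lee_fin box_vol_ge0.
have /ppcard_eqP[f] : ([set: nat] #= [set: nat * nat])%card.
  by rewrite card_eq_sym; exact: card_nat2.
apply: (@le_trans _ _
  (\sum_(0 <= m <oo) (box_vol (a (f m).1 (f m).2) (b (f m).1 (f m).2))%:E)%E).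
  apply: leb_le_cover => [m l|x /SF [j _ Fx]]; first by case: (ab (f m).1).
  have [_ /(_ x Fx) [i _ xi] _] := ab j.
  exists (f^-1%FUN (j, i)) => //; rewrite invK ?inE //.
rewrite nneseries_esumT; last by move=> m; apply: ab0.
rewrite -(@reindex_esum R nat (nat * nat)%type [set: nat] [set: nat * nat] f
  (fun ji => (box_vol (a ji.1 ji.2) (b ji.1 ji.2))%:E)); last first.
  by apply: (@bij _ _ _ _ f).
rewrite -setXTT -(@esum_esum R nat nat setT (fun=> setT)
  (fun j i => (box_vol (a j i) (b j i))%:E)) //.
rewrite -nneseries_esumT; last first.
  by move=> j; apply: (@esum_ge0 R nat) => i _; exact: ab0.
apply: lee_nneseries => j *; first by apply: (@esum_ge0 R nat) => i _; exact: ab0.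
by rewrite -nneseries_esumT //; case: (ab j).
Qed.

Lemma box_vol0 k (a : 'cV[R]_k) : (0 < k)%N -> box_vol a a = 0.
Proof.
case: k a => // k a _; rewrite /box_vol (bigD1 ord0) //= subrr mul0r //.
Qed.

(** The remaining boxes of the covering are taken to be points, which have
    volume zero in positive dimension. *)
Lemma leb_finite_cover k (S : set 'cV[R]_k) N (a b : nat -> 'cV[R]_k) :
  (0 < k)%N -> (forall j i, (j < N)%N -> a j i ord0 <= b j i ord0) ->
  (forall x, S x -> exists2 j, (j < N)%N & box (a j) (b j) x) ->
  (leb S <= (\sum_(0 <= j < N) box_vol (a j) (b j))%:E)%E.
Proof.
move=> k0 ab Sab; pose b' j := if (j < N)%N then b j else a j.
have := @leb_le_cover k S a b'; rewrite (nneseries_split 0 N); last first.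
  move=> j _; rewrite lee_fin box_vol_ge0 // => i; rewrite /b'.
  by case: ifP => // jN; exact: ab.
rewrite add0n [X in (_ + X)%E](_ : _ = 0)%E ?adde0; last first.
  rewrite eseries0 // => j Nj _.
  by rewrite /b' ltnNge Nj /= box_vol0.
rewrite sumEFin; under eq_big_nat => j /andP[_ jN] do rewrite /b' jN.
apply => [j i|x /Sab[j jN xj]]; first by rewrite /b'; case: ifP => // /ab.
by exists j => //; rewrite /b' jN.
Qed.

Lemma leb_le_box k (S : set 'cV[R]_k) (a b : 'cV[R]_k) :
  (0 < k)%N -> (forall i, a i ord0 <= b i ord0) -> S `<=` box a b ->
  (leb S <= (box_vol a b)%:E)%E.
Proof.
move=> k0 ab Sab; have := @leb_finite_cover k S 1 (fun=> a) (fun=> b) k0.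
by rewrite big_nat1; apply => // x /Sab; exists 0%N.
Qed.

(** For a map that multiplies the measure of boxes by at most [c], countable
    subadditivity gives the same for all sets. *)
Lemma leb_image_le k (f : 'cV[R]_k -> 'cV[R]_k) (c : R) : 0 < c ->
  (forall a b : 'cV[R]_k, (forall i, a i ord0 <= b i ord0) ->
     (leb (f @` box a b) <= (c * box_vol a b)%:E)%E) ->
  forall S, (leb (f @` S) <= c%:E * leb S)%E.
Proof.
move=> c0 fbox S; rewrite -lee_pdivrMl //.
apply: le_ereal_inf_tmp => _ [a [b [ab Sab ->]]]; rewrite lee_pdivrMl //.
rewrite -nneseriesZl; last first.
  by move=> j _; rewrite lee_fin box_vol_ge0.
apply: (@le_trans _ _ (\sum_(0 <= j <oo) leb (f @` box (a j) (b j)))%E).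
  apply: leb_sigma_subadditive => _ [x Sx <-].
  by have [j _ xj] := Sab x Sx; exists j => //; exists x.
apply: lee_nneseries => j *; first exact: leb_ge0.
by rewrite -EFinM fbox.
Qed.

Lemma leb_translate_le k (v : 'cV[R]_k) (S : set 'cV[R]_k) :
  (0 < k)%N -> (leb ((fun x => v + x)%R @` S) <= leb S)%E.
Proof.
move=> k0; rewrite -[leRHS]mul1e; apply: leb_image_le => // a b ab.
rewrite mul1r (_ : box_vol a b = box_vol (v + a) (v + b)); last first.
  by apply: eq_bigr => i _; rewrite !mxE; ring.
apply: leb_le_box => // [i|_ [x xab <-] i]; first by rewrite !mxE lerD2l.
by rewrite !mxE !lerD2l.
Qed.

(** Only this inequality is proved for elementary matrices, since it is stable
    under products; the equality for an invertible matrix results from the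
    inequalities for it and for its inverse. *)
Definition leb_expands k (M : 'M[R]_k) : Prop :=
  forall S, (leb (mulmx M @` S) <= (`|\det M|)%:E * leb S)%E.

Lemma leb_expandsM k (M N : 'M[R]_k) :
  leb_expands M -> leb_expands N -> leb_expands (M *m N).
Proof.
move=> hM hN S; rewrite (_ : _ @` S = mulmx M @` (mulmx N @` S)); last first.
  by rewrite image_comp; apply: eq_imagel => x _ /=; rewrite mulmxA.
apply: le_trans (hM _) _; rewrite det_mulmx normrM EFinM -muleA.
by apply: lee_wpmul2l; [rewrite lee_fin normr_ge0|exact: hN].
Qed.

Lemma leb_expands1 k : leb_expands (1%:M : 'M[R]_k).
Proof.
move=> S; rewrite det1 normr1 mul1e (_ : _ @` S = S) //.
apply/seteqP; split=> [_ [x Sx <-]|x Sx]; first by rewrite mul1mx.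
by exists x => //; rewrite mul1mx.
Qed.

Lemma leb_expands_diag k (d : 'rV[R]_k) : (0 < k)%N ->
  (forall i, d ord0 i != 0) -> leb_expands (diag_mx d).
Proof.
move=> k0 d0; have dp : 0 < `|\det (diag_mx d)|.
  by rewrite normr_gt0 det_diag; apply/prodf_neq0.
apply: leb_image_le => // a b ab.
pose a' := \col_i Num.min (d ord0 i * a i ord0) (d ord0 i * b i ord0).
pose b' := \col_i Num.max (d ord0 i * a i ord0) (d ord0 i * b i ord0).
rewrite (_ : _ * _ = box_vol a' b'); last first.
  rewrite det_diag normr_prod /box_vol -big_split /=; apply: eq_bigr => i _.
  rewrite !mxE; have := ab i; have := d0 i.
  have [dp'|dn|_] := ltgtP 0 (d ord0 i); last by [].
    move=> _ abi; rewrite min_l ?max_r ?ler_pM2l // gtr0_norm //; ring.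
  move=> _ abi; rewrite min_r ?max_l ?ler_nM2l // ltr0_norm //; ring.
apply: leb_le_box => // [i|_ [x xab <-] i]; first by rewrite !mxE ge_min !le_max lexx.
rewrite mul_diag_mx !mxE; have /andP[ax xb] := xab i.
rewrite ge_min le_max; have [dp'|dn|<-] := ltgtP 0 (d ord0 i).
- by rewrite !ler_pM2l // ax xb orbT.
- by rewrite !ler_nM2l // ax xb orbT.
- by rewrite !mul0r lexx.
Qed.

Lemma grid_cell (N : nat) (d y : R) : (0 < N)%N -> 0 <= y <= N%:R * d ->
  exists2 m, (m < N)%N & m%:R * d <= y <= m.+1%:R * d.
Proof.
elim: N => // N IH _ /andP[y0 yN].
move: IH yN; have [->|N0] := posnP N => IH yN.
  by exists 0%N => //; rewrite mul0r y0.
have [yN'|yN'] := leP y (N%:R * d); last by exists N => //; rewrite (ltW yN') yN.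
have [|m mN my] := IH isT; first by rewrite y0.
by exists m => //; rewrite ltnS ltnW.
Qed.

Definition transvection k (i j : 'I_k) (t : R) : 'M[R]_k :=
  1%:M + t *: delta_mx i j.

Lemma transvectionE k (i j : 'I_k) t (x : 'cV[R]_k) l :
  (transvection i j t *m x) l ord0 = x l ord0 + (l == i)%:R * (t * x j ord0).
Proof.
rewrite mulmxDl mul1mx -scalemxAl !mxE; congr (_ + _).
rewrite (bigD1 j) //= big1 => [|m mj]; last by rewrite mxE (negbTE mj) andbF mul0r.
by rewrite mxE eqxx andbT addr0; ring.
Qed.

Lemma det_transvection k (i j : 'I_k) t : i != j -> \det (transvection i j t) = 1.
Proof.
move=> ij; suff main (i' j' : 'I_k) : (j' < i')%N -> \det (transvection i' j' t) = 1.
  have [ji|ij'|/val_inj] := ltngtP j i; first exact: main.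
    rewrite -det_tr (_ : _^T = transvection j i t) ?main //.
    by rewrite /transvection linearD linearZ /= trmx1 trmx_delta.
  by move/eqP; rewrite eq_sym (negbTE ij).
move=> ji; rewrite det_trig ?big1 // => [l _|]; last first.
  apply/is_trig_mxP => l m lm; rewrite !mxE -val_eqE (ltn_eqF lm) add0r.
  have [li|] := eqVneq l i'; last by rewrite mulr0.
  have [mj|] := eqVneq m j'; last by rewrite mulr0.
  by move: lm; rewrite li mj ltnNge ltnW.
rewrite !mxE eqxx; have [li|] := eqVneq l i'; last by rewrite mulr0 addr0.
have [lj|] := eqVneq l j'; last by rewrite mulr0 addr0.
by move: ji; rewrite -li -lj ltnn.
Qed.

(** A sheared box is covered by the boxes around the images of the [N] slices
    of the box along the coordinate [j]; their total volume exceeds that of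
    the box by a multiple of [1 / N]. *)
Lemma leb_expands_transvection k (i j : 'I_k) t :
  i != j -> leb_expands (transvection i j t).
Proof.
move=> ij; have k0 : (0 < k)%N by apply: leq_ltn_trans (ltn_ord i).
rewrite /leb_expands det_transvection // normr1.
apply: leb_image_le => // a b ab; rewrite mul1r.
pose w := b i ord0 - a i ord0; pose h := b j ord0 - a j ord0.
pose rest := \prod_(l < k | (l != j) && (l != i)) (b l ord0 - a l ord0).
have rest0 : 0 <= rest by rewrite prodr_ge0 // => l _; rewrite subr_ge0.
have volE : box_vol a b = h * (w * rest).
  by rewrite /box_vol (bigD1 j) //= (bigD1 i).
have h0 : 0 <= h by rewrite subr_ge0.
apply/lee_addgt0Pr => e e0; rewrite -EFinD.
pose C := 2 * `|t| * h * h * rest.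
have C0 : 0 <= C by rewrite /C !mulr_ge0.
pose N := (Num.truncn (C / e)).+1.
have N0 : 0 < N%:R :> R by rewrite ltr0n.
have CN : C / N%:R <= e.
  by rewrite ler_pdivrMr // mulrC -ler_pdivrMr // ltW // truncnS_gt.
pose d := h / N%:R; have d0 : 0 <= d by rewrite divr_ge0 // ltW.
have Nd : N%:R * d = h by rewrite /d; field; rewrite gt_eqF.
pose lo (m : nat) : 'cV[R]_k := \col_l if l == j then a j ord0 + m%:R * d else
  if l == i then a i ord0 + t * (a j ord0 + m%:R * d) - `|t| * d else a l ord0.
pose hi (m : nat) : 'cV[R]_k := \col_l if l == j then a j ord0 + m.+1%:R * d else
  if l == i then b i ord0 + t * (a j ord0 + m%:R * d) + `|t| * d else b l ord0.
have lohi m l : lo m l ord0 <= hi m l ord0.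
  rewrite !mxE; case: eqP => [_|_].
    by rewrite lerD2l ler_wpM2r // ler_nat.
  case: eqP => _ //; have : 0 <= `|t| * d by rewrite mulr_ge0.
  by have := ab i; lra.
have volm m : box_vol (lo m) (hi m) = d * ((w + 2 * `|t| * d) * rest).
  rewrite /box_vol (bigD1 j) //= !mxE eqxx (bigD1 i) //= !mxE (negbTE ij) eqxx.
  rewrite -natr1 -[X in X * (_ * _) = _]/(_ + _); congr (_ * (_ * _)).
  - ring.
  - by rewrite /w; ring.
  - by apply: eq_bigr => l /andP[lj li]; rewrite !mxE (negbTE lj) (negbTE li).
apply: le_trans (@leb_finite_cover k _ N lo hi k0 _ _) _.
- by move=> m l _; exact: lohi.
- move=> _ [x xab <-]; have /andP[axj xbj] := xab j.
  have [||m mN /andP[my ym]] := @grid_cell N d (x j ord0 - a j ord0).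
  + by [].
  + by rewrite Nd subr_ge0 axj lerD2r xbj.
  exists m => // l; rewrite transvectionE !mxE.
  have [lj|lj] := eqVneq l j.
    by rewrite lj eq_sym (negbTE ij) mul0r addr0 -lerBrDl my /= -lerBlDl.
  have [li|li] := eqVneq l i; last by rewrite mul0r addr0; exact: xab.
  have /andP[axi xbi] := xab i; rewrite li mul1r.
  have : `|t * (x j ord0 - a j ord0 - m%:R * d)| <= `|t| * d.
    rewrite normrM ler_wpM2l // ger0_norm ?subr_ge0 //.
    by move: ym; rewrite -natr1; lra.
  by rewrite ler_norml => /andP[? ?]; apply/andP; split; lra.
rewrite lee_fin; under eq_bigr do rewrite volm.
rewrite big_const_nat subn0 iter_addr_0 -[leLHS]mulr_natl mulrA Nd volE.
rewrite (_ : _ * _ = h * (w * rest) + C / N%:R) ?lerD2l //.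
by rewrite /C /d; field; rewrite gt_eqF.
Qed.

Lemma row_shear_expands k (b : 'rV[R]_k) :
  leb_expands (block_mx 1%:M b 0 1%:M : 'M[R]_(1 + k)).
Proof.
rewrite (row_sum_delta b).
elim/big_rec : _ => [|j c _ IH].
  by rewrite -scalar_mx_block; exact: leb_expands1.
rewrite (_ : block_mx _ _ _ _ =
  transvection (lshift k ord0) (rshift 1 j) (b ord0 j) *m block_mx 1%:M c 0 1%:M).
  apply: leb_expandsM => //; apply: leb_expands_transvection.
  by rewrite eq_lrshift.
rewrite (_ : transvection _ _ _ = block_mx 1%:M (b ord0 j *: delta_mx ord0 j) 0 1%:M).
  by rewrite mulmx_block !mul1mx !mulmx0 !mul0mx !mulmx1 !addr0 !add0r addrC.
apply/matrixP => u v; rewrite -(splitK u) -(splitK v).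
case: (fintype.split u) => u'; case: (fintype.split v) => v' /=;
  rewrite ?block_mxEul ?block_mxEur ?block_mxEdl ?block_mxEdr !mxE;
  by rewrite ?(eq_lshift, eq_rshift, eq_lrshift, eq_rlshift) ?andbF ?mulr0 ?addr0 ?add0r
     ?(ord1 u').
Qed.

Lemma col_shear_expands k (c : 'cV[R]_k) :
  leb_expands (block_mx 1%:M 0 c 1%:M : 'M[R]_(1 + k)).
Proof.
rewrite -[c]trmxK (row_sum_delta c^T) linear_sum /=.
elim/big_rec : _ => [|j d _ IH].
  by rewrite -scalar_mx_block; exact: leb_expands1.
rewrite (_ : block_mx _ _ _ _ =
  transvection (rshift 1 j) (lshift k ord0) (c^T ord0 j) *m block_mx 1%:M 0 d 1%:M).
  apply: leb_expandsM => //; apply: leb_expands_transvection.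
  by rewrite eq_rlshift.
rewrite linearZ /= trmx_delta.
rewrite (_ : transvection _ _ _ = block_mx 1%:M 0 (c^T ord0 j *: delta_mx j ord0) 1%:M).
  by rewrite mulmx_block !mul1mx !mulmx0 !mul0mx !mulmx1 !addr0 !add0r.
apply/matrixP => u v; rewrite -(splitK u) -(splitK v).
case: (fintype.split u) => u'; case: (fintype.split v) => v' /=;
  rewrite ?block_mxEul ?block_mxEur ?block_mxEdl ?block_mxEdr !mxE;
  by rewrite ?(eq_lshift, eq_rshift, eq_lrshift, eq_rlshift) ?andbF ?mulr0 ?addr0 ?add0r
     ?(ord1 v') ?andbT.
Qed.

Lemma ord0_lshift k : ord0 = lshift k ord0 :> 'I_(1 + k).
Proof. exact: val_inj. Qed.

Lemma box_vol_recl k (a b : 'cV[R]_(1 + k)) :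
  box_vol a b = (b ord0 ord0 - a ord0 ord0) * box_vol (dsubmx a) (dsubmx b).
Proof.
rewrite /box_vol big_ord_recl; congr (_ * _); apply: eq_bigr => i _.
by rewrite !mxE !rshift1.
Qed.

Lemma box_recl k (a b x : 'cV[R]_(1 + k)) :
  box a b x <-> a ord0 ord0 <= x ord0 ord0 <= b ord0 ord0 /\
                box (dsubmx a) (dsubmx b) (dsubmx x).
Proof.
split=> [h|[h0 h] i]; first by split=> [|i]; [exact: h|rewrite !mxE; exact: h].
rewrite -(splitK i); case: (fintype.split i) => j /=.
  by rewrite ord1 lshift0.
by have := h j; rewrite !mxE.
Qed.

(** If [p = q], the bound is zero, which some covering of [S] of finite volume
    shows; this is why [S] has to have finite measure. *)
Lemma leb_cylinder_le k (p q : R) (S : set 'cV[R]_k) : p <= q -> (leb S < +oo)%E ->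
  (leb [set x : 'cV[R]_(1 + k) | (p <= x ord0 ord0 <= q)%R /\ S (dsubmx x)] <=
   (q - p)%:E * leb S)%E.
Proof.
move=> pq Soo.
have cov (a b : nat -> 'cV[R]_k) : (forall j i, a j i ord0 <= b j i ord0) ->
    S `<=` \bigcup_j box (a j) (b j) ->
    (leb [set x : 'cV[R]_(1 + k) | (p <= x ord0 ord0 <= q)%R /\ S (dsubmx x)] <=
    (q - p)%:E * \sum_(0 <= j <oo) (box_vol (a j) (b j))%:E)%E.
  move=> ab Sab; rewrite -nneseriesZl; last by move=> j _; rewrite lee_fin box_vol_ge0.
  pose a' j : 'cV[R]_(1 + k) := col_mx p%:M (a j).
  pose b' j : 'cV[R]_(1 + k) := col_mx q%:M (b j).
  have u0 r (c : 'cV[R]_k) : (col_mx r%:M c : 'cV[R]_(1 + k)) ord0 ord0 = r.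
    by rewrite ord0_lshift col_mxEu mxE eqxx.
  under eq_eseriesr => j _ do rewrite -EFinM.
  rewrite (@eq_eseriesr _ _ (fun j => (box_vol (a' j) (b' j))%:E)).
    apply: leb_le_cover => [j i|x [pxq /Sab[j _ xj]]].
      rewrite -(splitK i); case: (fintype.split i) => l /=.
        by rewrite !col_mxEu !mxE ord1 eqxx.
      by rewrite !col_mxEd.
    exists j => //; apply/box_recl; rewrite !u0; split=> //.
    by rewrite !col_mxKd.
  by move=> j _; rewrite box_vol_recl !u0 !col_mxKd.
move: pq; rewrite le_eqVlt => /orP[/eqP pq|pq].
  have [_ [a [b [ab Sab _]]] _] := ereal_inf_lt Soo.
  by have := cov a b ab Sab; rewrite pq subrr !mul0e.
rewrite -lee_pdivrMl ?subr_gt0 //; apply: le_ereal_inf_tmp => _ [a [b [ab Sab ->]]].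
by rewrite lee_pdivrMl ?subr_gt0 // cov.
Qed.

Lemma leb_expands_lift k (D : 'M[R]_k) : (0 < k)%N ->
  \det D != 0 -> leb_expands D ->
  leb_expands (block_mx 1%:M 0 0 D : 'M[R]_(1 + k)).
Proof.
move=> k0 D0 hD; rewrite /leb_expands det_ublock det1 mul1r.
apply: leb_image_le => [|a b ab]; first by rewrite normr_gt0.
have leC : (leb (mulmx D @` box (dsubmx a) (dsubmx b)) <=
            (`|\det D| * box_vol (dsubmx a) (dsubmx b))%:E)%E.
  apply: le_trans (hD _) _; rewrite EFinM; apply: lee_wpmul2l.
    by rewrite lee_fin.
  by apply: leb_le_box => // i; rewrite !mxE.
apply: le_trans (leb_le _) _; last first.
  apply: le_trans (leb_cylinder_le (ab ord0) (le_lt_trans leC (ltry _))) _.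
  rewrite box_vol_recl mulrCA EFinM.
  by apply: lee_wpmul2l; rewrite // lee_fin subr_ge0.
move=> _ [x /box_recl [x0 xC] <-] /=.
rewrite -[x]vsubmxK mul_block_col !mul1mx !mul0mx addr0 add0r col_mxKd.
split; last by exists (dsubmx x).
by rewrite ord0_lshift col_mxEu mxE -ord0_lshift.
Qed.

(** Gaussian elimination: a matrix with nonzero upper left entry is a product
    of a column shear, a diagonal matrix, a matrix of smaller size and a row
    shear; a transvection makes the upper left entry nonzero. *)
Lemma leb_expands_unit k (M : 'M[R]_k.+1) : \det M != 0 -> leb_expands M.
Proof.
elim: k M => [|k IH] M M0.
  rewrite (_ : M = diag_mx (const_mx (M ord0 ord0))); last first.
    by apply/matrixP => i j; rewrite !ord1 !mxE eqxx.
  apply: leb_expands_diag => // i; rewrite mxE.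
  by move: M0; rewrite det_mx11.
have pivot (N : 'M[R]_(1 + k.+1)) : \det N != 0 -> N ord0 ord0 != 0 -> leb_expands N.
  move=> N0 p0; pose p := N ord0 ord0.
  pose b := ursubmx N; pose c := dlsubmx N; pose D := drsubmx N.
  pose D' := D - p^-1 *: (c *m b).
  have ulE : ulsubmx N = p%:M.
    by apply/matrixP => i j; rewrite !ord1 !mxE lshift0 eqxx.
  have NE : N = block_mx 1%:M 0 (p^-1 *: c) 1%:M *m
      (diag_mx (row_mx p%:M (const_mx 1)) *m block_mx 1%:M 0 0 D') *m
      block_mx 1%:M (p^-1 *: b) 0 1%:M.
    rewrite diag_mx_row (_ : diag_mx p%:M = p%:M); last first.
      by apply/matrixP => i j; rewrite !ord1 !mxE eqxx.
    rewrite diag_const_mx !mulmx_block !mul1mx !mulmx1 !mulmx0 !mul0mx !addr0 !add0r.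
    rewrite -[LHS]submxK ulE; congr block_mx.
    - by rewrite mul_scalar_mx scalerA mulfV // scale1r.
    - by rewrite mul_mx_scalar scalerA mulfV // scale1r.
    - rewrite mul_mx_scalar scalerA mulfV // scale1r -scalemxAr.
      by rewrite mulmx0 add0r /D' addrC subrK.
  have D'0 : \det D' != 0.
    apply: contraNneq N0 => D'0; rewrite NE !det_mulmx det_ublock det1 mul1r D'0.
    by rewrite !(mulr0, mul0r).
  rewrite NE; apply: leb_expandsM; last exact: row_shear_expands.
  apply: leb_expandsM; first exact: col_shear_expands.
  apply: leb_expandsM; last exact: (leb_expands_lift _ D'0 (IH _ D'0)).
  apply: leb_expands_diag => // i; rewrite -(splitK i).
  case: (fintype.split i) => j /=; first by rewrite row_mxEl (ord1 j) mxE eqxx.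
  by rewrite row_mxEr mxE oner_neq0.
have [p0|p0] := eqVneq (M ord0 ord0) 0; last exact: pivot.
have [i i0] : exists i, M i ord0 != 0.
  apply/existsP; apply: contra_neqT M0; rewrite negb_exists => /forallP col0.
  rewrite (expand_det_col _ ord0) big1 // => i _.
  by have := col0 i; rewrite negbK => /eqP ->; rewrite mul0r.
have i00 : i != ord0 by apply: contra_neq i0 => ->.
have inv : M = transvection ord0 i (-1) *m (transvection ord0 i 1 *m M).
  rewrite mulmxA -[LHS]mul1mx; congr (_ *m _); rewrite /transvection.
  rewrite mulmxDl mul1mx mulmxDr mulmx1 -scalemxAl -scalemxAr.
  rewrite mul_delta_mx_0 // !scaler0 addr0 scaleN1r scale1r.
  by rewrite addrK.
rewrite inv; apply: leb_expandsM.
  by apply: leb_expands_transvection; rewrite eq_sym.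
apply: pivot.
  by rewrite det_mulmx det_transvection ?mul1r // eq_sym.
rewrite mulmxDl mul1mx scale1r mxE p0 add0r mxE (bigD1 i) //= big1 => [|j ji].
  by rewrite mxE !eqxx mul1r addr0.
by rewrite mxE (negbTE ji) andbF mul0r.
Qed.

Lemma leb_linear k (M : 'M[R]_k) (S : set 'cV[R]_k) : (0 < k)%N ->
  \det M != 0 -> leb (mulmx M @` S) = ((`|\det M|)%:E * leb S)%E.
Proof.
case: k M S => // k M S _ M0; apply/le_anti/andP; split.
  exact: leb_expands_unit.
have Mu : M \in unitmx by rewrite unitmxE unitfE.
have M0' : \det (invmx M) != 0 by rewrite det_inv invr_neq0.
have := leb_expands_unit M0' (mulmx M @` S).
rewrite image_comp (_ : _ @` S = S); last first.
  apply/seteqP; split=> [_ [x Sx <-]|x Sx]; first by rewrite /= mulKmx.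
  by exists x => //=; rewrite mulKmx.
rewrite det_inv normrV ?unitfE // => h; rewrite -lee_pdivlMl ?normr_gt0 //.
Qed.

Lemma leb_translate k (v : 'cV[R]_k) (S : set 'cV[R]_k) :
  (0 < k)%N -> leb ((fun x => v + x) @` S) = leb S.
Proof.
move=> k0; apply/le_anti/andP; split; first exact: leb_translate_le.
have := leb_translate_le (- v) ((fun x => v + x) @` S) k0.
rewrite image_comp (_ : _ @` S = S) //.
apply/seteqP; split=> [_ [x Sx <-]|x Sx]; first by rewrite /= addKr.
by exists x => //=; rewrite addKr.
Qed.

End Lebesgue.

(** * Measure of balls and volume of ellipsoids *)

Section LebesgueBall.
Variable R : realType.
Implicit Types k n : nat.

(** Weighted form of the fact that boxes covering a box have total volume at
    least that of the box.  The weights make the induction on the dimension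
    work: freezing the first coordinate [t] multiplies the weight of the box
    [j] by the indicator of its first side at [t], and integrating the
    inequality of the lower dimension over [t] gives the statement. *)
Lemma box_vol_le_weighted k (a b : 'cV[R]_k) (aj bj : nat -> 'cV[R]_k)
    (w : nat -> R) :
  (forall i, a i ord0 <= b i ord0) ->
  (forall j i, aj j i ord0 <= bj j i ord0) ->
  (forall j, 0 <= w j) ->
  (forall x, box a b x ->
     (1 <= \sum_(0 <= j <oo) (w j * \1_(box (aj j) (bj j)) x)%:E)%E) ->
  ((box_vol a b)%:E <= \sum_(0 <= j <oo) (w j * box_vol (aj j) (bj j))%:E)%E.
Proof.
elim: k a b aj bj w => [|k IH] a b aj bj w ab abj w0 cov.
  have := cov a; rewrite /box_vol big_ord0; move=> /(_ _) h.
  apply: le_trans (h _) _; first by case.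
  apply: lee_nneseries => j *; first by rewrite lee_fin mulr_ge0.
  by rewrite lee_fin big_ord0 ler_wpM2l // indicE lern1 leq_b1.
change (forall x : 'cV[R]_(1 + k), box a b x ->
     (1 <= \sum_(0 <= j <oo) (w j * \1_(box (aj j) (bj j)) x)%:E)%E) in cov.
pose p := a ord0 ord0; pose q := b ord0 ord0.
have pq : p <= q by exact: ab.
pose I j : set R := `[aj j ord0 ord0, bj j ord0 ord0]%classic.
pose vC j := box_vol (dsubmx (aj j : 'cV_(1 + k))) (dsubmx (bj j : 'cV_(1 + k))).
have vC0 j : 0 <= vC j by apply: box_vol_ge0 => i; rewrite !mxE.
pose f j t : \bar R := (w j * vC j * \1_(I j) t)%:E.
have f0 j t : (0 <= f j t)%E by rewrite lee_fin !mulr_ge0.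
pose D : set R := `[p, q]%classic.
have slice t : D t ->
  ((box_vol (dsubmx (a : 'cV_(1 + k))) (dsubmx (b : 'cV_(1 + k))))%:E <=
    \sum_(0 <= j <oo) f j t)%E.
  move=> Dt.
  under [X in (_ <= X)%E]eq_eseriesr => j _ do rewrite /f -mulrA (mulrC (vC j)) mulrA.
  apply: IH => [i|j i|j|y yC]; [by rewrite !mxE|by rewrite !mxE| |].
    by rewrite mulr_ge0.
  pose x : 'cV[R]_(1 + k) := col_mx t%:M y.
  have x0 : x ord0 ord0 = t by rewrite ord0_lshift col_mxEu mxE eqxx.
  apply: le_trans (cov x _) _.
    apply/box_recl; rewrite x0 col_mxKd; split=> //.
  apply: lee_nneseries => j *; first by rewrite lee_fin mulr_ge0.
  rewrite lee_fin -mulrA ler_wpM2l // !indicE -natrM ler_nat mulnb.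
  case: (boolP (x \in _)) => // /set_mem/box_recl[]; rewrite x0 col_mxKd => tI yCj.
  by rewrite lt0b; apply/andP; split; apply/mem_set; rewrite // /I /= in_itv.
have mI j : measurable (I j) by exact: measurable_itv.
have mD : measurable D by exact: measurable_itv.
have mf j : measurable_fun D (f j).
  apply/measurable_EFinP; apply: measurable_funM => //.
have muD (r s : R) : r <= s -> lebesgue_measure `[r, s]%classic = (s - r)%:E.
  rewrite lebesgue_measure_itv /= lte_fin le_eqVlt => /orP[/eqP ->|->] //.
  by rewrite ltxx subrr.
have -> : (box_vol a b)%:E =
  (\int[lebesgue_measure]_(t in D)
    (box_vol (dsubmx (a : 'cV_(1 + k))) (dsubmx (b : 'cV_(1 + k))))%:E)%E.
  rewrite integral_cst // [X in (_ * X)%E](_ : _ = (q - p)%:E); last exact: muD.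
  by rewrite -EFinM mulrC -box_vol_recl.
have msum : measurable_fun D (fun t => \sum_(0 <= j <oo) f j t)%E.
  have := @ge0_emeasurable_sum _ _ R D f xpredT; apply => //.
have C0 (t : R) : D t ->
    (0 <= (box_vol (dsubmx (a : 'cV_(1 + k))) (dsubmx (b : 'cV_(1 + k))))%:E)%E.
  by move=> _; rewrite lee_fin box_vol_ge0 // => i; rewrite !mxE.
have := @ge0_le_integral _ _ R lebesgue_measure D mD _ _ C0
  (measurable_cst _) msum slice.
move=> /le_trans; apply.
rewrite integral_nneseries //; apply: lee_nneseries => j *.
  by apply: integral_ge0.
rewrite /f; under eq_integral do rewrite EFinM.
rewrite ge0_integralZl_EFin ?mulr_ge0 //; last first.
  by apply/measurable_EFinP; apply: measurable_indic; exact: mI.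
rewrite integral_indic; [|exact: mD|exact: mI].
rewrite (_ : w j * box_vol _ _ =
  w j * vC j * (bj j ord0 ord0 - aj j ord0 ord0)); last first.
  by rewrite box_vol_recl /vC; ring.
rewrite [leRHS]EFinM.
apply: lee_wpmul2l; first by rewrite lee_fin mulr_ge0.
rewrite -muD //; apply: le_measure; rewrite ?inE.
- by apply: measurableI; [exact: mI|exact: mD].
- exact: mI.
- by move=> x [].
Qed.

Lemma leb_box k (a b : 'cV[R]_k) : (forall i, a i ord0 <= b i ord0) ->
  ((box_vol a b)%:E <= leb (box a b))%E.
Proof.
move=> ab; apply: le_ereal_inf_tmp => _ [aj [bj [abj cov ->]]].
have := @box_vol_le_weighted k a b aj bj (fun=> 1) ab abj.
under eq_eseriesr => j _ do rewrite mul1r.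
apply => // x /cov[j _ xj].
rewrite (nneseries_split 0 j.+1) => [|i _]; last by rewrite lee_fin mulr_ge0.
have x1 : \1_(box (aj j) (bj j)) x = 1 :> R by rewrite indicE mem_set.
rewrite add0n big_nat_recr //= x1 mul1r.
rewrite addeAC leeDr // adde_ge0 //.
  by apply: sume_ge0 => i _; rewrite lee_fin mulr_ge0.
by apply: nneseries_ge0 => i *; rewrite lee_fin mulr_ge0.
Qed.

Lemma leb_eball_gt0 k : (0 < k)%N -> (0 < leb (eball R k))%E.
Proof.
move=> k0; have k0' : 0 < k%:R :> R by rewrite ltr0n.
pose a : 'cV[R]_k := const_mx (- k%:R^-1); pose b : 'cV[R]_k := const_mx k%:R^-1.
have ab i : a i ord0 <= b i ord0 by rewrite !mxE ge0_cp // invr_ge0 ltW.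
have sub : box a b `<=` eball R k.
  move=> x xab; rewrite /eball /= enorm_le1 dotpE.
  apply: (@le_trans _ _ (\sum_(i < k) k%:R^-1)); last first.
    by rewrite sumr_const card_ord -[leLHS]mulr_natr mulVf // gt_eqF.
  apply: ler_sum => i _; have /andP[] := xab i; rewrite !mxE => h1 h2.
  have : k%:R^-1 <= 1 :> R by rewrite invf_le1 // ler1n.
  nra.
apply: lt_le_trans (leb_le sub); apply: lt_le_trans (leb_box ab).
rewrite lte_fin /box_vol prodr_gt0 // => i _; rewrite !mxE opprK.
by rewrite addr_gt0 // invr_gt0.
Qed.

Lemma leb_eball_fin k : (0 < k)%N -> leb (eball R k) \is a fin_num.
Proof.
move=> k0; rewrite ge0_fin_numE ?leb_ge0 //.
have ab i : (const_mx (-1) : 'cV[R]_k) i ord0 <= (const_mx 1 : 'cV[R]_k) i ord0.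
  by rewrite !mxE; lra.
apply: le_lt_trans (@leb_le_box R k _ _ _ k0 ab _) (ltry _) => x.
rewrite /eball /= enorm_le1 => x1 i; rewrite !mxE.
have : x i ord0 ^+ 2 <= 1.
  apply: le_trans x1; rewrite dotpE (bigD1 i) //= -expr2 lerDl sumr_ge0 // => j _.
  by rewrite -expr2 sqr_ge0.
by move=> h; rewrite -ler_norml -(ler_pXn2r (ltn0Sn 1)) ?nnegrE // real_normK ?expr1n ?num_real.
Qed.

Lemma leb_affine k (c : 'cV[R]_k) (A : 'M[R]_k) : (0 < k)%N -> \det A != 0 ->
  leb [set c + A *m y | y in eball R k] = ((`|\det A|)%:E * leb (eball R k))%E.
Proof.
move=> k0 A0; by rewrite -leb_linear // -[RHS](leb_translate c) // image_comp.
Qed.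

Lemma leb_dilate k (r : R) : (0 < k)%N -> 0 < r ->
  leb (dilate r (eball R k)) = ((r ^+ k)%:E * leb (eball R k))%E.
Proof.
move=> k0 r0; rewrite /dilate.
have := @leb_affine k 0 r%:M k0; rewrite det_scalar gt_eqF ?exprn_gt0 //.
rewrite gtr0_norm ?exprn_gt0 // => <- //; congr (leb _).
by apply: eq_imagel => y _; rewrite add0r mul_scalar_mx.
Qed.

Lemma mulmx_ext n k (A B : 'M[R]_(n, k)) :
  (forall i, A *m delta_mx i (ord0 : 'I_1) = B *m delta_mx i ord0) -> A = B.
Proof.
move=> AB; apply/matrixP => i j.
by have := congr1 (fun M : 'cV_n => M i ord0) (AB j); rewrite /= -!colE !mxE.
Qed.

(** In any admissible chart the ellipsoid is an affine image of the unit ball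
    by a matrix [W] with [W^T W = T^T T], so that [`|\det W| = \det T] and all
    charts give the same value. *)
Lemma kvol_ellipsoid n k (c : 'cV[R]_n) (Q : 'M[R]_(n, k)) (T : 'M[R]_k) :
  (0 < k)%N -> Q^T *m Q = 1%:M -> 0 < \det T ->
  kvol k [set c + (Q *m T) *m y | y in eball R k] =
  ((\det T)%:E * leb (eball R k))%E.
Proof.
move=> k0 QQ T0; set E := [set _ | _ in _].
have in_ball0 : eball R k 0 by rewrite /eball /= enorm0.
have chart (c' : 'cV[R]_n) (Q' : 'M[R]_(n, k)) : Q'^T *m Q' = 1%:M ->
  E `<=` [set c' + Q' *m y | y in [set: 'cV[R]_k]] ->
  leb [set y | E (c' + Q' *m y)] = ((\det T)%:E * leb (eball R k))%E.
  move=> QQ' Esub; set A := Q *m T.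
  have [y0 _ /= y0E] : [set c' + Q' *m y | y in [set: 'cV[R]_k]] c.
    by apply: Esub; exists 0 => //; rewrite mulmx0 addr0.
  pose W := Q'^T *m A.
  have AE : A = Q' *m W.
    apply: mulmx_ext => i; have [|y1 _ /= y1E] := Esub (c + A *m delta_mx i ord0).
      exists (delta_mx i ord0) => //.
      by rewrite /eball /= enorm_le1 -colE_dotp mxE !eqxx.
    have Ai : A *m delta_mx i ord0 = Q' *m (y1 - y0).
      by rewrite mulmxBr; apply: (addrI c); rewrite -y1E -{1}y0E -[RHS]addrA (addrC (Q' *m y0)) subrK.
    by rewrite -[RHS]mulmxA /W -(mulmxA Q'^T A) Ai (mulmxA Q'^T) QQ' mul1mx.
  have detW : `|\det W| = \det T.
    have : \det (W^T *m W) = \det (T^T *m T).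
      rewrite (_ : W^T *m W = A^T *m A).
        by rewrite /A trmx_mul mulmxA -(mulmxA T^T) QQ mulmx1.
      by rewrite {2}AE mulmxA /W trmx_mul trmxK.
    rewrite !det_mulmx !det_tr -!expr2 => /eqP.
    by rewrite eqf_sqr => /orP[] /eqP ->; rewrite ?normrN gtr0_norm.
  rewrite -detW -(leb_affine y0) //; last by rewrite -normr_eq0 detW gt_eqF.
  congr (leb _); apply/seteqP; split=> [y [z zB]|_ [z zB <-]] /=.
    rewrite -/A AE -y0E -!addrA => /addrI; rewrite -mulmxA -mulmxDr => h.
    by exists z => //; move/(congr1 (mulmx Q'^T)): h; rewrite !(mulmxA Q'^T) QQ' !mul1mx.
  by exists z => //; rewrite -/A AE -y0E mulmxDr !mulmxA addrA.
apply/le_anti/andP; split; last first.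
  by apply: le_ereal_inf_tmp => _ [[c' Q'] [/= h1 h2] <-] /=; rewrite chart.
apply: ereal_inf_lbound; exists (c, Q); last by rewrite /= chart // => _ [z zB <-];
  exists (T *m z); rewrite // mulmxA.
by split=> // _ [z zB <-]; exists (T *m z); rewrite // mulmxA.
Qed.

End LebesgueBall.

(** * John frames and the trace inequalities *)

Section Frame.
Variable R : realType.

Definition john_frame (I : finType) n (lam : I -> R) (u : I -> 'cV[R]_n) : Prop :=
  [/\ forall i, 0 < lam i, forall i, dotp (u i) (u i) = 1,
      \sum_i lam i *: u i = 0 & \sum_i lam i *: (u i *m (u i)^T) = 1%:M].

Lemma dotp_sub_sqr n r (z h : 'cV[R]_n) :
  dotp (r *: z - h) (r *: z - h) = r ^+ 2 * dotp z z - 2 * r * dotp z h + dotp h h.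
Proof. by rewrite !dotpL (dotpC h); ring. Qed.

Lemma frobenius_ge0 n k (A : 'M[R]_(n, k)) : 0 <= \tr (A^T *m A).
Proof.
apply: sumr_ge0 => j _; rewrite mxE; apply: sumr_ge0 => i _.
by rewrite mxE -expr2 sqr_ge0.
Qed.

Lemma frobenius_eq0 n k (A : 'M[R]_(n, k)) : \tr (A^T *m A) = 0 -> A = 0.
Proof.
have pos j : 0 <= (A^T *m A) j j.
  by rewrite mxE; apply: sumr_ge0 => i _; rewrite mxE -expr2 sqr_ge0.
move/eqP; rewrite psumr_eq0 // => /allP h; apply/matrixP => i j; rewrite mxE.
have := h j (mem_index_enum _); rewrite mxE psumr_eq0; last first.
  by move=> l _; rewrite mxE -expr2 sqr_ge0.
by move=> /allP/(_ i (mem_index_enum _)); rewrite mxE -expr2 sqrf_eq0 => /eqP.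
Qed.

Section Frame1.
Variables (I : finType) (n : nat) (lam : I -> R) (u : I -> 'cV[R]_n).
Hypothesis frame : john_frame lam u.

Let lam0 i : 0 < lam i. Proof. by case: frame. Qed.
Let lamW i : 0 <= lam i. Proof. exact: ltW. Qed.
Let u1 i : dotp (u i) (u i) = 1. Proof. by case: frame. Qed.

Lemma frame_lin x : \sum_i lam i * dotp (u i) x = 0.
Proof.
have [_ _ /(congr1 (fun v => dotp v x)) + _] := frame.
rewrite /=; rewrite dotp0l dotp_suml => h; rewrite -[RHS]h; by apply: eq_bigr => i _; rewrite dotpZl.
Qed.

(** Polarized form of the decomposition of the identity; the other identities
    for frames are its instances. *)
Lemma frame_trace k (A B : 'M[R]_(n, k)) :
  \sum_i lam i * dotp (A^T *m u i) (B^T *m u i) = \tr (A^T *m B).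
Proof.
have [_ _ _ /(congr1 (fun M => \tr (A^T *m M *m B)))] := frame.
rewrite mulmx1 => <-; rewrite mulmx_sumr mulmx_suml raddf_sum /=.
apply: eq_bigr => i _; rewrite -scalemxAr -scalemxAl mxtraceZ; congr (_ * _).
by rewrite dotpC dotp_tr trmx_mul trmxK mxtrace_mulC !mulmxA.
Qed.

Lemma frame_dotp x y : \sum_i lam i * (dotp (u i) x * dotp (u i) y) = dotp x y.
Proof.
rewrite dotp_tr -frame_trace; apply: eq_bigr => i _; congr (_ * _).
by rewrite [RHS]dotpE big_ord1 -!/(dotp _ _) dotpC (dotpC _ y).
Qed.

Lemma frame_sum : \sum_i lam i = n%:R.
Proof.
have := frame_trace (1%:M : 'M[R]_n) 1%:M; rewrite trmx1 mul1mx mxtrace1 => <-.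
by apply: eq_bigr => i _; rewrite mul1mx u1 mulr1.
Qed.

Lemma frame_decomp x : x = \sum_i (lam i * dotp (u i) x) *: u i.
Proof.
apply: dotp_ext => z; rewrite -frame_dotp dotp_sumr; apply: eq_bigr => i _.
by rewrite dotpZr (dotpC z) mulrA mulrAC.
Qed.

(** A point [x] with [u i . x <= 1] for all [i] has norm at most [n], as
    [(1 - u i . x) (|x| + u i . x)] is nonnegative and has weighted sum
    [n |x| - |x| ^ 2]. *)
Lemma frame_bounded x : (forall i, dotp (u i) x <= 1) -> enorm x <= n%:R.
Proof.
move=> ux; have [->|x0] := eqVneq x 0; first by rewrite enorm0.
have xp : 0 < enorm x by rewrite sqrtr_gt0 dotp_gt0.
have : 0 <= \sum_i lam i * ((1 - dotp (u i) x) * (enorm x + dotp (u i) x)).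
  apply: sumr_ge0 => i _; rewrite !mulr_ge0 // ?subr_ge0 //.
  by have := cauchy_schwarzN (u i) x; rewrite (enorm_eq1 (u1 i)) mul1r; lra.
rewrite (_ : \sum_i _ = enorm x * \sum_i lam i + (1 - enorm x) *
  (\sum_i lam i * dotp (u i) x) - \sum_i lam i * (dotp (u i) x * dotp (u i) x)).
  rewrite frame_sum frame_lin frame_dotp -enorm_sqr mulr0 addr0 expr2 -mulrBr.
  by rewrite pmulr_rge0 // subr_ge0.
rewrite !mulr_sumr -big_split /= -sumrB; apply: eq_bigr => i _; ring.
Qed.

Section Ellipsoid.
Variables (k : nat) (c : 'cV[R]_n) (A Q : 'M[R]_(n, k)).
Hypothesis k0 : (0 < k)%N.
Hypothesis QQ : Q^T *m Q = 1%:M.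

(** Half the width of the ellipsoid [c + A B] in the direction [u i]. *)
Let a i := enorm (A^T *m u i).
Hypothesis ha : forall i, a i <= 1 - dotp (u i) c.

(** In the identities below these are the quantities [m], [P], [S] and [g] of
    the introduction; [rr i] is the distance that the ellipsoid leaves to the
    supporting hyperplane [u i . x = 1]. *)
Let m := \sum_i lam i * a i.
Let P := \tr (Q^T *m A).
Let S := \tr (A^T *m A).
Let g := - \sum_i (lam i * a i) *: u i.
Let rr i := 1 - dotp (u i) c - a i.

Let a0 i : 0 <= a i. Proof. exact: enorm_ge0. Qed.
Let k0R : 0 < k%:R :> R. Proof. by rewrite ltr0n. Qed.

Lemma sum_width_sqr : \sum_i lam i * a i ^+ 2 = S.
Proof. by rewrite /S -frame_trace; apply: eq_bigr => i _; rewrite enorm_sqr. Qed.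

(* Squared distance of [A] to its orthogonal projection on the line of [Q]. *)
Let frobQ : \tr ((A - (P / k%:R) *: Q)^T *m (A - (P / k%:R) *: Q)) = S - P ^+ 2 / k%:R.
Proof.
rewrite (_ : (_ - _)^T = A^T - (P / k%:R) *: Q^T); last by rewrite linearB /= linearZ.
rewrite mulmxBl !mulmxBr -!scalemxAl -!scalemxAr QQ.
rewrite !linearB /= !mxtraceZ mxtrace1 -/S -/P.
have -> : \tr (A^T *m Q) = P by rewrite -mxtrace_tr trmx_mul trmxK.
by field; rewrite gt_eqF.
Qed.

Lemma trace_sqr_le : P ^+ 2 <= k%:R * S.
Proof.
have := frobenius_ge0 (A - (P / k%:R) *: Q).
by rewrite frobQ subr_ge0 ler_pdivrMr // mulrC.
Qed.

Lemma trace_sqr_eq : P ^+ 2 = k%:R * S -> A = (P / k%:R) *: Q.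
Proof.
move=> PS; apply/eqP; rewrite -subr_eq0; apply/eqP/frobenius_eq0.
by rewrite frobQ PS; field; rewrite gt_eqF.
Qed.

Let sum_slack : \sum_i lam i * rr i = n%:R - m.
Proof.
transitivity (\sum_i lam i - \sum_i lam i * dotp (u i) c - m).
  by rewrite -!sumrB; apply: eq_bigr => i _; rewrite /rr; ring.
by rewrite frame_lin subr0 frame_sum.
Qed.

Let rr0 i : 0 <= rr i. Proof. by rewrite subr_ge0. Qed.

Lemma sum_width_le : m <= n%:R.
Proof. by rewrite -subr_ge0 -sum_slack sumr_ge0 // => i _; rewrite mulr_ge0. Qed.

Lemma sum_width_eq : m = n%:R -> forall i, a i = 1 - dotp (u i) c.
Proof.
move=> mn i; have := sum_slack; rewrite mn subrr => /eqP.
rewrite psumr_eq0 => [/allP/(_ i (mem_index_enum _))|j _]; last by rewrite mulr_ge0.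
by rewrite mulf_eq0 gt_eqF //= subr_eq0 => /eqP.
Qed.

Let dotg x : dotp g x = - \sum_i lam i * a i * dotp (u i) x.
Proof.
by rewrite dotpNl dotp_suml; congr (- _); apply: eq_bigr => i _; rewrite dotpZl.
Qed.

Lemma sum_width_sqr_le : S <= m + dotp g c.
Proof.
rewrite -sum_width_sqr dotg /m -sumrB; apply: ler_sum => i _.
rewrite -mulrA -mulrBr ler_wpM2l // -[X in X - _]mulr1 -mulrBr expr2.
by rewrite ler_wpM2l.
Qed.

(* [c - g] is the sum of the vectors [- (lam i * rr i) *: u i]. *)
Let g_c : dotp g c <= dotp g g + (n%:R - m) * enorm g.
Proof.
rewrite -sum_slack mulr_suml -lerBlDl.
rewrite (_ : _ - _ = - \sum_i lam i * rr i * dotp (u i) g); last first.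
  rewrite (_ : \sum_i _ = (\sum_i lam i * dotp (u i) g) -
    (\sum_i lam i * (dotp (u i) c * dotp (u i) g)) - \sum_i lam i * a i * dotp (u i) g).
    rewrite frame_lin frame_dotp (dotpC c) (dotg g); ring.
  by rewrite -!sumrB; apply: eq_bigr => i _; rewrite /rr; ring.
rewrite -sumrN; apply: ler_sum => i _.
rewrite -mulrN ler_wpM2l ?mulr_ge0 // lerNl.
by have := cauchy_schwarzN (u i) g; rewrite (enorm_eq1 (u1 i)) mul1r.
Qed.

(** The sum of squares behind [P ^ 2 + |g| ^ 2 <= m ^ 2]: the weighted sum of the
    [a i |m u i - v i| ^ 2] is [m] times the difference of the two sides. *)
Let y i := (a i)^-1 *: (A^T *m u i).
Let v i := P *: (Q *m y i) - g.

Let ayE i : a i *: y i = A^T *m u i.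
Proof.
rewrite /y scalerA; have [ai0|ai0] := eqVneq (a i) 0.
  by rewrite (enorm0_eq ai0) scaler0.
by rewrite mulfV // scale1r.
Qed.

Let ay1 i : a i * dotp (y i) (y i) = a i.
Proof.
have [->|ai0] := eqVneq (a i) 0; first by rewrite mul0r.
by rewrite /y !dotpL -enorm_sqr -/(a i); field.
Qed.

Let dot_uQ i z : dotp (u i) (Q *m z) = dotp z (Q^T *m u i).
Proof. by rewrite dotpC dotp_adjoint. Qed.

Let dot_uv : \sum_i lam i * (a i * dotp (u i) (v i)) = P ^+ 2 + dotp g g.
Proof.
rewrite expr2 {2}/P -(frame_trace Q A) (dotg g) mulr_sumr -sumrB.
apply: eq_bigr => i _; rewrite /v !dotpL dot_uQ -(ayE i) dotpZr dotpC; ring.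
Qed.

Let dot_vv : \sum_i lam i * (a i * dotp (v i) (v i)) = m * (P ^+ 2 + dotp g g).
Proof.
have QyE i : dotp (Q *m y i) (Q *m y i) = dotp (y i) (y i).
  by rewrite dotp_adjoint mulmxA QQ mul1mx.
transitivity (\sum_i (lam i * a i * (P ^+ 2 + dotp g g) -
  2 * P * (lam i * dotp (u i) (A *m (Q^T *m g))))).
  apply: eq_bigr => i _; rewrite /v dotp_sub_sqr QyE.
  have -> : a i * (P ^+ 2 * dotp (y i) (y i) - 2 * P * dotp (Q *m y i) g +
     dotp g g) = P * P * (a i * dotp (y i) (y i)) -
     2 * P * dotp (a i *: y i) (Q^T *m g) + a i * dotp g g.
    by rewrite (dotpZl (a i)) (dotp_adjoint Q); ring.
  by rewrite ay1 ayE (dotp_adjoint A^T) trmxK; ring.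
by rewrite sumrB -mulr_sumr frame_lin mulr0 subr0 mulr_suml.
Qed.

Let sum_defect : \sum_i lam i * (a i * dotp (m *: u i - v i) (m *: u i - v i)) =
  m * (m ^+ 2 - (P ^+ 2 + dotp g g)).
Proof.
transitivity (\sum_i (m ^+ 2 * (lam i * a i) -
   2 * m * (lam i * (a i * dotp (u i) (v i))) +
   lam i * (a i * dotp (v i) (v i)))).
  by apply: eq_bigr => i _; rewrite dotp_sub_sqr u1; ring.
by rewrite big_split sumrB -!mulr_sumr dot_uv /= dot_vv -/m; ring.
Qed.

Lemma sum_width_gt0 : 0 < P -> 0 < m.
Proof.
move=> P0; have m0 : 0 <= m by rewrite sumr_ge0 // => i _; rewrite mulr_ge0.
rewrite lt_def m0 andbT; apply/eqP => /eqP.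
rewrite psumr_eq0 => [/allP h|i _]; last by rewrite mulr_ge0.
have S0 : S = 0.
  rewrite -sum_width_sqr big1 // => i _; have := h i (mem_index_enum _).
  by rewrite mulf_eq0 gt_eqF //= => /eqP ->; rewrite expr0n mulr0.
have := trace_sqr_le; rewrite S0 mulr0 => h2.
by have := exprn_gt0 2 P0; lra.
Qed.

Lemma trace_center_le : 0 < P -> P ^+ 2 + dotp g g <= m ^+ 2.
Proof.
move=> /sum_width_gt0 m0; rewrite -subr_ge0 -(pmulr_rge0 _ m0) -sum_defect.
by apply: sumr_ge0 => i _; rewrite !mulr_ge0 // dotp_ge0.
Qed.

Lemma trace_center_eq i : P ^+ 2 + dotp g g = m ^+ 2 -> a i != 0 -> m *: u i = v i.
Proof.
move=> e ai; have := sum_defect; rewrite e subrr mulr0 => /eqP.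
rewrite psumr_eq0 => [/allP/(_ i (mem_index_enum _))|j _]; last first.
  by rewrite !mulr_ge0 // dotp_ge0.
rewrite mulf_eq0 gt_eqF //= mulf_eq0 (negbTE ai) /= => /eqP/dotp_eq0/eqP.
by rewrite subr_eq0 => /eqP.
Qed.

Let g_le : 0 < P -> enorm g <= m.
Proof.
move=> P0; have m0 := sum_width_gt0 P0; have g0 := enorm_ge0 g.
have := trace_center_le P0; rewrite -enorm_sqr => h.
by rewrite -(@ler_pXn2r _ 2) ?nnegrE ?(ltW m0) //; have := sqr_ge0 P; lra.
Qed.

(** [P ^ 2 + S <= m ^ 2 - |g| ^ 2 + m + |g| ^ 2 + (n - m) |g|], where [|g| <= m]. *)
Lemma trace_width_le : 0 < P -> P ^+ 2 + S <= m * (n%:R + 1).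
Proof.
move=> P0; have h2 := sum_width_sqr_le; have h3 := g_c; have h4 := trace_center_le P0.
have h5 := g_le P0; have h6 := sum_width_le; have g0 := enorm_ge0 g; nra.
Qed.

Lemma sum_width_defect f : \sum_i lam i * (a i * (f - a i)) = f * m - S.
Proof.
by rewrite -sum_width_sqr mulr_sumr -sumrB; apply: eq_bigr => i _; ring.
Qed.

Section Equality.
Hypothesis mn : m = n%:R.
Variable r : R.
Hypothesis r0 : 0 < r.
Hypothesis AQ : A = r *: Q.

Let aE i : a i = 1 - dotp (u i) c. Proof. exact: sum_width_eq. Qed.

Let QE i : A^T *m u i = r *: (Q^T *m u i).
Proof. by rewrite AQ linearZ /= -scalemxAl. Qed.

Let Qu0 i : a i = 0 -> Q^T *m u i = 0.
Proof.
move=> /enorm0_eq; rewrite QE => /eqP.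
by rewrite scaler_eq0 gt_eqF //= => /eqP.
Qed.

Lemma width_centerE : g = c.
Proof.
apply: dotp_ext => z; rewrite dotpC dotg.
transitivity (- (\sum_i lam i * dotp (u i) z -
     \sum_i lam i * (dotp (u i) z * dotp (u i) c))).
  by rewrite -sumrB; congr (- _); apply: eq_bigr => i _; rewrite aE; ring.
by rewrite frame_lin frame_dotp; ring.
Qed.

Lemma sum_width_sqr_center : S = n%:R + dotp c c.
Proof.
rewrite -sum_width_sqr; transitivity (\sum_i lam i - 2 * (\sum_i lam i * dotp (u i) c) +
     \sum_i lam i * (dotp (u i) c * dotp (u i) c)).
  rewrite mulr_sumr -sumrB -big_split /=; apply: eq_bigr => i _; rewrite aE; ring.
by rewrite frame_lin frame_dotp frame_sum; ring.
Qed.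

(** Expand [c] in the frame: [Q^T u i = 0] when [a i = 0], and [u i . c = 1 - f]
    otherwise, so that [Q^T c] is a multiple of [Q^T] applied to the sum of the
    [lam i *: u i]. *)
Lemma center_orth_asym f : (forall i, a i = 0 \/ a i = f) -> Q^T *m c = 0.
Proof.
move=> af; rewrite [c]frame_decomp mulmx_sumr.
transitivity ((1 - f) *: (Q^T *m \sum_i lam i *: u i)); last first.
  by case: frame => _ _ -> _; rewrite mulmx0 scaler0.
rewrite mulmx_sumr scaler_sumr; apply: eq_bigr => i _.
rewrite -!scalemxAr scalerA; case: (af i) => [/Qu0 ->|ai]; first by rewrite !scaler0.
by congr (_ *: _); have := aE i; rewrite ai => ->; ring.
Qed.

(** In the equality case [m u i = v i], comparing the squared lengths of both
    sides makes [Q^T u i] orthogonal to [Q^T c] for all [i]. *)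
Lemma center_orth_dim : 0 < P -> P ^+ 2 + dotp c c = n%:R ^+ 2 -> Q^T *m c = 0.
Proof.
move=> P0 e; have gc := width_centerE.
have orth i : dotp (Q^T *m u i) (Q^T *m c) = 0.
  have [/Qu0 ->|ai] := eqVneq (a i) 0; first by rewrite dotp0l.
  have := @trace_center_eq i; rewrite gc mn => /(_ e ai) /(congr1 (fun z => dotp z z)).
  rewrite /v dotp_sub_sqr gc dotpZl dotpZr u1 dotp_adjoint mulmxA QQ mul1mx.
  have -> : dotp (y i) (y i) = 1 by apply: (mulfI ai); rewrite ay1 mulr1.
  move=> h; have : P * dotp (Q *m y i) c = 0 by lra.
  move/eqP; rewrite mulf_eq0 gt_eqF //= dotp_adjoint /y dotpZl mulf_eq0.
  by rewrite invr_eq0 (negbTE ai) /= QE dotpZl mulf_eq0 gt_eqF //= => /eqP.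
have /dotp_eq0 x0 : dotp (Q *m (Q^T *m c)) (Q *m (Q^T *m c)) = 0.
  by rewrite -frame_dotp big1 // => i _; rewrite dot_uQ dotpC orth mul0r mulr0.
by rewrite -[LHS]mul1mx -QQ -mulmxA x0 mulmx0.
Qed.

End Equality.

End Ellipsoid.

(** The two terms of [min_factor] come from [P ^ 2 <= k S <= k m (s + 1) / 2] and
    from [(k + 1) P ^ 2 <= k (P ^ 2 + S) <= k m (n + 1)]. *)
Lemma frame_trace_le k (c : 'cV[R]_n) (A Q : 'M[R]_(n, k)) (s : R) :
  (0 < k)%N -> Q^T *m Q = 1%:M -> 0 <= s -> 0 < \tr (Q^T *m A) ->
  (forall i, enorm (A^T *m u i) <= 1 - dotp (u i) c) ->
  (forall i, enorm (A^T *m u i) <= s + dotp (u i) c) ->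
  \tr (Q^T *m A) ^+ 2 <= k%:R * (n%:R * min_factor n k s).
Proof.
move=> k0 QQ s0 P0 ha hs; have k0R : 0 < k%:R :> R by rewrite ltr0n.
set P := \tr _; set f := (s + 1) / 2.
have af i : enorm (A^T *m u i) <= f by have := ha i; have := hs i; rewrite /f; lra.
have mn := sum_width_le ha; set m := (X in X <= _) in mn.
have h2 := trace_width_le k0 QQ ha P0; rewrite -/m -/P in h2.
have h3 := trace_sqr_le A k0 QQ; rewrite -/P in h3; set S := \tr _ in h2 h3.
have h1 : S <= f * m.
  rewrite -subr_ge0 -sum_width_defect; apply: sumr_ge0 => i _.
  by rewrite !mulr_ge0 ?enorm_ge0 // subr_ge0.
have P20 : 0 < P ^+ 2 by rewrite exprn_gt0.
rewrite /min_factor; have [_|_] := leP f.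
  have : k%:R * S <= k%:R * (n%:R * f); last by lra.
  by rewrite ler_pM2l //; have : 0 <= f; [rewrite /f; lra|nra].
have k1 : 0 < k%:R + 1 :> R by lra.
rewrite -(ler_pM2l k1) (_ : _ * (k%:R * _) = k%:R * (n%:R * (n%:R + 1))); last first.
  by field; rewrite gt_eqF.
have n0 : 0 <= n%:R :> R by [].
have : k%:R * (P ^+ 2 + S) <= k%:R * (n%:R * (n%:R + 1)); last by lra.
by rewrite ler_pM2l //; apply: le_trans h2 _; rewrite ler_wpM2r //; lra.
Qed.

(** Equality forces [m = n] and [P ^ 2 = k S] whichever term is the smaller one;
    the two orthogonality lemmas above cover the two cases. *)
Lemma frame_trace_eq k (c : 'cV[R]_n) (A Q : 'M[R]_(n, k)) (s : R) :
  (0 < k)%N -> Q^T *m Q = 1%:M -> 0 <= s -> 0 < \tr (Q^T *m A) ->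
  (forall i, enorm (A^T *m u i) <= 1 - dotp (u i) c) ->
  (forall i, enorm (A^T *m u i) <= s + dotp (u i) c) ->
  \tr (Q^T *m A) ^+ 2 = k%:R * (n%:R * min_factor n k s) ->
  [/\ A = (\tr (Q^T *m A) / k%:R) *: Q, Q^T *m c = 0,
      dotp c c = n%:R * (min_factor n k s - 1)
    & (s + 1) / 2 <= (n%:R + 1) / (k%:R + 1) -> forall i,
      1 - dotp (u i) c = 0 \/ 1 - dotp (u i) c = (s + 1) / 2].
Proof.
move=> k0 QQ s0 P0 ha hs; set P := \tr _; have k0R : 0 < k%:R :> R by rewrite ltr0n.
set f := (s + 1) / 2.
have af i : enorm (A^T *m u i) <= f by have := ha i; have := hs i; rewrite /f; lra.
have mn := sum_width_le ha; have m0 := sum_width_gt0 k0 QQ P0.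
set m := (X in X <= _) in mn; rewrite -/m in m0.
have h2 := trace_width_le k0 QQ ha P0; rewrite -/m -/P in h2.
have h3 := trace_sqr_le A k0 QQ; rewrite -/P in h3; set S := \tr _ in h2 h3.
have h1 : S <= f * m.
  rewrite -subr_ge0 -sum_width_defect; apply: sumr_ge0 => i _.
  by rewrite !mulr_ge0 ?enorm_ge0 // subr_ge0.
have n0 : 0 < n%:R :> R by apply: lt_le_trans mn.
have P20 : 0 < P ^+ 2 by rewrite exprn_gt0.
have r0 : 0 < P / k%:R by rewrite divr_gt0.
have k1 : 0 < k%:R + 1 :> R by lra.
set F := min_factor n k s => PE.
suff [mE SE orth] : [/\ m = n%:R, P ^+ 2 = k%:R * S &
   (m = n%:R -> A = (P / k%:R) *: Q -> S = n%:R * F -> S = n%:R + dotp c c ->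
    Q^T *m c = 0 /\ (f <= (n%:R + 1) / (k%:R + 1) -> forall i,
      1 - dotp (u i) c = 0 \/ 1 - dotp (u i) c = f))].
  have AQ := trace_sqr_eq k0 QQ SE.
  have SF : S = n%:R * F by apply: (mulfI (lt0r_neq0 k0R)); rewrite -PE -SE.
  have Sc := sum_width_sqr_center ha mE.
  have [oc hf] := orth mE AQ SF Sc.
  by split=> //; move: Sc; rewrite -/S SF; lra.
have asym : f <= (n%:R + 1) / (k%:R + 1) -> m = n%:R -> S = n%:R * F ->
    forall i, enorm (A^T *m u i) = 0 \/ enorm (A^T *m u i) = f.
  move=> fle mE SF i; have := sum_width_defect A f.
  rewrite -/m -/S SF mE /F /min_factor -/f min_l // mulrC subrr => /eqP.
  rewrite psumr_eq0; last first.
    by move=> j _; rewrite !mulr_ge0 ?enorm_ge0 // subr_ge0.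
  move=> /allP/(_ i (mem_index_enum _)); rewrite mulf_eq0 gt_eqF //= mulf_eq0 subr_eq0.
  by case/orP => /eqP; [left|right].
have [fle|flt] := leP f ((n%:R + 1) / (k%:R + 1)).
  have FE : F = f by rewrite /F /min_factor -/f min_l.
  have f0 : 0 < f.
    have : 0 < k%:R * (n%:R * f) by rewrite -FE -PE.
    by rewrite (pmulr_rgt0 _ k0R) (pmulr_rgt0 _ n0).
  have mE : m = n%:R.
    apply/le_anti; rewrite mn -(ler_pM2l f0) -(ler_pM2l k0R) (mulrC f n%:R) -FE -PE FE.
    by apply: le_trans h3 _; rewrite ler_pM2l.
  split=> //.
    apply/le_anti; rewrite h3 PE FE ler_pM2l //=; apply: le_trans h1 _.
    by rewrite mE mulrC.
  move=> _ AQ SF Sc; split; last first.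
    by move=> _ i; rewrite -(sum_width_eq ha mE i); exact: asym.
  exact: (center_orth_asym ha mE r0 AQ (asym fle mE SF)).
have FE : F = (n%:R + 1) / (k%:R + 1).
  by rewrite /F /min_factor -/f min_r // ltW.
have PE' : (k%:R + 1) * P ^+ 2 = k%:R * (n%:R * (n%:R + 1)).
  by rewrite PE FE; field; rewrite gt_eqF.
have mE : m = n%:R.
  have n1 : 0 < n%:R + 1 :> R by lra.
  apply/le_anti; rewrite mn -(ler_pM2r n1) -(ler_pM2l k0R) -PE'.
  have : k%:R * (P ^+ 2 + S) <= k%:R * (m * (n%:R + 1)); last by lra.
  by rewrite ler_pM2l.
split=> //.
  have : k%:R * (P ^+ 2 + S) <= k%:R * (n%:R * (n%:R + 1)); last by lra.
  by rewrite ler_pM2l //; apply: le_trans h2 _; rewrite mE.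
move=> _ AQ SF Sc; split; last by [].
apply: (center_orth_dim QQ ha mE r0 AQ P0).
have cE : dotp c c = n%:R * F - n%:R by lra.
by rewrite cE -/P PE FE; field; rewrite gt_eqF.
Qed.

End Frame1.
End Frame.

(** * Continuity, separation and convex hulls *)

Section Topology.
Variable R : realType.

Lemma continuous_fin_sum (T : topologicalType) (I : finType) (f : I -> T -> R) :
  (forall i, continuous (f i)) -> continuous (fun x => \sum_i f i x).
Proof.
move=> cf; have main (s : seq I) : continuous (fun x => \sum_(i <- s) f i x).
  elim: s => [|i s IH].
    rewrite (_ : (fun x => _) = fun=> 0); first exact: cst_continuous.
    by apply/funext => x; rewrite big_nil.
  rewrite (_ : (fun x => _) = fun x => f i x + \sum_(j <- s) f j x); last first.
    by apply/funext => x; rewrite big_cons.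
  by move=> x; apply: cvgD; [exact: cf|exact: IH].
exact: main.
Qed.

Lemma continuous_mx (T : topologicalType) m n (f : T -> 'M[R]_(m, n)) :
  (forall i j, continuous (fun x => f x i j)) -> continuous f.
Proof.
move=> cf x A [P Pf PA]; apply: (filterS (P := [set y | forall i j, P i j (f y i j)])).
  by move=> y; exact: PA.
by apply: filter_forall => i; apply: filter_forall => j; exact: cf (Pf i j).
Qed.

Lemma continuous_coord (T : topologicalType) m n (f : T -> 'M[R]_(m, n)) i j :
  continuous f -> continuous (fun x => f x i j).
Proof.
move=> cf x; apply: (@continuous_comp _ _ _ f (fun M : 'M[R]_(m, n) => M i j)).
  exact: cf.
exact: coord_continuous.
Qed.

Lemma continuous_mulR (T : topologicalType) (f g : T -> R) :
  continuous f -> continuous g -> continuous (fun x => f x * g x).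
Proof. by move=> cf cg x; apply: cvgM; [exact: cf|exact: cg]. Qed.

Lemma continuous_mulmx (T : topologicalType) m n p (f : T -> 'M[R]_(m, n))
    (g : T -> 'M[R]_(n, p)) :
  continuous f -> continuous g -> continuous (fun x => f x *m g x).
Proof.
move=> cf cg; apply: continuous_mx => i j.
rewrite (_ : (fun x => _) = fun x => \sum_l f x i l * g x l j); last first.
  by apply/funext => x; rewrite mxE.
by apply: continuous_fin_sum => l; apply: continuous_mulR; exact: continuous_coord.
Qed.

Lemma continuous_trmx (T : topologicalType) m n (f : T -> 'M[R]_(m, n)) :
  continuous f -> continuous (fun x => (f x)^T).
Proof.
move=> cf; apply: continuous_mx => i j.
rewrite (_ : (fun x => _) = fun x => f x j i); last by apply/funext => x; rewrite mxE.
exact: continuous_coord.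
Qed.

Lemma continuous_dotp (T : topologicalType) n (f g : T -> 'cV[R]_n) :
  continuous f -> continuous g -> continuous (fun x => dotp (f x) (g x)).
Proof.
move=> cf cg; apply: continuous_coord.
by apply: continuous_mulmx => //; exact: continuous_trmx.
Qed.

Lemma closed_le_continuous (T : topologicalType) (f : T -> R) r :
  continuous f -> closed [set x | f x <= r].
Proof. by move=> cf; apply: (preimage_closed _ (@closed_le _ r)) => y _; exact: cf. Qed.

Lemma closed_ge_continuous (T : topologicalType) (f : T -> R) r :
  continuous f -> closed [set x | r <= f x].
Proof. by move=> cf; apply: (preimage_closed _ (@closed_ge _ r)) => y _; exact: cf. Qed.

Lemma closed_eq_continuous (T : topologicalType) (f : T -> R) r :
  continuous f -> closed [set x | f x = r].
Proof. by move=> cf; apply: (preimage_closed _ (@closed_eq _ r)) => y _; exact: cf. Qed.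

Definition convex n (K : set 'cV[R]_n) := forall x y t, K x -> K y -> 0 <= t <= 1 ->
  K (t *: x + (1 - t) *: y).

Lemma convex_setP n (K : set 'cV[R]_n) :
  convex_set (K : set (convex_lmodType 'cV[R]_n)) <-> convex K.
Proof.
split=> [h x y t Kx Ky t01|h x y l /set_mem Kx /set_mem Ky]; last first.
  apply/mem_set; apply: (h x y l%:num) => //.
  by apply/andP; split.
pose l : {i01 R} := Itv01 (proj1 (andP t01)) (proj2 (andP t01)).
by have /set_mem := h x y l (mem_set Kx) (mem_set Ky).
Qed.

(** Separation by the nearest point [p]: the vector [v = x - p] works. *)
Lemma separation n (K : set 'cV[R]_n) (x : 'cV[R]_n) :
  K !=set0 -> compact K -> convex K -> ~ K x ->
  exists2 v, 0 < dotp v v & forall y, K y -> dotp v y <= dotp v x - dotp v v.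
Proof.
move=> K0 cK convK Kx.
have cst_c : continuous (fun _ : 'cV[R]_n => x) by exact: cst_continuous.
have sub_c : continuous (fun y : 'cV[R]_n => y - x).
  by move=> y; apply: continuousB; [exact: cvg_id|exact: cst_c].
have [p /set_mem Kp pmin] := compact_EVT_min K0 cK
  (continuous_subspaceT (continuous_dotp sub_c sub_c)).
exists (x - p).
  by apply: dotp_gt0; rewrite subr_eq0; apply/eqP => xp; apply: Kx; rewrite xp.
move=> y Ky.
suff : dotp (x - p) (y - p) <= 0 by rewrite !dotpL; rewrite (dotpC p x); lra.
rewrite leNgt; apply/negP => pos.
set d := dotp (y - p) (y - p); have d0 : 0 <= d by exact: dotp_ge0.
pose e := dotp (x - p) (y - p); rewrite -/e in pos.
have line t : 0 <= t <= 1 -> 0 <= - (2 * t * e) + t ^+ 2 * d.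
  move=> t01; have /mem_set/pmin := convK y p t Ky Kp t01.
  have -> : t *: y + (1 - t) *: p - x = t *: (y - p) - (x - p).
    by apply/colP => i; rewrite !mxE; ring.
  rewrite dotp_sub_sqr -/d (dotpC (y - p)) -/e -[p - x]opprB dotpNl dotpNr opprK; lra.
pose t := Num.min 1 (e / (d + 1)).
have d1 : 0 < d + 1 by lra.
have t0 : 0 < t by rewrite lt_min ltr01 divr_gt0.
have t1 : t <= 1 by rewrite ge_min lexx.
have te : t * (d + 1) <= e by rewrite -ler_pdivlMr // ge_min lexx orbT.
have := line t; rewrite t1 (ltW t0) => /(_ isT).
have : t * (2 * e - t * d) > 0 by rewrite mulr_gt0 //; nra.
by lra.
Qed.

(** The hull of the image under [phi] of [U], stratified by the number [N] of
    points in a convex combination: for fixed [N] it is a continuous image of a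
    compact set, and by Carathéodory's theorem [N = D.+1] points suffice. *)
Section Hull.
Variables (D n : nat) (U : set 'cV[R]_n) (phi : 'cV[R]_n -> 'cV[R]_D).

Definition convex_comb N (mu : 'I_N -> R) (w : 'I_N -> 'cV[R]_n) (p : 'cV[R]_D) :=
  [/\ forall i, 0 <= mu i, forall i, U (w i), \sum_i mu i = 1
    & p = \sum_i mu i *: phi (w i)].

Definition hull N : set 'cV[R]_D := [set p | exists mu w, @convex_comb N mu w p].

Lemma hull_drop N (mu : 'I_N.+1 -> R) w p i :
  convex_comb mu w p -> mu i = 0 -> hull N p.
Proof.
case=> mu0 Uw mu1 pE mui; exists (fun j => mu (lift i j)), (fun j => w (lift i j)).
split=> //.
  by rewrite -[RHS]mu1 (bigD1_ord i) //= mui add0r.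
by rewrite pE (bigD1_ord i) //= mui scale0r add0r.
Qed.

Lemma hull_pad N p : hull N.+1 p -> hull N.+2 p.
Proof.
move=> [mu [w [mu0 Uw mu1 pE]]].
exists (fun i => if unlift ord0 i is Some j then mu j else 0),
       (fun i => if unlift ord0 i is Some j then w j else w ord0).
split.
- by move=> i; case: unliftP.
- by move=> i; case: unliftP.
- rewrite big_ord_recl unlift_none add0r -[RHS]mu1.
  by apply: eq_bigr => i _; rewrite liftK.
- rewrite big_ord_recl unlift_none scale0r add0r pE.
  by apply: eq_bigr => i _; rewrite liftK.
Qed.

(** An affine dependency of the points allows the weights to be shifted until
    one of them vanishes. *)
Lemma hull_reduce N p : (D < N)%N -> hull N.+1 p -> hull N p.
Proof.
move=> DN [mu [w [mu0 Uw mu1 pE]]].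
pose B : 'M[R]_(N.+1, D + 1) := \matrix_(i, j)
  (col_mx (phi (w i)) (1%:M : 'cV_1)) j ord0.
have [v /sub_kermxP vB v0] : exists2 v : 'rV_N.+1, (v <= kermx B)%MS & v != 0.
  apply/rowV0Pn; rewrite -mxrank_eq0 mxrank_ker subn_eq0 -ltnNge.
  by rewrite (leq_ltn_trans (rank_leq_col _)) // addn1 ltnS.
have vphi : \sum_i v ord0 i *: phi (w i) = 0.
  apply/colP => j; have /matrixP/(_ ord0 (lshift 1 j)) := vB.
  rewrite !mxE summxE => h; rewrite -[RHS]h; apply: eq_bigr => i _.
  by rewrite [B i _]mxE col_mxEu mxE.
have v1 : \sum_i v ord0 i = 0.
  have /matrixP/(_ ord0 (rshift D ord0)) := vB.
  rewrite !mxE => h; rewrite -[RHS]h; apply: eq_bigr => i _.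
  by rewrite [B i _]mxE col_mxEd mxE eqxx mulr1.
have [i0 vi0] : exists i, 0 < v ord0 i.
  apply/existsP; apply: contra_neqT v0; rewrite negb_exists => /forallP neg.
  apply/rowP => i; rewrite mxE; apply/eqP.
  have : \sum_i - v ord0 i = 0 by rewrite sumrN v1 oppr0.
  move/eqP; rewrite psumr_eq0 => [/allP/(_ i (mem_index_enum _))|j _].
    by rewrite oppr_eq0.
  by rewrite oppr_ge0 leNgt; exact: neg.
pose i1 := [arg min_(i < i0 | 0 < v ord0 i) (mu i / v ord0 i)]%O.
have [vi1 i1min] : 0 < v ord0 i1 /\ forall i, 0 < v ord0 i ->
    mu i1 / v ord0 i1 <= mu i / v ord0 i.
  by rewrite /i1; case: arg_minP => // i vi imin; split.
set t := mu i1 / v ord0 i1 in i1min.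
have t0 : 0 <= t by rewrite divr_ge0 // ltW.
apply: (@hull_drop N (fun i => mu i - t * v ord0 i) w p i1); last first.
  by rewrite /t; field; rewrite gt_eqF.
split=> //.
- move=> i; rewrite subr_ge0; have [vi|vi] := ltP 0 (v ord0 i).
    by rewrite -ler_pdivlMr // i1min.
  by rewrite (le_trans (mulr_ge0_le0 t0 vi)).
- by rewrite sumrB -mulr_sumr v1 mulr0 subr0.
- rewrite pE; under [RHS]eq_bigr do rewrite scalerBl -scalerA.
  by rewrite sumrB -scaler_sumr vphi scaler0 subr0.
Qed.

Lemma caratheodory N p : hull N p -> hull D.+1 p.
Proof.
have [ND|DN] := leqP N D.+1.
  rewrite -(subnK ND); elim: (D.+1 - N)%N => // d IH /IH.
  rewrite addSn; case: (d + N)%N => [|//]; last by move=> M; exact: hull_pad.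
  by move=> [mu [w [_ _]]]; rewrite big_ord0 => /eqP; rewrite eq_sym oner_eq0.
rewrite -(subnK (ltnW DN)); elim: (N - D.+1)%N => // d IH.
rewrite addSn => /hull_reduce h; apply: IH; apply: h.
by rewrite addnS ltnS leq_addl.
Qed.

Lemma hull_convex : convex (hull D.+1).
Proof.
move=> p q t [mu [w [mu0 Uw mu1 pE]]] [nu [z [nu0 Uz nu1 qE]]] /andP[t0 t1].
apply: (@caratheodory (D.+1 + D.+1)).
exists (fun i => match fintype.split i with inl j => t * mu j | inr j => (1 - t) * nu j end),
       (fun i => match fintype.split i with inl j => w j | inr j => z j end).
have splitl i : fintype.split (lshift D.+1 i) = inl i :> 'I_D.+1 + 'I_D.+1.
  exact: (unsplitK (inl i)).
have splitr i : fintype.split (rshift D.+1 i) = inr i :> 'I_D.+1 + 'I_D.+1.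
  exact: (unsplitK (inr i)).
split.
- by move=> i; case: fintype.split => j; rewrite mulr_ge0 // subr_ge0.
- by move=> i; case: fintype.split.
- rewrite big_split_ord /=; under eq_bigr do rewrite splitl.
  under [X in _ + X]eq_bigr do rewrite splitr.
  by rewrite -!mulr_sumr mu1 nu1; ring.
- rewrite big_split_ord /= pE qE !scaler_sumr.
  by congr (_ + _); apply: eq_bigr => i _; rewrite ?splitl ?splitr scalerA.
Qed.

Hypothesis cphi : continuous phi.
Hypothesis cU : compact U.

Lemma hull_compact N : compact (hull N).
Proof.
pose T := prod_topology (fun _ : 'I_N => (R * 'cV[R]_n)%type).
pose C : set T := [set f | forall i, (`[0, 1]%classic `*` U) (f i)].
have cC : compact C.
  apply: (@tychonoff 'I_N (fun _ => (R * 'cV[R]_n)%type : topologicalType)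
    (fun _ => `[0, 1]%classic `*` U)) => i.
  by apply: compact_setX => //; exact: segment_compact.
have proj1c i : continuous (fun f : T => (f i).1).
  move=> f; apply: (@continuous_comp _ _ _ (fun f : T => f i) fst).
    exact: (@proj_continuous _ _ i f).
  exact: cvg_fst.
have proj2c i : continuous (fun f : T => phi (f i).2).
  move=> f; apply: (@continuous_comp _ _ _ (fun f : T => (f i).2) phi).
    apply: (@continuous_comp _ _ _ (fun f : T => f i) snd).
      exact: (@proj_continuous _ _ i f).
    exact: cvg_snd.
  exact: cphi.
pose sum1 : set T := [set f | \sum_i (f i).1 = 1].
have cS : compact (C `&` sum1).
  by apply: compact_closedI => //; apply: closed_eq_continuous; exact: continuous_fin_sum.
pose G (f : T) : 'cV[R]_D := \sum_i (f i).1 *: phi (f i).2.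
have cG : continuous G.
  apply: continuous_mx => i j.
  rewrite (_ : (fun x => _) = fun f => \sum_l (f l).1 * phi (f l).2 i j); last first.
    by apply/funext => f; rewrite summxE; apply: eq_bigr => l _; rewrite mxE.
  apply: continuous_fin_sum => l; apply: continuous_mulR => //.
  exact: continuous_coord.
rewrite (_ : hull N = G @` (C `&` sum1)).
  by apply: continuous_compact => //; exact: continuous_subspaceT.
apply/seteqP; split=> [p [mu [w [mu0 Uw mu1 ->]]]|_ [f [Cf f1] <-]].
  exists (fun i => (mu i, w i)) => //; split=> // i; split=> //=.
  rewrite in_itv /= mu0 -mu1 (bigD1 i) //= lerDl sumr_ge0 //.
exists (fun i => (f i).1), (fun i => (f i).2); split=> // i; have [] := Cf i => //.
by rewrite /= in_itv => /andP[].
Qed.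

End Hull.
End Topology.

(** * John's theorem *)

Section John.
Variable R : realType.

(** [\det (1 + t H) = t ^ n chi (1 / t)] for the characteristic polynomial [chi] of
    [- H], whose two leading coefficients are [1] and [\tr H]. *)
Lemma det_perturb n (H : 'M[R]_n.+1) : 0 < \tr H ->
  exists2 t0, 0 < t0 & forall t, 0 < t <= t0 -> 1 < \det (1%:M + t *: H).
Proof.
move=> tr0; pose chi := char_poly (- H).
have horner_chi x : chi.[x] = \det (x%:M + H).
  rewrite /chi /char_poly -horner_evalE -det_map_mx; congr (\det _).
  apply/matrixP => i j; rewrite !mxE /= horner_evalE !hornerE opprK.
  by case: (i == j); rewrite ?mulr1n ?mulr0n hornerE.
pose C := \sum_(i < n) `|chi`_i|.
have C0 : 0 <= C by rewrite sumr_ge0.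
have C1 : 0 < C + 1 by lra.
exists (Num.min 1 (\tr H / (C + 1))); first by rewrite lt_min ltr01 divr_gt0.
move=> t /andP[t0]; rewrite le_min => /andP[t1]; rewrite ler_pdivlMr // => tC.
have -> : 1%:M + t *: H = t *: (t^-1%:M + H).
  by rewrite scalerDr scale_scalar_mx mulfV ?gt_eqF.
rewrite detZ -horner_chi horner_coef size_char_poly !big_ord_recr /=.
have -> : chi`_n.+1 = 1.
  by have /monicP := char_poly_monic (- H); rewrite lead_coefE size_char_poly.
have -> : chi`_n = \tr H by rewrite (@char_poly_trace _ n.+1) // linearN opprK.
rewrite mul1r !mulrDr -exprMn mulfV ?gt_eqF // expr1n.
have -> : t ^+ n.+1 * (\tr H * t^-1 ^+ n) = t * \tr H.
  rewrite exprS exprVn; field; rewrite expf_neq0 // gt_eqF //.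
rewrite ltrDr; suff : - (t ^+ 2 * C) <= t ^+ n.+1 * \sum_(i < n) chi`_i * t^-1 ^+ i.
  have : 0 < t * (\tr H - t * C) by rewrite mulr_gt0 //; lra.
  by lra.
rewrite /C !mulr_sumr -sumrN; apply: ler_sum => i _.
have -> : t ^+ n.+1 * (chi`_i * t^-1 ^+ i) = t ^+ 2 * (t ^+ (n.-1 - i) * chi`_i).
  have -> : n.+1 = (2 + (n.-1 - i) + i)%N.
    by have := ltn_ord i; lia.
  by rewrite !exprD exprVn; field; rewrite expf_neq0 // gt_eqF.
rewrite -mulrN ler_pM2l ?exprn_gt0 //.
have e1 : t ^+ (n.-1 - i) <= 1 by rewrite exprn_ile1 // ltW.
have e0 : 0 <= t ^+ (n.-1 - i) by rewrite exprn_ge0 // ltW.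
have := ler_norm (- chi`_i); rewrite normrN; have := normr_ge0 chi`_i; nra.
Qed.

Lemma mulmx_norm_le n (M : 'M[R]_n) (u : 'cV[R]_n) :
  dotp u u = 1 -> dotp (M *m u) (M *m u) <= \tr (M *m M^T).
Proof.
move=> u1; rewrite dotpE; apply: ler_sum => i _.
have -> : (M *m u) i ord0 = dotp (row i M)^T u.
  by rewrite dotpE !mxE; apply: eq_bigr => j _; rewrite !mxE.
have -> : (M *m M^T) i i = dotp (row i M)^T (row i M)^T.
  by rewrite dotpE !mxE; apply: eq_bigr => j _; rewrite !mxE.
have h1 := cauchy_schwarz (row i M)^T u; have h2 := cauchy_schwarzN (row i M)^T u.
rewrite (enorm_eq1 u1) mulr1 in h1 h2.
by rewrite -(enorm_sqr (row i M)^T); have := enorm_ge0 (row i M)^T; nra.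
Qed.

Section Perturbation.
Variables (n : nat) (K : set 'cV[R]_n.+1).
Hypothesis cK : compact K.
Hypothesis convK : convex K.
Hypothesis ballK : eball R n.+1 `<=` K.
Hypothesis maxK : forall c (A : 'M[R]_n.+1), 1 < \det A ->
  ~ ([set c + A *m y | y in eball R n.+1] `<=` K).

(** The unit vectors at which the supporting hyperplane of the ball also
    supports [K]; they are the contact points of the ball with [K]. *)
Definition contact (K : set 'cV[R]_n.+1) : set 'cV[R]_n.+1 :=
  [set u | dotp u u = 1 /\ forall x, K x -> dotp u x <= 1].

Let cstc (T : topologicalType) (x : 'cV[R]_n.+1) : continuous (fun _ : T => x).
Proof. exact: cst_continuous. Qed.

Let idc : continuous (fun x : 'cV[R]_n.+1 => x). Proof. by move=> x; exact: cvg_id. Qed.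

Lemma contact_closed a : closed [set u : 'cV[R]_n.+1 | forall x, K x -> dotp u x <= a].
Proof.
rewrite (_ : [set u | _] = \bigcap_(x in K) [set u | dotp u x <= a]); last first.
  by apply/seteqP; split=> u h x; exact: h.
apply: closed_bigI => x _; apply: closed_le_continuous.
by apply: continuous_dotp; [exact: idc|exact: cstc].
Qed.

Lemma sphere_compact : compact [set u : 'cV[R]_n.+1 | dotp u u = 1].
Proof.
apply: subclosed_compact cK _.
  by apply: closed_eq_continuous; apply: continuous_dotp; exact: idc.
by move=> u u1; apply: ballK; rewrite /eball /= enorm_le1 u1.
Qed.

Lemma contact_compact : compact (contact K).
Proof.
rewrite (_ : contact K = [set u | dotp u u = 1] `&`
  [set u | forall x, K x -> dotp u x <= 1]) //.
by apply: compact_closedI; [exact: sphere_compact|exact: contact_closed].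
Qed.

(** If [u . H u + h . u < 0] at all contact points, the ellipsoids
    [t h + (1 + t H) B] are contained in [K] for small [t > 0].  Otherwise the
    directions [u] separating a point of such an ellipsoid from [K] would
    accumulate, as [t] tends to [0], at a contact point where this quadratic
    function is nonnegative. *)
Lemma perturbation (H : 'M[R]_n.+1) (h : 'cV[R]_n.+1) : 0 < \tr H ->
  ~ (forall u, contact K u -> dotp u (H *m u) + dotp h u < 0).
Proof.
move=> trH neg; pose q u := dotp u (H *m u) + dotp h u.
have [t0 t00 dett] := det_perturb trH.
pose C0 := \tr (H^T *m H).
have C00 : 0 <= C0 by exact: frobenius_ge0.
pose C1 := \tr (H *m H^T).
have C10 : 0 <= C1 by rewrite /C1 -{1}(trmxK H) frobenius_ge0.
pose C := C0 + C1 + 1 + enorm h.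
have hn0 := enorm_ge0 h.
(* Compact and decreasing as [t] tends to [0]; a common point contradicts the
   hypothesis. *)
pose F t := [set u | dotp u u = 1] `&` ([set u | forall x, K x -> dotp u x <= 1 + C * t]
   `&` [set u | - (C * t) <= q u]).
pose small := [set t : R | 0 < t <= Num.min 1 t0].
have Fne t : small t -> F t !=set0.
  move=> /andP[tpos]; rewrite le_min => /andP[t1 tt0].
  have /(maxK (c := t *: h))/existsNP[x] : 1 < \det (1%:M + t *: H).
    by apply: dett; rewrite tpos.
  move=> /not_implyP[[y yB xE] Kx].
  have K0 : K !=set0 by exists 0; apply: ballK; rewrite /eball /= enorm0.
  have [v v0 vK] := separation K0 cK convK Kx.
  have nv : 0 < enorm v by rewrite sqrtr_gt0.
  pose u := (enorm v)^-1 *: v.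
  have u1 : dotp u u = 1 by apply: dotp_normalize; apply: contraTneq v0 => ->; rewrite dotp0l ltxx.
  have ux z : K z -> dotp u z < dotp u x.
    move=> /vK vz; rewrite /u !dotpZl ltr_pM2l ?invr_gt0 //; lra.
  have ux1 : 1 < dotp u x.
    by rewrite -u1; apply: ux; apply: ballK; rewrite /eball /= enorm_le1 u1.
  clearbody u.
  (* From [sqrt (1 + z) <= 1 + z / 2] for the norm of [w]. *)
  have bnd : dotp u x <= 1 + t * q u + t ^+ 2 * C0 / 2.
    rewrite -xE dotpDr dotpZr.
    pose w := u + t *: (H^T *m u).
    have -> : dotp u ((1%:M + t *: H) *m y) = dotp w y.
      rewrite /w dotpDl dotpZl dotp_adjoint trmxK.
      by rewrite mulmxDl mul1mx -scalemxAl dotpDr dotpZr.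
    have wy : dotp w y <= enorm w.
      apply: le_trans (cauchy_schwarz _ _) _.
      by rewrite -[leRHS]mulr1 ler_wpM2l ?enorm_ge0.
    have ww : enorm w ^+ 2 = 1 + 2 * t * dotp u (H *m u) + t ^+ 2 * dotp (H^T *m u) (H^T *m u).
      rewrite enorm_sqr /w !dotpDl !dotpDr u1 !dotpZl !dotpZr.
      by rewrite (dotpC u (H^T *m u)) [dotp (H^T *m u) u]dotp_adjoint trmxK; ring.
    have := mulmx_norm_le H^T u1; rewrite trmxK -/C0 => hC.
    have : 0 <= (enorm w - 1) ^+ 2 by exact: sqr_ge0.
    have : t ^+ 2 * dotp (H^T *m u) (H^T *m u) <= t ^+ 2 * C0 by rewrite ler_wpM2l ?sqr_ge0.
    rewrite /q (dotpC h); lra.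
  have qC : q u <= C1 + 1 + enorm h.
    have := cauchy_schwarz u (H *m u); have := cauchy_schwarz h u.
    rewrite (enorm_eq1 u1) mulr1 mul1r => h1 h2.
    have := mulmx_norm_le H u1; rewrite -/C1 -enorm_sqr => h3.
    have : 0 <= (enorm (H *m u) - 1) ^+ 2 by exact: sqr_ge0.
    rewrite /q; lra.
  have tt : t ^+ 2 * C0 <= t * C0 by rewrite ler_wpM2r // expr2 ler_piMr // ltW.
  exists u; split=> //; split.
    move=> z /ux /ltW /le_trans; apply; apply: le_trans bnd _.
    have : t * q u <= t * (C1 + 1 + enorm h) by rewrite ler_wpM2l // ltW.
    have : 0 <= t * C0 by rewrite mulr_ge0 // ltW.
    rewrite /C; lra.
  have : 0 < t * (q u + C * t).
    have : 0 <= t ^+ 2 * (C1 + 1 + enorm h) by rewrite mulr_ge0 ?sqr_ge0 //; lra.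
    have : 0 <= t ^+ 2 * C0 by rewrite mulr_ge0 // sqr_ge0.
    rewrite /C; lra.
  by rewrite pmulr_rgt0 // /=; lra.
have C_ge0 : 0 <= C by rewrite /C; lra.
have Fmono s t : s <= t -> F s `<=` F t.
  move=> st u [u1 [uK uq]]; have Cst : C * s <= C * t by rewrite ler_wpM2l.
  by split=> //; split=> [x /uK|/=]; [|move: uq => /=]; lra.
have small0 : small (Num.min 1 t0) by rewrite /small /= lexx lt_min ltr01 t00.
have FF : ProperFilter (filter_from small F).
  apply: filter_from_proper Fne; apply: filter_from_filter.
    by exists (Num.min 1 t0).
  move=> s t ss st; exists (Num.min s t); last by move=> u Fu; split; apply: Fmono Fu;
    rewrite ge_min lexx ?orbT.
  by move: ss st => /andP[s0 s1] /andP[? ?]; apply/andP; rewrite lt_min s0 ge_min s1.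
have cq : continuous q.
  have c1 : continuous (fun u => dotp u (H *m u)).
    apply: continuous_dotp; first exact: idc.
    apply: continuous_mulmx; last exact: idc.
    exact: cst_continuous.
  have c2 : continuous (fun u => dotp h u) by apply: continuous_dotp; [exact: cstc|exact: idc].
  by move=> u; exact: (continuousD (c1 u) (c2 u)).
have Fclosed t : closed (F t).
  apply: closedI; last apply: closedI.
  - by apply: closed_eq_continuous; apply: continuous_dotp; exact: idc.
  - exact: contact_closed.
  - exact: closed_ge_continuous.
have [|p [p1 pF]] := sphere_compact FF.
  by exists (Num.min 1 t0) => // u [].
have Fp t : small t -> F t p.
  move=> st; rewrite [F t](closure_id _).1; last exact: Fclosed.
  by move: pF; rewrite clusterE; apply; exists t.
have eps r : (forall t, small t -> r <= C * t) -> r <= 0.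
  move=> hr; rewrite leNgt; apply/negP => r0.
  have C1' : 0 < C + 1 by lra.
  pose t := Num.min (Num.min 1 t0) (r / (C + 1)).
  have tpos : 0 < t by rewrite !lt_min ltr01 t00 divr_gt0.
  have tr : t * (C + 1) <= r by rewrite -ler_pdivlMr // ge_min lexx orbT.
  have : r <= C * t by apply: hr; rewrite /small /= tpos ge_min lexx.
  lra.
have : q p < 0.
  apply: neg; split=> // x Kx; rewrite -subr_le0; apply: eps => t /Fp[_ [/(_ x Kx) h1 _]].
  by rewrite lerBlDl.
suff : - q p <= 0 by lra.
by apply: eps => t /Fp[_ [_ /= h1]]; lra.
Qed.

Let phi (u : 'cV[R]_n.+1) : 'cV[R]_(n.+1 * n.+1 + n.+1) :=
  col_mx (mxvec (u *m u^T))^T u.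

Let phi_continuous : continuous phi.
Proof.
apply: continuous_mx => i j; rewrite /phi.
have -> : (fun u => phi u i j) = (fun u => phi u i j) by [].
rewrite -(splitK i); case: (fintype.split i) => l /=.
  rewrite (_ : (fun u => _) = fun u : 'cV[R]_n.+1 => (mxvec (u *m u^T)) j l); last first.
    by apply/funext => u; rewrite col_mxEu mxE.
  case/mxvec_indexP: l => a b.
  rewrite (_ : (fun u => _) = fun u : 'cV[R]_n.+1 => (u *m u^T) a b); last first.
    by apply/funext => u; rewrite (ord1 j) mxvecE.
  apply: continuous_coord; apply: continuous_mulmx; first exact: idc.
  exact/continuous_trmx/idc.
rewrite (_ : (fun u => _) = fun u : 'cV[R]_n.+1 => u l j); last first.
  by apply/funext => u; rewrite col_mxEd.
exact/continuous_coord/idc.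
Qed.

(** John's theorem: otherwise the point [(1 / n, 0)] could be separated from
    the convex hull of the [(u u^T, u)], [u] a contact point, and the
    separating functional would give a perturbation of the ball of larger
    volume.  A representation of this point with the least number of terms
    has positive weights. *)
Theorem john_decomposition : exists N (lam : 'I_N -> R) (u : 'I_N -> 'cV[R]_n.+1),
  john_frame lam u /\ forall i, contact K (u i).
Proof.
set D := (n.+1 * n.+1 + n.+1)%N.
have n0 : n.+1%:R != 0 :> R by rewrite pnatr_eq0.
pose p0 : 'cV[R]_D := col_mx (mxvec (n.+1%:R^-1 *: (1%:M : 'M[R]_n.+1)))^T 0.
have [hp0|nhp0] := pselect (hull (contact K) phi D.+1 p0).
  have exN : exists N, `[< hull (contact K) phi N p0 >] by exists D.+1; exact/asboolP.
  have := ex_minnP exN; case=> -[|N] /asboolP hN minN.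
    by case: hN => mu [w [_ _]]; rewrite big_ord0 => /eqP; rewrite eq_sym oner_eq0.
  have [mu [w cc]] := hN; have [mu0 Uw mu1 p0E] := cc.
  have mupos i : 0 < mu i.
    rewrite lt_def mu0 andbT; apply/eqP => mui.
    by have /asboolP/minN := hull_drop cc mui; rewrite ltnn.
  exists N.+1, (fun i => n.+1%:R * mu i), w; split=> //; split.
  - by move=> i; rewrite mulr_gt0 // ltr0n.
  - by move=> i; case: (Uw i).
  - have := congr1 dsubmx p0E; rewrite col_mxKd linear_sum /= => e0.
    have s0 : \sum_i mu i *: w i = 0.
      by rewrite [RHS]e0; apply: eq_bigr => i _; rewrite linearZ /= col_mxKd.
    by under eq_bigr do rewrite -scalerA; rewrite -scaler_sumr s0 scaler0.
  - have := congr1 (fun v => vec_mx (usubmx v)^T) p0E.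
    rewrite /= col_mxKu trmxK mxvecK !linear_sum /= => e0.
    under eq_bigr do rewrite -scalerA; rewrite -scaler_sumr.
    have -> : 1%:M = n.+1%:R *: (n.+1%:R^-1 *: (1%:M : 'M[R]_n.+1)).
      by rewrite scalerA mulfV // scale1r.
    rewrite e0; congr (_ *: _).
    by apply: eq_bigr => i _; rewrite !linearZ /= col_mxKu trmxK mxvecK.
exfalso; have [U0|U0] := pselect (contact K !=set0); last first.
  apply: (@perturbation 1%:M 0); first by rewrite mxtrace1 ltr0n.
  by move=> u Uu; exfalso; apply: U0; exists u.
have single u : contact K u -> hull (contact K) phi D.+1 (phi u).
  move=> Uu; apply: (@caratheodory _ _ _ _ _ 1).
  exists (fun=> 1), (fun=> u); split=> //; by rewrite big_ord1 // scale1r.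
have [||v v0 vS] := separation _ _ (@hull_convex _ _ _ (contact K) phi) nhp0.
- by have [u Uu] := U0; exists (phi u); exact: single.
- by apply: hull_compact; [exact: phi_continuous|exact: contact_compact].
rewrite /D in v v0 vS *.
pose H0 : 'M[R]_n.+1 := vec_mx (usubmx v)^T; pose h := dsubmx v.
have vE a z : dotp v (col_mx a^T z) = (a *m (mxvec H0)^T) ord0 ord0 + dotp h z.
  rewrite dotpC /dotp -[v in LHS]vsubmxK tr_col_mx mul_row_col mxE trmxK.
  by rewrite /H0 vec_mxK trmxK -!/(dotp _ _) (dotpC z).
have vphi u : dotp v (phi u) = dotp u (H0 *m u) + dotp h u.
  have uuE : u *m u^T = (u^T)^T *m u^T by rewrite trmxK.
  by rewrite vE uuE mxvec_dotmul trmxK -mulmxA.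
have vp0 : dotp v p0 = n.+1%:R^-1 * \tr H0.
  rewrite vE dotp0r addr0 linearZ /= -scalemxAl mxE; congr (_ * _).
  rewrite mx1_sum_delta linear_sum mulmx_suml summxE; apply: eq_bigr => i _.
  have -> : delta_mx i i = (delta_mx (ord0 : 'I_1) i)^T *m delta_mx ord0 i :> 'M[R]_n.+1.
    by rewrite trmx_delta mul_delta_mx.
  by rewrite mxvec_dotmul -rowE trmx_delta -colE !mxE.
(* Subtracting [r] leaves both a positive trace and negative values at the
   contact points. *)
pose r := n.+1%:R^-1 * \tr H0 - dotp v v / 2.
apply: (@perturbation (H0 - r%:M) h).
  rewrite linearB /= mxtrace_scalar -[r *+ _]mulr_natl /r.
  have -> : \tr H0 - n.+1%:R * (n.+1%:R^-1 * \tr H0 - dotp v v / 2) =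
    n.+1%:R * (dotp v v / 2) by field.
  by rewrite mulr_gt0 ?ltr0n // divr_gt0.
move=> u Uu.
have h1 : dotp u (H0 *m u) + dotp h u <= n.+1%:R^-1 * \tr H0 - dotp v v.
  by rewrite -vp0 -vphi; exact/vS/single.
have h2 : dotp u ((H0 - r%:M) *m u) = dotp u (H0 *m u) - r.
  by rewrite mulmxBl mul_scalar_mx dotpDr dotpNr dotpZr; case: Uu => -> _; rewrite mulr1.
rewrite h2 /r; move: h1 v0; rewrite -vp0.
move: (dotp v p0) (dotp v v) (dotp u (H0 *m u)) (dotp h u) => w x y z; lra.
Qed.

End Perturbation.
End John.

(** * Ellipsoids and Euclidean balls *)

Section Ellipsoids.
Variable R : realType.
Implicit Types n k : nat.

Lemma support_le n k (A : 'M[R]_(n, k)) w y :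
  eball R k y -> dotp w (A *m y) <= enorm (A^T *m w).
Proof.
rewrite /eball /= => y1; rewrite dotpC dotp_adjoint dotpC.
apply: le_trans (cauchy_schwarz _ _) _.
by rewrite -[leRHS]mulr1 ler_wpM2l ?enorm_ge0.
Qed.

Lemma support_attained n k (A : 'M[R]_(n, k)) w :
  exists2 y, eball R k y & dotp w (A *m y) = enorm (A^T *m w).
Proof.
have [z|z] := eqVneq (A^T *m w) 0.
  exists 0; first by rewrite /eball /= enorm0.
  by rewrite mulmx0 dotp0r z enorm0.
exists ((enorm (A^T *m w))^-1 *: (A^T *m w)).
  by rewrite /eball /= enorm_le1 dotp_normalize.
rewrite dotpC dotp_adjoint dotpZl -enorm_sqr.
by field; rewrite gt_eqF // sqrtr_gt0 dotp_gt0.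
Qed.

Lemma eballN k (y : 'cV[R]_k) : eball R k y -> eball R k (- y).
Proof. by rewrite /eball /= enormN. Qed.

(** The support function of [c + A B] is [w . c + |A^T w|], whose odd part
    determines [c]. *)
Lemma ellipsoid_center_unique n k (E : set 'cV[R]_n) c c' :
  ellipsoid_at k c E -> ellipsoid_at k c' E -> c = c'.
Proof.
suff half (A A' : 'M[R]_(n, k)) (a a' : 'cV[R]_n) w :
    [set a + A *m y | y in eball R k] `<=` [set a' + A' *m y | y in eball R k] ->
    dotp w a + enorm (A^T *m w) <= dotp w a' + enorm (A'^T *m w).
  move=> [A [_ EA]] [A' [_ EA']]; apply/eqP; rewrite -subr_eq0; apply/eqP/dotp_eq0.
  have sub : [set c + A *m y | y in eball R k] `<=` [set c' + A' *m y | y in eball R k].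
    by rewrite -EA -EA'.
  have sub' : [set c' + A' *m y | y in eball R k] `<=` [set c + A *m y | y in eball R k].
    by rewrite -EA -EA'.
  have h1 := half _ _ _ _ (c - c') sub; have h2 := half _ _ _ _ (- (c - c')) sub'.
  have h3 := half _ _ _ _ (- (c - c')) sub; have h4 := half _ _ _ _ (c - c') sub'.
  rewrite !mulmxN !enormN !dotpNl in h2 h3.
  by rewrite dotpDr dotpNr; lra.
move=> sub; have [y yB <-] := support_attained A w.
have [|z zB zE] := sub (a + A *m y); first by exists y.
by rewrite -dotpDr -zE dotpDr lerD2l support_le.
Qed.

Lemma ellipsoid_centerE n k (E : set 'cV[R]_n) c :
  ellipsoid_at k c E -> ellipsoid_center k E = c.
Proof.
move=> Ec; apply: (ellipsoid_center_unique _ Ec).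
by apply: (@getPex _ [set c | ellipsoid_at k c E]); exists c.
Qed.

Lemma eball_ellipsoid n : ellipsoid_at n 0 (eball R n).
Proof.
exists 1%:M; split; first by move=> x y; rewrite !add0r !mul1mx.
apply/seteqP; split=> [x xB|_ [x xB <-]]; last by rewrite add0r mul1mx.
by exists x => //; rewrite add0r mul1mx.
Qed.

Lemma det_trigT k (T : 'M[R]_k) : is_trig_mx T^T -> \det T = \prod_i T i i.
Proof. by move=> tT; rewrite -det_tr det_trig //; apply: eq_bigr => i _; rewrite mxE. Qed.

(** The inequality between the arithmetic and the geometric mean of the diagonal
    entries. *)
Lemma det_le_trace k (T : 'M[R]_k) : is_trig_mx T^T -> (forall i, 0 < T i i) ->
  \det T <= (\tr T / k%:R) ^+ k ?= iff [forall i, forall j, T i i == T j j].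
Proof.
move=> tT T0; rewrite det_trigT //.
have := @leif_AGM R 'I_k predT (fun i => T i i).
rewrite /= cardT size_enum_ord => h; apply: h => i _; exact: ltW.
Qed.

Lemma det_trig_gt0 k (T : 'M[R]_k) :
  is_trig_mx T^T -> (forall i, 0 < T i i) -> 0 < \det T.
Proof. by move=> tT T0; rewrite det_trigT // prodr_gt0. Qed.

Lemma gram_scalar n k (A : 'M[R]_(n, k)) r :
  (forall y, dotp (A *m y) (A *m y) = r * dotp y y) -> A^T *m A = r%:M.
Proof.
move=> h; apply: mulmx_ext => i; apply: dotp_ext => z.
rewrite -mulmxA -dotp_adjoint mul_scalar_mx dotpZr.
have := h (z + delta_mx i ord0); rewrite mulmxDr !dotpDl !dotpDr !h.
rewrite (dotpC (A *m delta_mx i ord0)) (dotpC (delta_mx i ord0) z); lra.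
Qed.

(** Both centers agree by symmetry; then [A] maps unit vectors to vectors of
    length [r], since otherwise the ball would contain a vector in the same
    direction whose preimage is longer than [1]. *)
Lemma euclidean_ball_gram n k (c : 'cV[R]_n) (A : 'M[R]_(n, k)) r : 0 < r ->
  (forall y : 'cV[R]_k, A *m y = 0 -> y = 0) ->
  euclidean_ball k r [set c + A *m y | y in eball R k] -> A^T *m A = (r ^+ 2)%:M.
Proof.
move=> r0 inj [c0 [V [_ E]]].
have cc0 : c = c0.
  apply/eqP; rewrite -subr_eq0; apply/eqP/dotp_eq0.
  set w := c - c0; have [y yB yw] := support_attained A w.
  have : [set c0 + r *: x | x in eball R n `&` [set x | x \in V]] (c + A *m y).
    by rewrite -E; exists y.
  move=> [x [xB xV] xE].
  have : [set c + A *m y | y in eball R k] (c0 + r *: (- x)).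
    by rewrite E; exists (- x) => //; split; [exact: eballN|rewrite /= memvN].
  move=> [z zB zE]; have := support_le A w (eballN zB); rewrite mulmxN dotpNr -yw.
  have -> : A *m z = c0 - r *: x - c by rewrite -scalerN -zE addrAC subrr add0r.
  have -> : A *m y = c0 + r *: x - c by rewrite xE addrAC subrr add0r.
  rewrite !dotpDr !dotpNr /w !dotpDl !dotpNl.
  have := dotp_ge0 (c - c0); rewrite !dotpDl !dotpDr !dotpNl !dotpNr; lra.
subst c0.
have img y : eball R k y -> exists x, [/\ eball R n x, x \in V & A *m y = r *: x].
  move=> yB; have : [set c + r *: x | x in eball R n `&` [set x | x \in V]] (c + A *m y).
    by rewrite -E; exists y.
  by move=> [x [xB xV] /addrI xE]; exists x; split.
have pre x : eball R n x -> x \in V -> exists2 y, eball R k y & A *m y = r *: x.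
  move=> xB xV; have : [set c + A *m y | y in eball R k] (c + r *: x).
    by rewrite E; exists x.
  by move=> [y yB /addrI yE]; exists y.
have unit y : dotp y y = 1 -> enorm (A *m y) = r.
  move=> y1; have yB : eball R k y by rewrite /eball /= enorm_le1 y1.
  have [x [xB xV yE]] := img y yB.
  have x0 : x != 0.
    apply: contra_eqN y1 => /eqP x0; have -> : y = 0.
      by apply: inj; rewrite yE x0 scaler0.
    by rewrite dotp0l eq_sym oner_eq0.
  have nx : 0 < enorm x by rewrite sqrtr_gt0 dotp_gt0.
  have [||z zB zE] := pre ((enorm x)^-1 *: x).
  - by rewrite /eball /= enorm_le1 dotp_normalize.
  - by rewrite memvZ.
  have zy : z = (enorm x)^-1 *: y.
    apply/eqP; rewrite -subr_eq0; apply/eqP/inj.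
    by rewrite mulmxBr -scalemxAr zE yE !scalerA mulrC subrr.
  have : enorm z <= 1 by [].
  rewrite zy enormZ (enorm_eq1 y1) mulr1 gtr0_norm ?invr_gt0 // invf_le1 // => x1.
  have -> : A *m y = r *: x by [].
  rewrite enormZ gtr0_norm // (_ : enorm x = 1) ?mulr1 //.
  by apply/le_anti; rewrite x1 andbT; exact: xB.
apply: gram_scalar => y; have [->|y0] := eqVneq y 0; first by rewrite mulmx0 !dotp0l mulr0.
have := unit _ (dotp_normalize y0).
have ny : 0 < enorm y by rewrite sqrtr_gt0 dotp_gt0.
rewrite -scalemxAr enormZ gtr0_norm ?invr_gt0 // => e.
rewrite -!enorm_sqr -exprMn; congr (_ ^+ 2).
by rewrite -e; field; rewrite gt_eqF.
Qed.

Lemma ball_euclidean n k (c : 'cV[R]_n) (Q : 'M[R]_(n, k)) r : Q^T *m Q = 1%:M ->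
  euclidean_ball k r [set c + (r *: Q) *m y | y in eball R k].
Proof.
move=> QQ; exists c, (limg (linfun (mulmx Q : 'cV[R]_k -> 'cV[R]_n))); split.
  rewrite limg_dim_eq ?dimvf /dim /= ?muln1 //.
  apply/eqP; rewrite -subv0; apply/subvP => y.
  rewrite memv_cap memv_ker lfunE /= => /andP[_ /eqP Qy0].
  by rewrite memv0 -[y]mul1mx -QQ -mulmxA Qy0 mulmx0.
have QB y : eball R n (Q *m y) <-> eball R k y.
  by rewrite /eball /= !enorm_le1 dotp_adjoint mulmxA QQ mul1mx.
apply/seteqP; split=> [_ [y yB <-]|_ [x [xB /memv_imgP[y _ xE]] <-]].
  exists (Q *m y); last by rewrite scalemxAl.
  split; first exact/QB.
  by apply/memv_imgP; exists y; rewrite ?memvf // lfunE.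
move: xE xB; rewrite lfunE /= => -> /QB yB; exists y => //.
by rewrite scalemxAl.
Qed.

End Ellipsoids.

(** * Bodies in John position *)

Section JohnPosition.
Variable R : realType.

(** Converse of John's theorem: a frame of contact points makes the ball the
    only ellipsoid of maximal volume.  For an ellipsoid [c + Q T B] in [K] the
    trace of [T] is at most [n], hence its determinant at most [1]; in the
    equality case the contact points are eigenvectors of [T^T]. *)
Section Converse.
Variables (I : finType) (n : nat) (lam : I -> R) (u : I -> 'cV[R]_n).
Hypothesis frame : john_frame lam u.
Hypothesis n0 : (0 < n)%N.
Variables (c : 'cV[R]_n) (Q T : 'M[R]_n).
Hypothesis QQ : Q^T *m Q = 1%:M.
Hypothesis tT : is_trig_mx T^T.
Hypothesis T0 : forall i, 0 < T i i.
Hypothesis ha : forall i, enorm ((Q *m T)^T *m u i) <= 1 - dotp (u i) c.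

Let n0R : 0 < n%:R :> R. Proof. by rewrite ltr0n. Qed.
Let lam0 i : 0 < lam i. Proof. by case: frame. Qed.
Let QQ' : Q *m Q^T = 1%:M. Proof. exact: mulmx1C. Qed.
Let A := Q *m T.
Let trE : \tr (Q^T *m A) = \tr T. Proof. by rewrite mulmxA QQ mul1mx. Qed.

Let Qu1 i : dotp (Q^T *m u i) (Q^T *m u i) = 1.
Proof. by rewrite dotp_adjoint trmxK mulmxA QQ' mul1mx; case: frame. Qed.

Let cs i : dotp (Q^T *m u i) (A^T *m u i) <= enorm (A^T *m u i).
Proof. by have := cauchy_schwarz (Q^T *m u i) (A^T *m u i); rewrite (enorm_eq1 (Qu1 i)) mul1r. Qed.

Let tr_le_width : \tr T <= \sum_i lam i * enorm (A^T *m u i).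
Proof.
by rewrite -trE -(frame_trace frame); apply: ler_sum => i _; rewrite ler_pM2l ?cs.
Qed.

Lemma trace_le_dim : \tr T <= n%:R.
Proof. exact: le_trans tr_le_width (sum_width_le frame ha). Qed.

Lemma det_le1 : \det T <= 1.
Proof.
apply: le_trans (det_le_trace tT T0).1 _; apply: exprn_ile1.
  by rewrite divr_ge0 // sumr_ge0 // => i _; exact: ltW.
by rewrite ler_pdivrMr // mul1r trace_le_dim.
Qed.

Lemma det_eq1 : \det T = 1 -> Q *m T = Q /\ c = 0.
Proof.
move=> det1; have trn : \tr T = n%:R.
  apply/le_anti; rewrite trace_le_dim /=.
  have mean0 : 0 <= \tr T / n%:R by rewrite divr_ge0 // sumr_ge0 // => i _; exact: ltW.
  have := (det_le_trace tT T0).1; rewrite det1 -{1}(expr1n R n) ler_pXn2r ?nnegrE //.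
  by rewrite ler_pdivlMr // mul1r.
have Tii i : T i i = 1.
  have nn : n%:R / n%:R = 1 :> R by rewrite divff // gt_eqF.
  have := (det_le_trace tT T0).2; rewrite det1 trn nn expr1n eqxx.
  move=> /esym/forallP Teq; apply: (mulfI (lt0r_neq0 n0R)); rewrite mulr1 -[RHS]trn.
  rewrite mulr_natl (_ : _ *+ n = \sum_(j < n) T i i); last by rewrite sumr_const card_ord.
  apply: eq_bigr => j _.
  by have /forallP/(_ j)/eqP := Teq i.
have widthn : \sum_i lam i * enorm (A^T *m u i) = n%:R.
  by apply/le_anti; rewrite (sum_width_le frame ha) -trn tr_le_width.
have parallel i : A^T *m u i = enorm (A^T *m u i) *: (Q^T *m u i).
  have : \sum_i lam i * (enorm (A^T *m u i) - dotp (Q^T *m u i) (A^T *m u i)) = 0.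
    under eq_bigr do rewrite mulrBr.
    by rewrite sumrB (frame_trace frame) trE widthn trn subrr.
  move/eqP; rewrite psumr_eq0 => [/allP/(_ i (mem_index_enum _))|j _]; last first.
    by rewrite mulr_ge0 ?subr_ge0 ?cs // ltW.
  rewrite mulf_eq0 gt_eqF //= subr_eq0 => /eqP e.
  apply/eqP; rewrite eq_sym -subr_eq0; apply/eqP/dotp_eq0.
  by rewrite dotp_sub_sqr Qu1 -e -[dotp (A^T *m u i) _]enorm_sqr; ring.
(* By [parallel], [Q^T u i] is an eigenvector of the unitriangular matrix [T^T]. *)
have width1 i : enorm (A^T *m u i) = 1.
  set a := enorm _; pose M := T^T - a%:M.
  have Mw : M *m (Q^T *m u i) = 0.
    rewrite mulmxBl mul_scalar_mx mulmxA -trmx_mul -/A [X in X - _]parallel.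
    exact: subrr.
  have M0 : \det M = 0.
    apply/eqP/negPn/negP => M0.
    have Mu : M \in unitmx by rewrite unitmxE unitfE.
    have w0 : Q^T *m u i = 0 by rewrite -[LHS](mulKmx Mu) Mw mulmx0.
    by have /eqP := Qu1 i; rewrite w0 dotp0l eq_sym oner_eq0.
  have Mtrig : is_trig_mx M.
    apply/is_trig_mxP => j l jl; have /is_trig_mxP/(_ j l jl) := tT.
    by rewrite !mxE => ->; rewrite -val_eqE (ltn_eqF jl) mulr0n subr0.
  move/eqP: M0; rewrite det_trig // => /eqP/eqP.
  rewrite (_ : \prod_i M i i = (1 - a) ^+ n).
    by rewrite expf_eq0 n0 subr_eq0 => /eqP ->.
  rewrite (_ : (1 - a) ^+ n = \prod_(j < n) (1 - a)); last first.
    by rewrite prodr_const card_ord.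
  by apply: eq_bigr => j _; rewrite !mxE eqxx Tii.
have AQ : A = Q.
  apply: trmx_inj; apply: mulmx_ext => i; set z := delta_mx _ _.
  rewrite (frame_decomp frame z) !mulmx_sumr; apply: eq_bigr => j _.
  by rewrite -!scalemxAr parallel width1 scale1r.
split=> //; apply: dotp_eq0; rewrite -(frame_dotp frame) big1 // => i _.
suff -> : dotp (u i) c = 0 by rewrite mul0r mulr0.
have cneg j : 0 <= - dotp (u j) c by have := ha j; rewrite width1; lra.
have : \sum_j lam j * - dotp (u j) c = 0.
  by under eq_bigr do rewrite mulrN; rewrite sumrN (frame_lin frame) oppr0.
move/eqP; rewrite psumr_eq0 => [/allP/(_ i (mem_index_enum _))|j _]; last first.
  by rewrite mulr_ge0 // ltW.
by rewrite mulf_eq0 gt_eqF //= oppr_eq0 => /eqP.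
Qed.

End Converse.

Lemma width_le n k (K : set 'cV[R]_n) c (A : 'M[R]_(n, k)) w r :
  [set c + A *m y | y in eball R k] `<=` K -> (forall x, K x -> dotp w x <= r) ->
  enorm (A^T *m w) <= r - dotp w c.
Proof.
move=> EK wK; have [y yB <-] := support_attained A w.
rewrite lerBrDr addrC -dotpDr; apply: wK; apply: EK.
by exists y.
Qed.

Lemma orthogonal_eball n (Q : 'M[R]_n) : Q^T *m Q = 1%:M ->
  [set 0 + Q *m y | y in eball R n] = eball R n.
Proof.
move=> QQ; apply/seteqP; split=> [_ [y yB <-]|x xB].
  by move: yB; rewrite /eball /= add0r !enorm_le1 dotp_adjoint mulmxA QQ mul1mx.
exists (Q^T *m x); last by rewrite add0r mulmxA (mulmx1C QQ) mul1mx.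
by move: xB; rewrite /eball /= !enorm_le1 dotp_adjoint trmxK mulmxA (mulmx1C QQ) mul1mx.
Qed.

Lemma john_frame_ellipsoid (I : finType) n (lam : I -> R) (u : I -> 'cV[R]_n)
    (K : set 'cV[R]_n) : (0 < n)%N -> john_frame lam u -> eball R n `<=` K ->
  (forall i x, K x -> dotp (u i) x <= 1) -> john_ellipsoid K = eball R n.
Proof.
move=> n0 frame BK uK; have BE : ellipsoid n (eball R n) by exists 0; exact: eball_ellipsoid.
have Bfin := leb_eball_fin R n0; have B0 := leb_eball_gt0 R n0.
have qr c (A : 'M[R]_n) : injective (fun y : 'cV[R]_n => c + A *m y) ->
    [set c + A *m y | y in eball R n] `<=` K -> exists Q T,
    [/\ A = Q *m T, Q^T *m Q = 1%:M, is_trig_mx T^T & forall i, 0 < T i i] /\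
    [/\ leb [set c + A *m y | y in eball R n] = ((\det T)%:E * leb (eball R n))%E,
        \det T <= 1 & \det T = 1 -> Q *m T = Q /\ c = 0].
  move=> /inj_mulmx_eq0/qr_decomposition[Q [T [QQ AE tT T0]]] EK.
  have ha i : enorm ((Q *m T)^T *m u i) <= 1 - dotp (u i) c.
    by rewrite -AE; apply: width_le EK _ => x; exact: uK.
  exists Q, T; split=> //; split.
  - have Tp := det_trig_gt0 tT T0.
    have Q1 : `|\det Q| = 1.
      have := congr1 determinant QQ; rewrite det_mulmx det_tr det1 -expr2 => /eqP.
      by rewrite sqrf_eq1 => /orP[] /eqP ->; rewrite ?normrN normr1.
    have Q0 : \det Q != 0 by rewrite -normr_eq0 Q1 oner_eq0.
    have T0' : \det T != 0 by rewrite gt_eqF.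
    rewrite leb_affine // AE det_mulmx ?mulf_neq0 //.
    by rewrite normrM Q1 mul1r gtr0_norm.
  - exact: (det_le1 frame n0 QQ tT T0 ha).
  - exact: (det_eq1 frame n0 QQ tT T0 ha).
have Bmax : max_ellipsoid K (eball R n).
  split=> // _ [c [A [inj ->]]] EK; have [Q [T [_ [-> T1 _]]]] := qr c A inj EK.
  by rewrite -[leRHS]mul1e; apply: lee_wpmul2r; [exact: ltW|rewrite lee_fin].
apply: xget_unique => // E [[c [A [inj EA]]] EK Emax].
rewrite EA in EK; have [Q [T [[AE QQ _ _] [EV T1 Teq]]]] := qr c A inj EK.
have := Emax _ BE BK; rewrite EA EV -[leLHS]mul1e lee_pmul2r // lee_fin => T1'.
have [TQ c0] : Q *m T = Q /\ c = 0 by apply: Teq; apply/le_anti; rewrite T1.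
by rewrite c0 AE TQ orthogonal_eball.
Qed.

(** Conversely, the contact points of a body in John position carry a frame. *)
Lemma john_ellipsoid_frame n (K : set 'cV[R]_n) : (0 < n)%N ->
  convex_body K -> john_ellipsoid K = eball R n ->
  eball R n `<=` K /\ exists N (lam : 'I_N -> R) (u : 'I_N -> 'cV[R]_n),
    john_frame lam u /\ forall i x, K x -> dotp (u i) x <= 1.
Proof.
case: n K => // n K _ [cK /convex_setP convK _] KB.
have Bfin := leb_eball_fin R (ltn0Sn n); have B0 := leb_eball_gt0 R (ltn0Sn n).
have [_ BK Bmax] : max_ellipsoid K (eball R n.+1).
  rewrite -KB; apply: xgetPex; apply/not_existsP => none.
  have : eball R n.+1 0 by rewrite /eball /= enorm0.
  by rewrite -KB /john_ellipsoid xgetPN.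
split=> //; have [|N [lam [u [frame uK]]]] := john_decomposition cK convK BK.
  move=> c A A1 EK; have A0 : \det A != 0 by rewrite gt_eqF // (lt_trans _ A1).
  have Au : A \in unitmx by rewrite unitmxE unitfE.
  have := Bmax [set c + A *m y | y in eball R n.+1]; rewrite leb_affine //.
  rewrite -[X in (_ <= X)%E]mul1e lee_pmul2r // lee_fin => h.
  have : `|\det A| <= 1.
    apply: h EK; exists c, A; split=> //; apply/inj_mulmx_eq0 => y Ay0.
    by rewrite -[y](mulKmx Au) Ay0 mulmx0.
  by rewrite leNgt => /negP; apply; rewrite (lt_le_trans A1) // ler_norm.
by exists N, lam, u; split=> // i x Kx; case: (uK i) => _; exact.
Qed.

Definition asym_set n (K : set 'cV[R]_n) : set R :=
  [set r | 0 <= r /\ K `<=` [set r *: - y | y in K]].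

Lemma john_asymmetryE n (K : set 'cV[R]_n) :
  john_ellipsoid K = eball R n -> john_asymmetry K = inf (asym_set K).
Proof.
move=> KB; rewrite /john_asymmetry.
have -> : john_center K = 0.
  by rewrite /john_center KB; apply: ellipsoid_centerE; exact: eball_ellipsoid.
congr inf; apply/seteqP; split=> r [r0 h]; split=> // x.
  move=> Kx; have [|z [y Ky yz] zx] := h x; first by exists x; rewrite ?subr0.
  by exists y; rewrite // -zx -yz sub0r.
move=> [z Kz zx]; have [|y Ky yz] := h z => //.
by exists (- y); [exists y; rewrite ?sub0r|rewrite -zx subr0].
Qed.

(** [K] lies in the ball of radius [n], and the unit ball lies in [K]. *)
Lemma asym_set_dim (I : finType) n (lam : I -> R) (u : I -> 'cV[R]_n) (K : set 'cV[R]_n) :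
  (0 < n)%N -> john_frame lam u -> eball R n `<=` K ->
  (forall i x, K x -> dotp (u i) x <= 1) -> asym_set K n%:R.
Proof.
move=> n0 frame BK uK; have n0R : 0 < n%:R :> R by rewrite ltr0n.
split=> // x Kx; exists (- n%:R^-1 *: x); last first.
  by rewrite scaleNr opprK scalerA mulfV ?scale1r // gt_eqF.
apply: BK; rewrite /eball /= enormZ normrN gtr0_norm ?invr_gt0 //.
by rewrite ler_pdivrMl // mulr1; apply: (frame_bounded frame) => i; exact: uK.
Qed.

Lemma john_asymmetry_ge (I : finType) n (lam : I -> R) (u : I -> 'cV[R]_n)
    (K : set 'cV[R]_n) : (0 < n)%N -> john_frame lam u -> eball R n `<=` K ->
  (forall i x, K x -> dotp (u i) x <= 1) -> john_ellipsoid K = eball R n ->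
  0 <= john_asymmetry K /\ forall i x, K x -> - dotp (u i) x <= john_asymmetry K.
Proof.
move=> n0 frame BK uK KB; rewrite john_asymmetryE //.
have ne : asym_set K !=set0 by exists n%:R; exact: (asym_set_dim n0 frame BK uK).
split; first by apply: lb_le_inf => // r [].
move=> i x Kx; apply: lb_le_inf => // r [r0 /(_ x Kx)[y Ky <-]].
by rewrite dotpZr dotpNr mulrN opprK; have := uK i y Ky; nra.
Qed.

End JohnPosition.

(** * The volume bound and its equality case *)

Section VolumeBound.
Variable R : realType.

Lemma max_radius_gt0 n k (s : R) : (0 < n)%N -> (0 < k)%N -> 0 <= s -> 0 < max_radius n k s.
Proof.
move=> n0 k0 s0; rewrite sqrtr_gt0 mulr_gt0 ?divr_gt0 ?ltr0n //.
have n0R : 0 < n%:R :> R by rewrite ltr0n.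
have k0R : 0 < k%:R :> R by rewrite ltr0n.
by rewrite lt_min !divr_gt0 //; lra.
Qed.

Lemma max_radius_sqr n k (s : R) : (0 < n)%N -> (0 < k)%N -> 0 <= s ->
  k%:R * max_radius n k s ^+ 2 = n%:R * min_factor n k s.
Proof.
move=> n0 k0 s0; have k0R : 0 < k%:R :> R by rewrite ltr0n.
rewrite sqr_sqrtr; first by field; rewrite gt_eqF.
by have := max_radius_gt0 n0 k0 s0; rewrite sqrtr_gt0 => /ltW.
Qed.

Lemma trace_gt0 k (T : 'M[R]_k) : (0 < k)%N -> (forall i, 0 < T i i) -> 0 < \tr T.
Proof.
case: k T => // k T _ T0; rewrite /mxtrace big_ord_recl ltr_wpDr //.
by apply: sumr_ge0 => i _; exact: ltW.
Qed.

Section Body.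
Variables (I : finType) (n k : nat) (lam : I -> R) (u : I -> 'cV[R]_n).
Variables (K : set 'cV[R]_n) (s : R).
Hypotheses (n0 : (0 < n)%N) (k0 : (0 < k)%N) (s0 : 0 <= s).
Hypothesis frame : john_frame lam u.
Hypothesis uK : forall i x, K x -> dotp (u i) x <= 1.
Hypothesis us : forall i x, K x -> - dotp (u i) x <= s.
Variables (c : 'cV[R]_n) (A : 'M[R]_(n, k)).
Hypothesis inj : forall y : 'cV[R]_k, A *m y = 0 -> y = 0.
Hypothesis EK : [set c + A *m y | y in eball R k] `<=` K.

Let r := max_radius n k s.
Let r0 : 0 < r. Proof. exact: max_radius_gt0. Qed.
Let k0R : 0 < k%:R :> R. Proof. by rewrite ltr0n. Qed.

Let ha i : enorm (A^T *m u i) <= 1 - dotp (u i) c.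
Proof. by apply: width_le EK _ => x; exact: uK. Qed.

Let hs i : enorm (A^T *m u i) <= s + dotp (u i) c.
Proof.
have := @width_le _ _ _ _ _ _ (- u i) s EK; rewrite mulmxN enormN dotpNl opprK; apply.
by move=> x Kx; rewrite dotpNl; exact: us.
Qed.

Let kr : k%:R * (n%:R * min_factor n k s) = (k%:R * r) ^+ 2.
Proof. by rewrite -max_radius_sqr // -/r; ring. Qed.

Lemma kvol_le_ball :
  (kvol k [set (c + A *m y)%R | y in eball R k] <= (r ^+ k)%:E * leb (eball R k))%E.
Proof.
have [Q [T [QQ AE tT T0]]] := qr_decomposition inj.
have trE : \tr (Q^T *m A) = \tr T by rewrite AE mulmxA QQ mul1mx.
have P0 : 0 < \tr T by exact: trace_gt0.
have P0W := ltW P0; have rW := ltW r0; have kr0 : 0 <= k%:R * r by rewrite mulr_ge0.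
have mean0 : 0 <= \tr T / k%:R by rewrite divr_ge0.
have P0' : 0 < \tr (Q^T *m A) by rewrite trE.
have := frame_trace_le frame k0 QQ s0 P0' ha hs.
rewrite trE kr ler_pXn2r ?nnegrE // => Pr.
rewrite AE kvol_ellipsoid //; last exact: det_trig_gt0.
apply: lee_wpmul2r; first exact: leb_ge0.
rewrite lee_fin; apply: le_trans (det_le_trace tT T0).1 _.
by rewrite ler_pXn2r ?nnegrE // ler_pdivrMr // mulrC.
Qed.

Lemma kvol_eq_ball :
  kvol k [set (c + A *m y)%R | y in eball R k] = ((r ^+ k)%:E * leb (eball R k))%E ->
  exists Q, [/\ Q^T *m Q = 1%:M, A = r *: Q, Q^T *m c = 0,
      dotp c c = n%:R * (min_factor n k s - 1)
    & (s + 1) / 2 <= (n%:R + 1) / (k%:R + 1) -> forall i,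
      1 - dotp (u i) c = 0 \/ 1 - dotp (u i) c = (s + 1) / 2].
Proof.
have [Q [T [QQ AE tT T0]]] := qr_decomposition inj.
have trE : \tr (Q^T *m A) = \tr T by rewrite AE mulmxA QQ mul1mx.
have P0 : 0 < \tr T by exact: trace_gt0.
have P0W := ltW P0; have rW := ltW r0; have kr0 : 0 <= k%:R * r by rewrite mulr_ge0.
have mean0 : 0 <= \tr T / k%:R by rewrite divr_ge0.
have P0' : 0 < \tr (Q^T *m A) by rewrite trE.
have := frame_trace_le frame k0 QQ s0 P0' ha hs.
rewrite trE kr ler_pXn2r ?nnegrE // => Pr.
have Bfin := leb_eball_fin R k0; have B0 := leb_eball_gt0 R k0.
rewrite {1}AE kvol_ellipsoid //; last exact: det_trig_gt0.
have b0 : 0 < fine (leb (eball R k)) by rewrite -lte_fin fineK.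
rewrite -(fineK Bfin) -!EFinM => -[/(mulIf (lt0r_neq0 b0)) detr].
have Pr' : \tr T = k%:R * r.
  apply/le_anti; rewrite Pr /= mulrC -ler_pdivlMr //.
  rewrite -(@ler_pXn2r _ k) ?nnegrE // -detr.
  exact: (det_le_trace tT T0).1.
exists Q; have := frame_trace_eq frame k0 QQ s0 P0' ha hs.
rewrite trE kr Pr' => /(_ erefl)[AQ Qc cc hu]; split=> //.
by rewrite {1}AQ; congr (_ *: _); field; rewrite gt_eqF.
Qed.

End Body.

(** A Euclidean ball has the right volume as its Gram matrix [A^T A] is known; the
    converse is read off from the equality case of the trace inequalities. *)
Theorem ellipsoid_volume_bound n k (K E : set 'cV[R]_n) :
  (0 < n)%N -> (0 < k)%N -> convex_body K -> john_ellipsoid K = eball R n ->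
  ellipsoid k E -> E `<=` K ->
  let s := john_asymmetry K in
  (kvol k E <= leb (dilate (max_radius n k s) (eball R k)))%E /\
  (kvol k E = leb (dilate (max_radius n k s) (eball R k)) <->
   euclidean_ball k (max_radius n k s) E /\
   E `<=` [set x | dotp (ellipsoid_center k E) x
                   = n%:R * (min_factor n k s - 1)]).
Proof.
move=> n0 k0 cvK KB [c Ec] EK s.
have [BK [N [lam [u [frame uK]]]]] := john_ellipsoid_frame n0 cvK KB.
have [s0 us] := john_asymmetry_ge n0 frame BK uK KB; rewrite -/s in s0 us.
have cE := ellipsoid_centerE Ec.
have [A [injA EA]] := Ec; have inj := (inj_mulmx_eq0 A c).1 injA.
have EK' : [set c + A *m y | y in eball R k] `<=` K by rewrite -EA.
have r0 := max_radius_gt0 n0 k0 s0.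
rewrite leb_dilate // cE EA; split; first exact: (kvol_le_ball n0 k0 s0 frame uK us inj EK').
split.
  move=> /(kvol_eq_ball n0 k0 s0 frame uK us inj EK')[Q [QQ AQ Qc cc _]].
  split; first by rewrite AQ; exact: ball_euclidean.
  move=> _ [y yB <-] /=; rewrite dotpDr cc AQ -scalemxAl dotpZr.
  by rewrite dotpC dotp_adjoint Qc dotp0r mulr0 addr0.
move=> [/(euclidean_ball_gram r0 inj) AA _].
have [Q [T [QQ AE tT T0]]] := qr_decomposition inj.
have T0' := det_trig_gt0 tT T0.
rewrite AE kvol_ellipsoid //; congr ((_)%:E * _)%E.
have : \det (T^T *m T) = (max_radius n k s ^+ k) ^+ 2.
  rewrite (_ : T^T *m T = A^T *m A); last by rewrite AE trmx_mul mulmxA -(mulmxA T^T) QQ mulmx1.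
  by rewrite AA det_scalar -!exprM mulnC.
have rk0 := exprn_gt0 k r0.
by rewrite det_mulmx det_tr -expr2 => /eqP; rewrite eqrXn2 ?(ltW T0') ?(ltW rk0) // => /eqP.
Qed.

(** For [s] strictly between [1] and [1 + 2 / n] the center [c] would be nonzero
    of norm less than one, whereas some contact point [u] satisfies [u . c = 1]. *)
Lemma no_equality n k (K E : set 'cV[R]_n) : (0 < n)%N -> (0 < k <= n - 1)%N ->
  convex_body K -> john_ellipsoid K = eball R n -> ellipsoid k E -> E `<=` K ->
  kvol k E = leb (dilate (max_radius n k (john_asymmetry K)) (eball R k)) ->
  john_asymmetry K \notin `]1, 1 + 2 / n%:R[.
Proof.
move=> n0 /andP[k0 kn] cvK KB [c [A [injA EA]]] EK; set s := john_asymmetry K.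
have [BK [N [lam [u [frame uK]]]]] := john_ellipsoid_frame n0 cvK KB.
have [s0 us] := john_asymmetry_ge n0 frame BK uK KB; rewrite -/s in s0 us.
have inj := (inj_mulmx_eq0 A c).1 injA.
have EK' : [set c + A *m y | y in eball R k] `<=` K by rewrite -EA.
rewrite leb_dilate ?max_radius_gt0 // EA.
move=> /(kvol_eq_ball n0 k0 s0 frame uK us inj EK')[Q [_ _ _ cc hu]].
apply/negP; rewrite in_itv /= => /andP[s1 s2].
have n0R : 0 < n%:R :> R by rewrite ltr0n.
have k0R : 0 < k%:R :> R by rewrite ltr0n.
have kn1 : k%:R + 1 <= n%:R :> R by rewrite natr1 ler_nat; lia.
have s2n : (s - 1) * n%:R < 2 by rewrite -ltr_pdivlMr //; lra.
have fle : (s + 1) / 2 <= (n%:R + 1) / (k%:R + 1).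
  rewrite ler_pdivlMr; last by lra.
  have : (s + 1) / 2 * (k%:R + 1) <= (s + 1) / 2 * n%:R by rewrite ler_wpM2l //; lra.
  lra.
have {}cc : dotp c c = n%:R * ((s - 1) / 2).
  by rewrite cc /min_factor min_l //; field.
have [i ui] : exists i, dotp (u i) c = 1.
  apply: contrapT => /forallNP none.
  have : \sum_i lam i * dotp (u i) c = (1 - s) / 2 * n%:R.
    rewrite -(frame_sum frame) mulr_sumr; apply: eq_bigr => i _.
    case: (hu fle i) => h; first by case: (none i); lra.
    by rewrite mulrC; congr (_ * _); lra.
  rewrite (frame_lin frame) => h.
  have : 0 < (s - 1) * n%:R by rewrite mulr_gt0 // subr_gt0.
  by move: h; clear; lra.
have := cauchy_schwarz (u i) c; rewrite ui (enorm_eq1 (_ : dotp (u i) (u i) = 1)); last by case: frame.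
rewrite mul1r => c1; have := enorm_sqr c; rewrite cc.
by move: c1 s2n; clear; nra.
Qed.

End VolumeBound.

(** * Polytopes attaining the bound *)

Section Construction.
Variable R : realType.

(** The decomposition of the identity follows from its quadratic form. *)
Lemma john_frame_intro (I : finType) n (lam : I -> R) (u : I -> 'cV[R]_n) :
  (forall i, 0 < lam i) -> (forall i, dotp (u i) (u i) = 1) ->
  (forall x, \sum_i lam i * dotp (u i) x = 0) ->
  (forall x, \sum_i lam i * dotp (u i) x ^+ 2 = dotp x x) -> john_frame lam u.
Proof.
move=> lam0 u1 lin quad; split=> //.
  apply: dotp_ext => z; rewrite dotp0r -[RHS](lin z) dotp_sumr.
  by apply: eq_bigr => i _; rewrite dotpZr dotpC.
apply: mulmx_ext => i; set e := delta_mx i ord0; apply: dotp_ext => z.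
rewrite mul1mx mulmx_suml dotp_sumr.
transitivity (\sum_i lam i * (dotp (u i) z * dotp (u i) e)).
  apply: eq_bigr => j _; rewrite -scalemxAl dotpZr; congr (_ * _).
  rewrite -mulmxA [(u j)^T *m e]mx11_scalar mul_mx_scalar dotpZr mulrC dotpC.
  by congr (_ * _).
set X := \sum_i _.
have : dotp (z + e) (z + e) = dotp z z + 2 * X + dotp e e.
  rewrite -!quad /X mulr_sumr -!big_split /=; apply: eq_bigr => j _.
  rewrite dotpDr; ring.
have -> : dotp (z + e) (z + e) = dotp z z + 2 * dotp z e + dotp e e.
  by rewrite !dotpDl !dotpDr (dotpC e z); ring.
have two0 : 2 != 0 :> R by rewrite pnatr_eq0.
by move=> /addIr/addrI/(mulfI two0) ->.
Qed.

(** The ball is in John position by the upper inequalities alone; the lower ones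
    make the asymmetry at most [s], and equal to [s] as soon as one of them is
    an equality at some point of the polytope. *)
Section Polytope.
Variables (I : finType) (n : nat) (lam : I -> R) (u : I -> 'cV[R]_n) (s : R).
Hypotheses (n0 : (0 < n)%N) (s1 : 1 <= s).
Hypothesis frame : john_frame lam u.

Definition polytope : set 'cV[R]_n := [set x | forall i, - s <= dotp (u i) x <= 1].

Let u1 i : dotp (u i) (u i) = 1. Proof. by case: frame. Qed.

Lemma eball_polytope : eball R n `<=` polytope.
Proof.
move=> x; rewrite /eball /= => x1 i.
have := cauchy_schwarz (u i) x; have := cauchy_schwarzN (u i) x.
rewrite (enorm_eq1 (u1 i)) mul1r => h1 h2.
by rewrite (le_trans _ h1) ?lerN2 ?(le_trans x1) // (le_trans h2).
Qed.

Lemma polytope_le i x : polytope x -> dotp (u i) x <= 1.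
Proof. by move=> /(_ i)/andP[]. Qed.

Lemma cube_compact (a b : R) :
  compact [set x : 'cV[R]_n | forall i, a <= x i ord0 <= b].
Proof.
rewrite (_ : [set x | _] = trmx @` [set v : 'rV[R]_n | forall i, `[a, b]%classic (v ord0 i)]).
  apply: continuous_compact.
    by apply: continuous_subspaceT; apply: continuous_trmx => v; exact: cvg_id.
  by apply: (@rV_compact _ _ (fun=> `[a, b]%classic)) => _; exact: segment_compact.
apply/seteqP; split=> [x xab|_ [v vab <-] i].
  by exists x^T; rewrite ?trmxK // => i; rewrite mxE /= in_itv; exact: xab.
by rewrite mxE; have := vab i; rewrite /= in_itv.
Qed.

Lemma polytope_convex_body : convex_body polytope.
Proof.
have dotc w : continuous (fun x : 'cV[R]_n => dotp w x).
  by apply: continuous_dotp; [exact: cst_continuous|move=> x; exact: cvg_id].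
split.
- apply: (subclosed_compact _ (@cube_compact (- n%:R) n%:R)).
    rewrite (_ : polytope = \bigcap_(i in [set: I])
      ([set x | - s <= dotp (u i) x] `&` [set x | dotp (u i) x <= 1])); last first.
      apply/seteqP; split=> [x px i _|x px i]; first by have /andP[] := px i.
      by have [/= -> ->] := px i Logic.I.
    by apply: closed_bigI => i _; apply: closedI; [exact: closed_ge_continuous|
      exact: closed_le_continuous].
  move=> x px i; rewrite -ler_norml.
  have xn : enorm x <= n%:R by apply: (frame_bounded frame) => j; exact: polytope_le.
  have n0R : 0 <= n%:R :> R by [].
  have h : x i ord0 ^+ 2 <= enorm x ^+ 2.
    rewrite enorm_sqr dotpE (bigD1 i) //= -expr2 lerDl sumr_ge0 // => j _.
    by rewrite -expr2 sqr_ge0.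
  apply: le_trans xn; rewrite -(@ler_pXn2r _ 2) ?nnegrE ?enorm_ge0 //.
  by rewrite real_normK ?num_real.
- apply/convex_setP => x y t px py /andP[t0 t1] i.
  have /andP[x0 x1] := px i; have /andP[y0 y1] := py i.
  by rewrite dotpDr !dotpZr; apply/andP; split; nra.
- exists 0; apply: (filterS (P := [set x : 'cV[R]_n | dotp x x < 1])).
    by move=> x /= x1; apply: eball_polytope; rewrite /eball /= enorm_le1 ltW.
  apply: open_nbhs_nbhs; split; last by rewrite /= dotp0l ltr01.
  apply: (@open_comp _ _ (fun x : 'cV[R]_n => dotp x x) [set r | r < 1]).
    by move=> x _; apply: continuous_dotp => z; exact: cvg_id.
  exact: open_lt.
Qed.

Lemma polytope_john : john_ellipsoid polytope = eball R n.
Proof.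
apply: (john_frame_ellipsoid n0 frame eball_polytope) => i x; exact: polytope_le.
Qed.

Lemma polytope_asymmetry :
  (exists i x, polytope x /\ dotp (u i) x = - s) -> john_asymmetry polytope = s.
Proof.
move=> [i [x [px uxs]]]; have s0 : 0 < s by exact: lt_le_trans ltr01 s1.
rewrite (john_asymmetryE polytope_john).
have sS : asym_set polytope s.
  split; first exact: ltW.
  move=> z pz; exists (- s^-1 *: z); last first.
    by rewrite scaleNr opprK scalerA mulfV ?scale1r // gt_eqF.
  move=> j; have /andP[z0 z1] := pz j; rewrite dotpZr mulNr lerN2.
  rewrite ler_pdivrMl // lerNl ler_pdivlMl // mulrN1 z0 andbT.
  by apply: le_trans z1 _; rewrite -[leLHS]mulr1 ler_pM // ltW.
apply/le_anti/andP; split; first by apply: ge_inf => //; exists 0 => r [].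
apply: lb_le_inf; first by exists s.
move=> r [r0 /(_ x px)[y py xy]]; move: uxs; rewrite -xy dotpZr dotpNr.
by have := polytope_le i py; nra.
Qed.

End Polytope.

(** A family of vectors [y j] in the second factor of the product of [R ^ k] and
    [R ^ N] with weights [mu j], completed in the first factor by the vectors
    [p j *: +- e_l].  The polytope of the frame so obtained contains a ball
    parallel to the first factor, whose extent is governed by [p]. *)
Section Product.
Variables (J : finType) (k N : nat) (mu p : J -> R) (y : J -> 'cV[R]_N).
Hypothesis k0 : (0 < k)%N.
Hypothesis mu0 : forall j, 0 < mu j.
Hypothesis p0 : forall j, 0 <= p j.
Hypothesis py1 : forall j, p j ^+ 2 + dotp (y j) (y j) = 1.
Hypothesis mup : \sum_j mu j * p j ^+ 2 = k%:R.
Hypothesis muy : forall x, \sum_j mu j * dotp (y j) x = 0.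
Hypothesis muyy : forall x, \sum_j mu j * dotp (y j) x ^+ 2 = dotp x x.

Let I := (J * ('I_k * bool))%type.
Let k0R : 0 < k%:R :> R. Proof. by rewrite ltr0n. Qed.

Definition prod_vec (i : I) : 'cV[R]_(k + N) :=
  col_mx ((p i.1 * (-1) ^+ i.2.2) *: delta_mx i.2.1 ord0) (y i.1).
Definition prod_weight (i : I) : R := mu i.1 / (2 * k%:R).

Lemma dotp_col_mx (a c : 'cV[R]_k) (b d : 'cV[R]_N) :
  dotp (col_mx a b) (col_mx c d) = dotp a c + dotp b d.
Proof. by rewrite /dotp tr_col_mx mul_row_col mxE. Qed.

Lemma prod_dotp i x : dotp (prod_vec i) x =
  p i.1 * (-1) ^+ i.2.2 * (usubmx x) i.2.1 ord0 + dotp (y i.1) (dsubmx x).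
Proof. by rewrite -[x in LHS]vsubmxK dotp_col_mx dotpZl -colE_dotp. Qed.

Let sum_pair (F : J -> 'I_k -> bool -> R) :
  \sum_(i : I) F i.1 i.2.1 i.2.2 = \sum_j \sum_l (F j l true + F j l false).
Proof.
rewrite -(pair_bigA _ (fun j (lb : 'I_k * bool) => F j lb.1 lb.2)) /=.
apply: eq_bigr => j _; rewrite -(pair_bigA _ (fun l b => F j l b)) /=.
by apply: eq_bigr => l _; rewrite big_bool.
Qed.

Lemma prod_frame : john_frame prod_weight prod_vec.
Proof.
apply: john_frame_intro.
- by move=> i; rewrite divr_gt0 // mulr_gt0.
- move=> [j [l b]]; rewrite dotp_col_mx !dotpL -colE_dotp mxE !eqxx mulr1 -[RHS](py1 j) /=.
  by congr (_ + _); case: b; rewrite /= ?expr1 ?expr0; ring.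
- move=> x; under eq_bigr do rewrite prod_dotp.
  rewrite (sum_pair (fun j l (b : bool) => mu j / (2 * k%:R) *
    (p j * (-1) ^+ b * (usubmx x) l ord0 + dotp (y j) (dsubmx x)))).
  rewrite -[RHS](muy (dsubmx x)); apply: eq_bigr => j _.
  rewrite (eq_bigr (fun=> (mu j * dotp (y j) (dsubmx x)) / k%:R)).
    by rewrite sumr_const card_ord -[LHS]mulr_natr; field; rewrite gt_eqF.
  by move=> l _; rewrite /= expr1 expr0; field; rewrite gt_eqF.
- move=> x; under eq_bigr do rewrite prod_dotp.
  rewrite (sum_pair (fun j l (b : bool) => mu j / (2 * k%:R) *
    (p j * (-1) ^+ b * (usubmx x) l ord0 + dotp (y j) (dsubmx x)) ^+ 2)).
  rewrite -[x in RHS]vsubmxK dotp_col_mx -(muyy (dsubmx x)).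
  rewrite [dotp (usubmx x) _](_ : _ = \sum_j mu j * p j ^+ 2 / k%:R *
    dotp (usubmx x) (usubmx x)); last first.
    by rewrite -mulr_suml -mulr_suml mup; field; rewrite gt_eqF.
  rewrite -big_split /=; apply: eq_bigr => j _.
  rewrite [dotp (usubmx x) _]dotpE mulr_sumr (_ : mu j * dotp (y j) _ ^+ 2 =
    \sum_(l < k) mu j * dotp (y j) (dsubmx x) ^+ 2 / k%:R).
    rewrite -big_split /=; apply: eq_bigr => l _; rewrite expr1 expr0.
    by field; rewrite gt_eqF.
  by rewrite sumr_const card_ord -[RHS]mulr_natr; field; rewrite gt_eqF.
Qed.

Variables (cy : 'cV[R]_N) (s : R).
Hypothesis s1 : 1 <= s.
Let r := max_radius (k + N) k s.
(** The ball is centered at [(0, cy)]; its half-width in the direction of a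
    frame vector over [j] is [r * p j].  Its volume is extremal by the choice of
    the radius, so only the inclusion and the asymmetry have to be ensured. *)
Hypothesis ball_in : forall j, - s + r * p j <= dotp (y j) cy <= 1 - r * p j.
(** Two ways to find a point on one of the lower supporting hyperplanes: in the
    ball, or as the multiple by [- s] of a frame vector. *)
Hypothesis extreme : (exists j, dotp (y j) cy - r * p j = - s) \/
  (exists2 j0, p j0 = 0 & forall j, - s^-1 <= dotp (y j) (y j0)).

Let n0 : (0 < k + N)%N. Proof. by rewrite addn_gt0 k0. Qed.
Let s0 : 0 <= s. Proof. by apply: le_trans s1. Qed.
Let r0 : 0 < r. Proof. exact: max_radius_gt0. Qed.

Let c : 'cV[R]_(k + N) := col_mx 0 cy.
Let Q : 'M[R]_(k + N, k) := col_mx 1%:M 0.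

Let QQ : Q^T *m Q = 1%:M.
Proof. by rewrite tr_col_mx mul_row_col trmx1 mul1mx mulmx0 addr0. Qed.

Let prod_point i (z : 'cV[R]_k) : dotp (prod_vec i) (c + (Q *m r%:M) *m z) =
  p i.1 * (-1) ^+ i.2.2 * (r * z i.2.1 ord0) + dotp (y i.1) cy.
Proof.
have -> : c + (Q *m r%:M) *m z = col_mx (r *: z) cy.
  rewrite /c /Q mul_col_mx mul1mx mul0mx mul_col_mx mul0mx mul_scalar_mx.
  by rewrite add_col_mx add0r addr0.
by rewrite prod_dotp col_mxKu col_mxKd mxE.
Qed.

Let ball_polytope :
  [set c + (Q *m r%:M) *m z | z in eball R k] `<=` polytope prod_vec s.
Proof.
move=> _ [z zB <-] i; rewrite prod_point.
have z1 : `|z i.2.1 ord0| <= 1.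
  rewrite -(@ler_pXn2r _ 2) ?nnegrE // expr1n real_normK ?num_real //.
  have : dotp z z <= 1 by rewrite -enorm_le1.
  apply: le_trans; rewrite dotpE (bigD1 i.2.1) //= -expr2 lerDl sumr_ge0 // => j _.
  by rewrite -expr2 sqr_ge0.
have : `|p i.1 * (-1) ^+ i.2.2 * (r * z i.2.1 ord0)| <= r * p i.1.
  rewrite !normrM normrX normrN normr1 expr1n mulr1 (ger0_norm (p0 _)) (gtr0_norm r0).
  by rewrite mulrA (mulrC (p _)) -[leRHS]mulr1 ler_wpM2l // mulr_ge0 // ltW.
have /andP[] := ball_in i.1; rewrite ler_norml => h1 h2 /andP[h3 h4].
by apply/andP; split; lra.
Qed.

Let extreme_point :
  exists i x, polytope prod_vec s x /\ dotp (prod_vec i) x = - s.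
Proof.
pose l0 : 'I_k := Ordinal k0.
case: extreme => [[j js]|[j0 pj0 yj0]].
  exists (j, (l0, true)), (c + (Q *m r%:M) *m delta_mx l0 ord0); split.
    apply: ball_polytope; exists (delta_mx l0 ord0) => //.
    by rewrite /eball /= enorm_le1 -colE_dotp mxE !eqxx.
  by rewrite prod_point /= mxE !eqxx /= mulr1 expr1 -js; ring.
have v1 i : dotp (prod_vec i) (prod_vec i) = 1 by case: prod_frame.
exists (j0, (l0, true)), (- s *: prod_vec (j0, (l0, true))); split; last first.
  by rewrite dotpZr v1 mulr1.
move=> i; have s0' : 0 < s by exact: lt_le_trans ltr01 s1.
have := cauchy_schwarz (prod_vec i) (prod_vec (j0, (l0, true))).
rewrite !(enorm_eq1 (v1 _)) mulr1 dotpZr => h1.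
have h2 : - s^-1 <= dotp (prod_vec i) (prod_vec (j0, (l0, true))).
  by rewrite /prod_vec dotp_col_mx /= pj0 mul0r scale0r dotp0r add0r.
have h3 : - 1 <= s * dotp (prod_vec i) (prod_vec (j0, (l0, true))).
  by rewrite -(mulfV (lt0r_neq0 s0')) -mulrN ler_pM2l.
by apply/andP; split; nra.
Qed.

Lemma product_attains : exists K E : set 'cV[R]_(k + N),
  [/\ convex_body K, john_ellipsoid K = eball R (k + N), john_asymmetry K = s,
      ellipsoid k E /\ E `<=` K
    & kvol k E = leb (dilate (max_radius (k + N) k s) (eball R k))].
Proof.
exists (polytope prod_vec s), [set c + (Q *m r%:M) *m z | z in eball R k]; split.
- exact: (polytope_convex_body s1 prod_frame).
- exact: (polytope_john n0 s1 prod_frame).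
- exact: (polytope_asymmetry n0 s1 prod_frame).
- split=> //; exists c, (Q *m r%:M); split=> //; apply/inj_mulmx_eq0 => z.
  rewrite -mulmxA mul_scalar_mx => /(congr1 (mulmx Q^T)).
  rewrite mulmxA QQ mul1mx mulmx0 => /eqP.
  by rewrite scaler_eq0 gt_eqF //= => /eqP.
- by rewrite kvol_ellipsoid ?det_scalar ?exprn_gt0 // leb_dilate.
Qed.

End Product.
End Construction.

(** * The extremal frames *)

Section Attained.
Variable R : realType.

(** For [m < N] these are the vertices of a regular simplex in a hyperplane
    orthogonal to the all-ones vector; each has scalar product [b] with it. *)
Definition simplex_vec N (al b : R) (m : 'I_N) : 'cV[R]_N :=
  al *: delta_mx m ord0 + ((b - al) / N%:R) *: const_mx 1.

Lemma dotp_ones N (x : 'cV[R]_N) : dotp (const_mx 1) x = \sum_m x m ord0.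
Proof. by rewrite dotpE; apply: eq_bigr => m _; rewrite mxE mul1r. Qed.

Lemma simplex_vecE N al b (m : 'I_N) x : dotp (simplex_vec al b m) x =
  al * x m ord0 + (b - al) / N%:R * dotp (const_mx 1) x.
Proof. by rewrite dotpDl !dotpZl -colE_dotp. Qed.

Lemma simplex_vec_sum N al b (x : 'cV[R]_N) : (0 < N)%N ->
  \sum_m dotp (simplex_vec al b m) x = b * dotp (const_mx 1) x.
Proof.
move=> N0; have N0R : N%:R != 0 :> R by rewrite pnatr_eq0 -lt0n.
under eq_bigr do rewrite simplex_vecE.
rewrite big_split /= -mulr_sumr -dotp_ones sumr_const card_ord -[X in _ + X]mulr_natr.
by field.
Qed.

Lemma simplex_vec_sqr N al b (x : 'cV[R]_N) : (0 < N)%N ->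
  \sum_m dotp (simplex_vec al b m) x ^+ 2 =
  al ^+ 2 * dotp x x + (b ^+ 2 - al ^+ 2) / N%:R * dotp (const_mx 1) x ^+ 2.
Proof.
move=> N0; have N0R : N%:R != 0 :> R by rewrite pnatr_eq0 -lt0n.
set S := dotp (const_mx 1) x; set be := (b - al) / N%:R.
transitivity (al ^+ 2 * dotp x x + 2 * al * be * S * S + (be * S) ^+ 2 *+ N).
  rewrite (_ : (be * S) ^+ 2 *+ N = \sum_(m < N) (be * S) ^+ 2); last first.
    by rewrite sumr_const card_ord.
  rewrite {2}/S dotp_ones dotpE !mulr_sumr -!big_split /=; apply: eq_bigr => m _.
  by rewrite simplex_vecE -/S -/be; ring.
by rewrite -[_ *+ N]mulr_natr /be; field.
Qed.

Lemma simplex_vec_dotp N al b al' b' (m m' : 'I_N) :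
  dotp (simplex_vec al b m) (simplex_vec al' b' m') =
  al * al' * (m == m')%:R + (b * b' - al * al') / N%:R.
Proof.
have N0R : N%:R != 0 :> R by case: N m m' => [[]//|N] _ _; rewrite pnatr_eq0.
rewrite simplex_vecE /simplex_vec dotpDr !dotpZr dotp_ones !mxE.
have -> : \sum_(i < N) (delta_mx m' ord0 : 'cV[R]_N) i ord0 = 1.
  rewrite (bigD1 m') //= mxE !eqxx big1 ?addr0 // => i im.
  by rewrite mxE (negbTE im).
have -> : dotp (const_mx 1) (const_mx 1 : 'cV[R]_N) = N%:R.
  by rewrite dotp_ones; under eq_bigr do rewrite mxE; rewrite sumr_const card_ord.
by rewrite andbT; field.
Qed.

Definition attained n k (s : R) : Prop := exists K E : set 'cV[R]_n,
  [/\ convex_body K, john_ellipsoid K = eball R n, john_asymmetry K = s,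
      ellipsoid k E /\ E `<=` K
    & kvol k E = leb (dilate (max_radius n k s) (eball R k))].

Section Dim.
Variables (k N : nat).
Hypotheses (k0 : (0 < k)%N) (N0 : (0 < N)%N).
Let k0R : 0 < k%:R :> R. Proof. by rewrite ltr0n. Qed.
Let N0R : 0 < N%:R :> R. Proof. by rewrite ltr0n. Qed.
Let N1R : 1 <= N%:R :> R. Proof. by rewrite ler1n. Qed.
Let n := (k + N)%N.
Let nE : n%:R = k%:R + N%:R :> R. Proof. by rewrite /n natrD. Qed.
Let n0R : 0 < n%:R :> R. Proof. by rewrite nE addr_gt0. Qed.

(** The contact points combine the vertices of two cross-polytopes, so that the
    body is centrally symmetric. *)
Lemma attained_symmetric : attained n k 1.
Proof.
pose p : R := Num.sqrt (k%:R / n%:R); pose z : R := Num.sqrt (N%:R / n%:R).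
have p2 : p ^+ 2 = k%:R / n%:R by rewrite sqr_sqrtr // divr_ge0 // ltW.
have z2 : z ^+ 2 = N%:R / n%:R by rewrite sqr_sqrtr // divr_ge0 // ltW.
have rp : max_radius n k 1 * p = 1.
  rewrite /max_radius /min_factor min_l; last first.
    rewrite ler_pdivlMr; last by rewrite addr_gt0.
    by rewrite nE; have := N1R; lra.
  rewrite -sqrtrM; last by rewrite !mulr_ge0 ?invr_ge0 ?ltW // addr_gt0.
  rewrite (_ : _ * _ = 1) ?sqrtr1 //; field; rewrite !gt_eqF //.
pose J := ('I_N * bool)%type.
pose mu (_ : J) : R := n%:R / (2 * N%:R).
pose y (j : J) : 'cV[R]_N := (z * (-1) ^+ j.2) *: delta_mx j.1 ord0.
have yE j x : dotp (y j) x = z * (-1) ^+ j.2 * x j.1 ord0.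
  by rewrite dotpZl -colE_dotp.
have sum_pair (F : 'I_N -> bool -> R) :
    \sum_(j : J) F j.1 j.2 = \sum_l (F l true + F l false).
  rewrite -(pair_bigA _ (fun l b => F l b)) /=.
  by apply: eq_bigr => l _; rewrite big_bool.
apply: (@product_attains R J k N mu (fun=> p) y k0 _ _ _ _ _ _ 0).
- by move=> j; rewrite divr_gt0 // mulr_gt0.
- by move=> j; rewrite sqrtr_ge0.
- move=> [l b]; rewrite yE mxE /= mxE !eqxx p2.
  have -> : k%:R / n%:R + z * (-1) ^+ b * (z * (-1) ^+ b * true%:R) = k%:R / n%:R + z ^+ 2.
    by case: b; rewrite /= ?expr1 ?expr0; ring.
  by rewrite z2 nE; field; rewrite -nE gt_eqF.
- transitivity (\sum_(j : J) (n%:R / (2 * N%:R) * p ^+ 2)); first by [].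
  rewrite sumr_const card_prod card_ord card_bool p2 -[LHS]mulr_natr natrM.
  by field; rewrite !gt_eqF.
- move=> x; under eq_bigr do rewrite yE.
  rewrite (sum_pair (fun l (b : bool) => n%:R / (2 * N%:R) * (z * (-1) ^+ b * x l ord0))).
  by rewrite big1 // => l _; rewrite /= expr1 expr0; ring.
- move=> x; under eq_bigr do rewrite yE.
  rewrite (sum_pair (fun l (b : bool) => n%:R / (2 * N%:R) * (z * (-1) ^+ b * x l ord0) ^+ 2)).
  rewrite dotpE; apply: eq_bigr => l _; rewrite /= expr1 expr0.
  transitivity (n%:R / N%:R * z ^+ 2 * (x l ord0 * x l ord0)).
    by field; rewrite gt_eqF.
  by rewrite z2; field; rewrite !gt_eqF.
- exact: lexx.
- by move=> j; rewrite dotp0r rp addNr subrr lexx.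
- by left; exists (Ordinal N0, true); rewrite dotp0r rp sub0r.
Qed.

Section Simplices.
Variable s : R.
Hypothesis s_ge : 1 + 2 / n%:R <= s.
Hypothesis s_le : s <= n%:R.

(** The equality case suggests the frame.  The center [c] of the ball has
    [|c| ^ 2 = n (f - 1)], and is taken along the all-ones vector [1], i.e.
    [c = t 1] with [t ^ 2 N = n (f - 1)].  A contact point [u] either is
    orthogonal to the ball, with [u . c = 1], or has [u . c = 1 - f], and then its
    component along the ball has length [p] with [r p = f].  The weights [w] and
    the scalar products [b] with [1] follow from [\sum lam u = 0] and from the
    decomposition of the identity in the direction of [c], and the
    coefficients [al] from the normalization of the contact points. *)
Let f := min_factor n k s.

Let f_ge : 1 + n%:R^-1 <= f.
Proof.
rewrite /f /min_factor le_min; apply/andP; split.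
  by rewrite ler_pdivlMr //; move: s_ge; lra.
have k1 : 0 < k%:R + 1 :> R by rewrite addr_gt0.
rewrite ler_pdivlMr // -[X in X + _](mulfV (lt0r_neq0 n0R)) -[X in _ + X]mul1r -mulrDl.
rewrite mulrAC ler_pdivrMr // ler_pM2l; last by rewrite addr_gt0.
by rewrite nE lerD2l.
Qed.

Let f_le1 : f <= (s + 1) / 2. Proof. by rewrite ge_min lexx. Qed.
Let f_le2 : f * (k%:R + 1) <= n%:R + 1.
Proof. by rewrite -ler_pdivlMr ?addr_gt0 // ge_min lexx orbT. Qed.

Let nf : 1 <= n%:R * (f - 1).
Proof.
have : n%:R * (1 + n%:R^-1) <= n%:R * f by rewrite ler_pM2l.
by rewrite mulrDr mulr1 mulfV ?gt_eqF // mulrBr mulr1 lerBrDr addrC.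
Qed.

Let f1 : 0 < f - 1.
Proof. by rewrite -(pmulr_rgt0 _ n0R); apply: lt_le_trans nf. Qed.
Let f0 : 0 < f.
Proof. by rewrite -(subrK 1 f) addr_gt0. Qed.

(** Squared lengths, orthogonally to the all-ones vector, of the second
    components of the two groups of contact points; [true] is the group of those
    not orthogonal to the ball. *)
Let z0 : R := 1 - (n%:R * (f - 1))^-1.
Let z1 : R := (n%:R + 1 - f * (k%:R + 1)) / n%:R.
Let t : R := Num.sqrt (n%:R * (f - 1) / N%:R).
Let al (g : bool) : R := Num.sqrt ((if g then z1 else z0) * (N%:R / (N%:R - 1))).
Let b (g : bool) : R := if g then - (f - 1) / t else t^-1.
Let p (g : bool) : R := if g then Num.sqrt (f * k%:R / n%:R) else 0.
Let w (g : bool) : R := n%:R / (f * N%:R) * (if g then 1 else f - 1).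
Let J := (bool * 'I_N)%type.
Let y (j : J) := simplex_vec (al j.1) (b j.1) j.2.

Let t0 : 0 < t. Proof. by rewrite sqrtr_gt0 divr_gt0 // mulr_gt0. Qed.
Let t2 : t ^+ 2 = n%:R * (f - 1) / N%:R.
Proof. by rewrite sqr_sqrtr // divr_ge0 ?mulr_ge0 // ltW. Qed.
Let p2 : p true ^+ 2 = f * k%:R / n%:R.
Proof. by rewrite sqr_sqrtr // divr_ge0 ?mulr_ge0 // ltW. Qed.
Let b2 g : b g ^+ 2 = N%:R * (if g then (f - 1) / n%:R else (n%:R * (f - 1))^-1).
Proof.
rewrite /b; case: g.
  by rewrite exprMn sqrrN exprVn t2; field; rewrite !gt_eqF.
by rewrite exprVn t2; field; rewrite !gt_eqF.
Qed.

Let z_ge0 g : 0 <= if g then z1 else z0.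
Proof.
case: g; rewrite /z1 /z0; first by rewrite divr_ge0 ?subr_ge0 ?(ltW n0R).
by rewrite subr_ge0 invf_le1 // (lt_le_trans ltr01 nf).
Qed.

(* In dimension one nothing is orthogonal to the all-ones vector. *)
Let z_N1 : N = 1%N -> z0 = 0 /\ z1 = 0.
Proof.
move=> N1; have nk : n%:R = k%:R + 1 :> R by rewrite nE N1.
have k1 : 0 < k%:R + 1 :> R by rewrite addr_gt0.
have nfE : n%:R * (f - 1) = 1.
  by apply/le_anti; rewrite nf andbT; move: f_le2; rewrite nk; lra.
have fE : f = 1 + (k%:R + 1)^-1.
  apply: (mulfI (lt0r_neq0 n0R)); rewrite -[f](subrK 1) mulrDr nfE nk.
  by field; rewrite gt_eqF.
rewrite /z0 /z1 nfE invr1 subrr; split=> //.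
by rewrite fE nk; field; rewrite gt_eqF.
Qed.

Let al2 g : al g ^+ 2 * (1 - N%:R^-1) = if g then z1 else z0.
Proof.
rewrite /al sqr_sqrtr; last by rewrite mulr_ge0 ?z_ge0 // divr_ge0 ?subr_ge0 // ltW.
have [N1|N1] := eqVneq N 1%N.
  by have [-> ->] := z_N1 N1; case: g; rewrite !mul0r.
have N1' : N%:R - 1 != 0 :> R by rewrite subr_eq0 -[1]/(1%:R) eqr_nat.
by field; rewrite N1' gt_eqF.
Qed.

Let sum_J (F : bool -> 'I_N -> R) :
  \sum_(j : J) F j.1 j.2 = \sum_l F true l + \sum_l F false l.
Proof. by rewrite -(pair_bigA _ (fun g l => F g l)) /= big_bool. Qed.

Let yy1 j : p j.1 ^+ 2 + dotp (y j) (y j) = 1.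
Proof.
rewrite simplex_vec_dotp eqxx mulr1.
have -> : al j.1 * al j.1 + (b j.1 * b j.1 - al j.1 * al j.1) / N%:R =
  al j.1 ^+ 2 * (1 - N%:R^-1) + b j.1 ^+ 2 / N%:R by field; rewrite gt_eqF.
rewrite al2 b2; case: (j.1).
  by rewrite p2 /z1; field; rewrite !gt_eqF.
by rewrite /p /z0; field; rewrite !gt_eqF.
Qed.

Let weights : w true * al true ^+ 2 + w false * al false ^+ 2 = 1 \/ N = 1%N.
Proof.
have [->|N1] := eqVneq N 1%N; [by right|left].
have N1' : 1 - N%:R^-1 != 0 :> R.
  rewrite subr_eq0 eq_sym invr_eq1 -[1]/(1%:R) eqr_nat //.
apply: (mulIf N1'); rewrite mulrDl -(mulrA (w true)) -(mulrA (w false)) !al2 /w /z1 /z0 mul1r mulr1.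
have kE : k%:R = n%:R - N%:R :> R by rewrite nE addrK.
by rewrite kE; field; rewrite !gt_eqF.
Qed.

Let weights_b : w true * b true ^+ 2 + w false * b false ^+ 2 = 1.
Proof. by rewrite !b2 /w; field; rewrite !gt_eqF. Qed.

Lemma attained_simplices : attained n k s.
Proof.
have n1 : 1 <= s by apply: le_trans s_ge; rewrite lerDl divr_ge0 // ltW.
have rp g : max_radius n k s * p g = if g then f else 0.
  case: g; last by rewrite mulr0.
  rewrite /max_radius -/f -sqrtrM; last by rewrite !mulr_ge0 ?invr_ge0 // ltW.
  have -> : n%:R / k%:R * f * (f * k%:R / n%:R) = f ^+ 2 by field; rewrite !gt_eqF.
  by rewrite sqrtr_sqr gtr0_norm.
have yc j : dotp (y j) (t *: const_mx 1) = if j.1 then 1 - f else 1.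
  rewrite dotpZr simplex_vecE mxE dotp_ones; under eq_bigr do rewrite mxE.
  rewrite sumr_const card_ord mulr1 mulfVK ?gt_eqF // addrC subrK /b.
  by case: (j.1); field; rewrite gt_eqF.
apply: (@product_attains R J k N (fun j => w j.1) (fun j => p j.1) y k0
  _ _ yy1 _ _ _ (t *: const_mx 1) s n1).
- move=> j; rewrite /w mulr_gt0 // ?divr_gt0 ?mulr_gt0 //.
  by case: (j.1).
- by move=> j; rewrite /p; case: (j.1); rewrite ?sqrtr_ge0.
- rewrite (sum_J (fun g _ => w g * p g ^+ 2)) !sumr_const card_ord p2 /p /w expr0n mulr0 mul0rn addr0.
  by rewrite -[LHS]mulr_natr; field; rewrite !gt_eqF.
- move=> x; rewrite (sum_J (fun g l => w g * dotp (simplex_vec (al g) (b g) l) x)).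
  rewrite -!mulr_sumr !simplex_vec_sum // !mulrA -mulrDl.
  rewrite [X in X * _](_ : _ = 0) ?mul0r // /w /b.
  by field; rewrite !gt_eqF.
- move=> x; rewrite (sum_J (fun g l => w g * dotp (simplex_vec (al g) (b g) l) x ^+ 2)).
  rewrite -!mulr_sumr !simplex_vec_sqr //.
  set S := dotp (const_mx 1) x; set D := dotp x x.
  transitivity ((w true * al true ^+ 2 + w false * al false ^+ 2) * (D - S ^+ 2 / N%:R)
    + (w true * b true ^+ 2 + w false * b false ^+ 2) * S ^+ 2 / N%:R).
    by field; rewrite gt_eqF.
  rewrite weights_b; case: weights => [->|N1]; first by ring.
  have -> : D = S ^+ 2.
    rewrite /D /S dotp_ones dotpE; move: (x); rewrite N1 => x'.
    by rewrite !big_ord1 expr2.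
  by rewrite N1 divr1 subrr mulr0 add0r mul1r invr1 mulr1.
- move=> j; rewrite rp yc; have := f_le1; have := f0.
  by case: (j.1) => h1 h2; apply/andP; split; lra.
(* If [f = (s + 1) / 2], the ball touches the lower hyperplanes of the first
   group, as [1 - 2 f = - s]; if [f = (n + 1) / (k + 1)], the second
   components of the first group have collapsed to one vector, and the scalar
   product of a vector of the second group with another frame vector is at
   least [- 1 / n]. *)
have [hf|hf] := leP ((s + 1) / 2) ((n%:R + 1) / (k%:R + 1)).
  left; exists (true, Ordinal N0); rewrite rp yc /=.
  have -> : f = (s + 1) / 2 by rewrite /f /min_factor min_l.
  by field.
right; exists (false, Ordinal N0) => // -[g m].
have k1 : 0 < k%:R + 1 :> R by rewrite addr_gt0.
have fE : f = (n%:R + 1) / (k%:R + 1) by rewrite /f /min_factor min_r // ltW.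
have z1E : z1 = 0 by rewrite /z1 fE divfK ?gt_eqF // subrr mul0r.
have al1 : al true = 0 by rewrite /al z1E mul0r sqrtr0.
apply: (@le_trans _ _ (- n%:R^-1)).
  by rewrite lerN2 lef_pV2 // posrE (lt_le_trans ltr01 n1).
rewrite simplex_vec_dotp /=; case: g.
  rewrite al1 !mul0r add0r subr0 /b.
  have -> : - (f - 1) / t * t^-1 = - ((f - 1) / t ^+ 2) by field; rewrite gt_eqF.
  by rewrite t2 le_eqVlt; apply/orP; left; apply/eqP; field; rewrite !gt_eqF.
have [_|mm] := eqVneq m (Ordinal N0).
  have := yy1 (false, Ordinal N0); rewrite simplex_vec_dotp eqxx /= expr0n add0r => ->.
  by apply: le_trans ler01; rewrite oppr_le0 invr_ge0 ltW.
have N1 : N != 1%N.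
  by apply: contraNneq mm => N1; apply/eqP/val_inj => /=; have := ltn_ord m; rewrite {2}N1; case: (val m).
have N1' : 1 - N%:R^-1 != 0 :> R by rewrite subr_eq0 eq_sym invr_eq1 -[1]/(1%:R) eqr_nat.
have f1E : f - 1 = N%:R / (k%:R + 1) by rewrite fE nE; field; rewrite gt_eqF.
have al0 : al false * al false = (n%:R + 1) / n%:R.
  apply: (mulIf N1'); rewrite -expr2 al2 /z0 f1E nE; field.
  by rewrite -nE !gt_eqF.
have b0 : b false * b false = (k%:R + 1) / n%:R.
  by rewrite -expr2 b2 f1E; field; rewrite !gt_eqF.
rewrite al0 b0 mulr0 add0r le_eqVlt; apply/orP; left; apply/eqP.
by rewrite nE; field; rewrite -nE !gt_eqF.
Qed.

End Simplices.
End Dim.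
End Attained.

Unset Implicit Arguments.
Set Strict Implicit.

Theorem theorem1p4 (R : realType) (n k : nat)
    (hn : (2 <= n)%N) (hk : (1 <= k <= n - 1)%N) :
  (forall K E : set 'cV[R]_n,
     convex_body K -> john_ellipsoid K = eball R n ->
     ellipsoid k E -> E `<=` K ->
     let s := john_asymmetry K in
     (kvol k E <= leb (dilate (max_radius n k s) (eball R k)))%E /\
     (kvol k E = leb (dilate (max_radius n k s) (eball R k)) <->
      euclidean_ball k (max_radius n k s) E /\
      E `<=` [set x | dotp (ellipsoid_center k E) x
                      = n%:R * (min_factor n k s - 1)])) /\
  (forall s : R, 1 <= s <= n%:R ->
     ((exists K E : set 'cV[R]_n,
         [/\ convex_body K, john_ellipsoid K = eball R n, john_asymmetry K = s,
             ellipsoid k E /\ E `<=` K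
           & kvol k E = leb (dilate (max_radius n k s) (eball R k))]) <->
      s \notin `]1, 1 + 2 / n%:R[)).
Proof.
have n0 : (0 < n)%N by apply: leq_trans hn.
have /andP[k0 kn] := hk.
split=> [K E cvxK jK ellE EK|s /andP[s1 sn]].
  exact: ellipsoid_volume_bound.
split=> [[K [E [cvxK jK <- [ellE EK] volE]]]|s_gap].
  exact: (no_equality n0 hk cvxK jK ellE EK volE).
have [N nE] : exists N, n = (k + N)%N by exists (n - k)%N; lia.
have N0 : (0 < N)%N by lia.
subst n.
have [-> |s_neq1] := eqVneq s 1; first exact: attained_symmetric.
apply: attained_simplices => //; rewrite leNgt; apply: contra s_gap => s_lt.
by rewrite in_itv /= s_lt andbT lt_neqAle eq_sym s_neq1.
Qed.
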